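(* Let $k$ be an algebraically closed field with $\operatorname{char}k\ne 2$, let $N\ge 3$, let $G=\mathrm{O}_N(k)$, and let $d=(d_{-s},\dots,d_s)$ be a proper orthogonal dimension vector with $\sum_i d_i=N$. Let $D(d)$ be the labelled line diagram attached to $d$ (as constructed in the context), and let $$x=\sum \epsilon_{i,j}\,e_{i,j},$$ where the sum is over all arrows from the vertex labelled $i$ to the vertex labelled $j$ in $D(d)$. Then $x$ is a Richardson element for the parabolic subgroup $P(d)$ of $G$; that is, $x$ lies in the Lie algebra $\mathfrak u$ of the unipotent radical of $P(d)$ and the orbit $P(d)\cdot x$ is open and dense in $\mathfrak u$.
   Context: **Setup.** Let $n=\lfloor N/2\rfloor$. Let $V=k^N$ have basis $v_{-n},\dots,v_{-1},v_0,v_1,\dots,v_n$ ($v_0$ and the index $0$ are omitted everywhere if $N$ is even) and symmetric bilinear form given by $(v_0,v_{\pm i})=0$, $(v_0,v_0)=1$, $(v_i,v_j)=(v_{-i},v_{-j})=0$, $(v_i,v_{-j})=\delta_{i,j}$ for $1\le i,j\le n$. $G=\mathrm{O}_N(k)$ is the isometry group, with Lie algebra $\mathfrak{so}_N(k)$, acted on by the adjoint action. Let $e_{i,j}$ be the linear map of $V$ sending $v_i$ to $v_j$ and all other basis vectors to $0$. A Chevalley basis of $\mathfrak{so}_N(k)$ is $$\{e_{i,j}-e_{-j,-i}\}_{1\le i,j\le n}\cup\{e_{i,-j}-e_{j,-i},\ e_{-j,i}-e_{-i,j}\}_{1\le i<j\le n}\cup\{e_{k,0}-e_{0,-k},\ e_{0,k}-e_{-k,0}\}_{1\le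 k\le n}$$ (last family omitted if $N$ is even), and $\epsilon_{i,j}=\pm1$ denotes the coefficient of $e_{i,j}$ in this basis if it appears. **Dimension vectors and parabolics.** Given $(d_1,\dots,d_s)\in\mathbb Z_{\ge0}^s$ with $\sum_{i=1}^s d_i\le n$, put $d_0=N-2\sum_{i=1}^s d_i$ and $d_{-i}=d_i$; then $d=(d_{-s},\dots,d_s)$ is an orthogonal dimension vector. It is proper if $d_i\neq0$ for all $i\ne0$ and, in case $2\sum_{i=1}^s d_i=N$, also $d_1\neq1$. Put $c_i=\lfloor d_0/2\rfloor+\sum_{j=1}^{i-1}d_j$ for $1\le i\le s+1$ and let $V_{-i}$ be the span of $v_{-n},v_{-n+1},\dots,v_{-c_i-1}$. $P(d)$ is the stabilizer in $G$ of the isotropic flag $0=V_{-(s+1)}\subseteq V_{-s}\subseteq\dots\subseteq V_{-1}$. **Small diagrams.** Let $f=(f_{-s},\dots,f_s)$ be an orthogonal dimension vector (of some size, zero entries allowed) with all entries in $\{0,1,2\}$ such that if $f_0=1$ then all nonzero entries are $1$. Define an (unlabelled) diagram $D(f)$ of vertices in the plane and arrows: Case 1: $f_0=1$ and all nonzero entries are $1$. Vertices at $(i,0)$ for all $i$ with $f_i=1$. From each vertex except the leftmost, draw an arrow to the next vertex to its left. Case 2: $f_0=2$. Vertices at $(i,1)$ and $(-i,-1)$ for $i\ge0$ with $f_i\neq0$, and at $(i,-1)$ and $(-i,1)$ for $i>0$ with $f_i=2$. From each vertex that is not leftmost in its row, draw an arrow to the next vertex to its left in its row. If some $f_i=1$,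 let $l>0$ be minimal with $f_l\ne0$ and draw additional arrows from $(l,1)$ to $(0,-1)$ and from $(0,1)$ to $(-l,-1)$. Case 3: $f_0=0$. Vertices at $(i,1)$ and $(-i,-1)$ for $i>0$ with $f_i\ne0$, and at $(i,-1)$ and $(-i,1)$ for $i>0$ with $f_i=2$. From each vertex that is not leftmost in its row, draw an arrow to the next vertex to its left in its row. If four or more entries of $f$ equal $1$, let $0<l<l'$ be the two smallest positive indices with $f_l,f_{l'}\ne0$ and draw additional arrows from $(l,1)$ to $(-l',-1)$ and from $(l',1)$ to $(-l,-1)$. **Decomposition of $d$.** A proper $d$ is decomposed as $d=d^0+d^1+\dots+d^m$ as follows. Initially set $d^0=0$. Suppose $d^0,\dots,d^{j-1}$ ($j\ge1$) are defined and let $c^j=d-\sum_{i=0}^{j-1}d^i$. Case A: $c^j_0>0$ and all nonzero entries of $c^j$ are $\ge2$. Put $d^j_i=0$ if $c^j_i=0$, and $d^j_i=2$ if $c^j_i\ge2$. Case B: $c^j_0>0$ is odd and $c^j$ has an entry equal to $1$. (Then necessarily $d^0=0$ so far.) Redefine $d^0$ by $d^0_i=0$ if $c^j_i=0$, and $d^0_i=1$ if $c^j_i\ge1$; then update $c^j$ (i.e. recompute $c^j=d-\sum_{i=0}^{j-1}d^i$ with the new $d^0$) and continue with the same $j$. Case C: $c^j_0>0$ is even and $c^j$ has an entry equal to $1$. Let $a$ be the least positive even entry of $c^j$. Put $d^j_i=0$ if $c^j_i=0$; $d^j_i=1$ if $c^j_i\in\{1,3,\dots,a-1\}$; $d^j_i=2$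 if $c^j_i\ge a$. Case D: $c^j_0=0$. Put $d^j_i=0,1,2$ according as $c^j_i=0$, $c^j_i=1$, $c^j_i\ge2$. Continue until $c^j=0$. **The diagram $D(d)$.** If $d_0$ is odd, draw the small diagram $D(d^0)$; if $d_0$ is even then $d^0=0$ and nothing is drawn at this step. Then for each $j=1,\dots,m$ insert the small diagram $D(d^j)$ stretched vertically so that a vertex at $(i,\pm1)$ is moved to $(i,\pm j)$, arrows being stretched accordingly. Finally label the $N$ vertices by $-n,\dots,n$ (omitting $0$ if $N$ is even) so that labels increase from left to right and, within each column (fixed first coordinate), from bottom to top. *)

(* Defs.v *)
From HB Require Import structures.
From mathcomp Require Import all_boot all_order all_algebra.
From mathcomp Require Import mpoly.

Set Implicit Arguments.
Unset Strict Implicit.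
Unset Printing Implicit Defensive.

Import Order.TTheory GRing.Theory Num.Theory.

Local Open Scope ring_scope.

(*  A linear map f of k^N is represented by the matrix A with f u = u *m A for
    every row vector u; the matrix of a composite f \o g is thus B *m A, where
    A and B are the matrices of f and g. Varieties are represented by their
    k-points, which is harmless over an algebraically closed field. *)

Section AlgebraicGroups.

Variables (k : closedFieldType) (N : nat).

Implicit Types (A g h X : 'M[k]_N) (H K P S U Z : 'M[k]_N -> Prop).
Implicit Types (f : {mpoly k[N * N]}).

Definition mxeval A f : k := f.@[fun l => mxvec A 0 l].

(* The derivative of f at A in the direction X. *)
Definition mxdiff A X f : k := \sum_(l < N * N) mxeval A f^`M(l) * mxvec X 0 l.

Definition zclosed Z : Prop :=
  exists F : {mpoly k[N * N]} -> Prop,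
    forall A, Z A <-> forall f, F f -> mxeval A f = 0.

(* The subspace topology on Y: relatively open and dense subsets of Y. *)
Definition open_in (Y O : 'M[k]_N -> Prop) : Prop :=
  (forall A, O A -> Y A) /\
  exists2 Z, zclosed Z & forall A, Y A -> (O A <-> ~ Z A).

Definition dense_in (Y O : 'M[k]_N -> Prop) : Prop :=
  (forall A, O A -> Y A) /\
  forall Z, zclosed Z -> (forall A, O A -> Z A) -> forall A, Y A -> Z A.

Definition zconnected S : Prop :=
  forall Z1 Z2, zclosed Z1 -> zclosed Z2 ->
    (forall A, S A -> Z1 A \/ Z2 A) ->
    (forall A, S A -> ~ (Z1 A /\ Z2 A)) ->
    (forall A, S A -> Z1 A) \/ (forall A, S A -> Z2 A).

Definition is_subgroup H : Prop :=
  [/\ forall g, H g -> g \in unitmx,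
      H 1%:M,
      forall g h, H g -> H h -> H (g *m h)
    & forall g, H g -> H (invmx g)].

(* Every zero set in GL_N of functions f / det^m, with f polynomial, is also
   the zero set in GL_N of polynomials. *)
Definition closed_subgroup H : Prop :=
  is_subgroup H /\
  exists2 Z, zclosed Z & forall g, g \in unitmx -> (H g <-> Z g).

Definition normal_in U P : Prop :=
  (forall g, U g -> P g) /\
  forall g h, P g -> U h -> U (invmx g *m h *m g).

Definition unipotent_mx g : Prop := exists m : nat, (g - 1%:M) ^+ m = 0.

Definition is_unipotent_group U : Prop := forall g, U g -> unipotent_mx g.

Definition connected_normal_unipotent P U : Prop :=
  [/\ closed_subgroup U, zconnected U, normal_in U P & is_unipotent_group U].

(* U is the largest closed connected normal unipotent subgroup of P. *)
Definition is_unipotent_radical P U : Prop :=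
  connected_normal_unipotent P U /\
  forall K, connected_normal_unipotent P K -> forall g, K g -> U g.

(* The tangent space of H at the identity, as a subspace of gl_N. *)
Definition Lie H X : Prop :=
  forall f, (forall g, H g -> mxeval g f = 0) -> mxdiff 1%:M X f = 0.

(* The matrix of the linear map g \o X \o g^-1. *)
Definition Ad g X : 'M[k]_N := invmx g *m X *m g.

Definition Ad_orbit P X Y : Prop := exists2 g, P g & Y = Ad g X.

Definition Richardson P X : Prop :=
  exists U, is_unipotent_radical P U /\
    [/\ Lie U X, open_in (Lie U) (Ad_orbit P X) & dense_in (Lie U) (Ad_orbit P X)].

End AlgebraicGroups.

(*  The basis v_{-n}, ..., v_n of k^N is the standard basis, in that order. *)

Section Orthogonal.

Variables (k : closedFieldType) (N : nat).

(* The index in {-n, ..., n} of the a-th basis vector, 0 <= a < N, where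
   n = N./2; the index 0 is skipped if N is even. *)
Definition lab (a : nat) : int :=
  if odd N || (a < N./2)%N then a%:Z - N./2%:Z else a%:Z - N./2%:Z + 1.

(* v_i |-> v_j, all other basis vectors |-> 0. *)
Definition emx (i j : int) : 'M[k]_N :=
  \matrix_(a, b) ((lab a == i) && (lab b == j))%:R.

Definition form_mx : 'M[k]_N := \matrix_(a, b) (lab a + lab b == 0)%:R.

Definition orthogonal_group (g : 'M[k]_N) : Prop :=
  g *m form_mx *m g^T = form_mx.

(* The pair (p, q) stands for the basis element e_p - e_q. *)
Definition Chevalley_basis : seq ((int * int) * (int * int)) :=
  let n := N./2 in
  [seq ((i%:Z, j%:Z), (- j%:Z, - i%:Z)) | i <- iota 1 n, j <- iota 1 n]
  ++ flatten [seq [:: ((i%:Z, - j%:Z), (j%:Z, - i%:Z));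
                      ((- j%:Z, i%:Z), (- i%:Z, j%:Z))]
             | i <- iota 1 n, j <- [seq j <- iota 1 n | (i < j)%N]]
  ++ (if odd N then
        flatten [seq [:: ((l%:Z, 0), (0, - l%:Z)); ((0, l%:Z), (- l%:Z, 0))]
                | l <- iota 1 n]
      else [::]).

(* The coefficient of e_{i,j} in the Chevalley basis, 0 if it does not occur. *)
Definition eps (i j : int) : int :=
  if (i, j) \in unzip1 Chevalley_basis then 1
  else if (i, j) \in unzip2 Chevalley_basis then -1 else 0.

End Orthogonal.

(*  As f_{-i} = f_i, the vector (f_{-s}, ..., f_s) is represented by the
    sequence [:: f_0; f_1; ...; f_s]. *)

Definition dimvec := seq nat.

Implicit Types (c d f : dimvec).

Definition bound f : nat := (size f).-1.

Definition entry f (i : int) : nat := nth 0%N f `|i|%N.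

Definition indices f : seq int :=
  [seq i%:Z - (bound f)%:Z | i <- iota 0 (bound f).*2.+1].

Definition orth_dimvec (N : nat) (t : seq nat) : dimvec :=
  (N - (sumn t).*2)%N :: t.

(* d_0 = 0 if and only if 2 (d_1 + ... + d_s) = N. *)
Definition proper_dimvec d : Prop :=
  (forall i : int, i \in indices d -> i != 0 -> entry d i <> 0%N) /\
  (entry d 0 = 0%N -> entry d 1 <> 1%N).

Section Parabolic.

Variables (k : closedFieldType) (N : nat) (d : dimvec).

Definition cpart (i : nat) : nat :=
  ((entry d 0)./2 + \sum_(1 <= j < i) entry d j)%N.

(* V_{-i} as a row space. *)
Definition flag (i : nat) : 'M[k]_N :=
  (\sum_(a < N | (lab N a <= - (cpart i)%:Z - 1)%R) <<delta_mx 0 a : 'rV_N>>)%MS.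

Definition parabolic (g : 'M[k]_N) : Prop :=
  orthogonal_group g /\
  forall i : nat, (1 <= i <= (bound d).+1)%N ->
    (flag i *m g == flag i)%MS.

End Parabolic.

Arguments parabolic : clear implicits.

Definition vertex := (int * int)%type.
Definition arrow := (vertex * vertex)%type.
Definition diagram := (seq vertex * seq arrow)%type.

Definition row_arrows (vs : seq vertex) : seq arrow :=
  [seq (p, q) | p <- vs,
     q <- [seq q <- vs | [&& q.2 == p.2, q.1 < p.1
            & ~~ has (fun r : vertex => (r.2 == p.2) && (q.1 < r.1 < p.1)) vs]]].

Definition two_row_vertices f : seq vertex :=
  [seq (i, 1) | i <- indices f & (0 <= i) && (entry f i != 0%N)]
  ++ [seq (- i, -1) | i <- indices f & (0 <= i) && (entry f i != 0%N)]
  ++ [seq (i, -1) | i <- indices f & (0 < i) && (entry f i == 2%N)]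
  ++ [seq (- i, 1) | i <- indices f & (0 < i) && (entry f i == 2%N)].

(* The positive indices i with f_i <> 0, in increasing order. *)
Definition pos_support f : seq int :=
  [seq i <- indices f | (0 < i) && (entry f i != 0%N)].

Definition small_diagram f : diagram :=
  if entry f 0 == 1%N then
    let vs := [seq (i, 0) | i <- indices f & entry f i == 1%N] in
    (vs, row_arrows vs)
  else
    let vs := two_row_vertices f in
    let l := nth 0 (pos_support f) 0 in
    let l' := nth 0 (pos_support f) 1 in
    let extra : seq arrow :=
      if entry f 0 == 2%N then
        if has (fun i => entry f i == 1%N) (indices f) then
          [:: ((l, 1), (0, -1)); ((0, 1), (- l, -1))]
        else [::]
      else
        if (4 <= count (fun i => entry f i == 1%N) (indices f))%N then
          [:: ((l, 1), (- l', -1)); ((l', 1), (- l, -1))]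
        else [::] in
    (vs, row_arrows vs ++ extra).

Definition sub_dimvec c f : dimvec := [seq (p.1 - p.2)%N | p <- zip c f].

Definition least_even c : nat :=
  head 0%N (sort leq [seq x <- c | (0 < x)%N && ~~ odd x]).

Definition stepA c : dimvec := [seq if x == 0 then 0 else 2 | x <- c]%N.
Definition stepB c : dimvec := [seq if x == 0 then 0 else 1 | x <- c]%N.
Definition stepC c : dimvec :=
  [seq if x == 0 then 0 else if x < least_even c then 1 else 2 | x <- c]%N.
Definition stepD c : dimvec := [seq minn x 2%N | x <- c].

(* Given c^j and the current d^0, returns the final d^0 and d^j, ..., d^m.
   Every step decreases the sum of the entries of c^j, so [sumn c] is enough
   fuel. *)
Fixpoint decompose_rec (fuel : nat) (c d0 : dimvec) : dimvec * seq dimvec :=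
  if fuel is fuel'.+1 then
    if all (pred1 0%N) c then (d0, [::])
    else if entry c 0 == 0%N then
      let r := decompose_rec fuel' (sub_dimvec c (stepD c)) d0 in
      (r.1, stepD c :: r.2)
    else if all (fun x => (x == 0%N) || (2 <= x)%N) c then
      let r := decompose_rec fuel' (sub_dimvec c (stepA c)) d0 in
      (r.1, stepA c :: r.2)
    else if odd (entry c 0) then
      decompose_rec fuel' (sub_dimvec c (stepB c)) (stepB c)
    else
      let r := decompose_rec fuel' (sub_dimvec c (stepC c)) d0 in
      (r.1, stepC c :: r.2)
  else (d0, [::]).

Definition decompose d : dimvec * seq dimvec :=
  decompose_rec (sumn d) d (nseq (size d) 0%N).

Definition stretch_vertex (j : nat) (p : vertex) : vertex := (p.1, p.2 * j%:Z).

Definition stretch (j : nat) (D : diagram) : diagram :=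
  ([seq stretch_vertex j p | p <- D.1],
   [seq (stretch_vertex j a.1, stretch_vertex j a.2) | a <- D.2]).

Definition line_diagram d : diagram :=
  let: (d0, ds) := decompose d in
  let Ds := (if odd (entry d 0) then [:: small_diagram d0] else [::])
    ++ [seq stretch j.+1 (small_diagram (nth [::] ds j)) | j <- iota 0 (size ds)] in
  (flatten (unzip1 Ds), flatten (unzip2 Ds)).

(* Left to right, and bottom to top within each column. *)
Definition vertex_le (p q : vertex) : bool :=
  (p.1 < q.1) || (p.1 == q.1) && (p.2 <= q.2).

Definition label (N : nat) (D : diagram) (p : vertex) : int :=
  lab N (index p (sort vertex_le D.1)).

Definition labelled_arrows (N : nat) (D : diagram) : seq (int * int) :=
  [seq (label N D a.1, label N D a.2) | a <- D.2].

Definition diagram_elt (k : closedFieldType) (N : nat) d : 'M[k]_N :=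
  \sum_(a <- labelled_arrows N (line_diagram d))
    (eps N a.1 a.2)%:~R *: emx k N a.1 a.2.

(* Main.v *)
(* Let [col a] be the abscissa of the vertex labelled by the [a]-th basis vector.
   Then [P(d)] is the group of the isometries which are block triangular for the
   grading of [k^N] by [col]. Its unipotent radical [U] consists of those with
   identity diagonal blocks: if [K] is normal unipotent in [P(d)], then the
   commutators of its elements with root elements and reflections have trace [N],
   which leaves no room in the diagonal blocks.

   The orbit of [x] is dense and open in the Lie algebra [uu] of [U] as soon as
   the map [z |-> [x, z]] from [pp = Lie P(d)] to [uu] is onto: by differentiating
   along Cayley curves, the partial derivatives of a polynomial which vanishes on
   the orbit vanish there too, hence the polynomial is zero, as in characteristic
   [p] a polynomial without derivatives is a [p]-th power. By quantifier
   elimination, a dense orbit contains an open set, hence it is open.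

   By duality for the trace form, this map is onto if every skew [w] such that
   [[w, x]] is strictly triangular is triangular. In terms of the alternating form
   [om(p, q) = (w p, q)] on the vertices, [om(x p, q) + om(p, x q) = 0] whenever
   [p] and [q] have abscissas of sum [<= 0], and [om(p, q) = 0] is to be shown if
   the sum is [< 0]. Along a row of the diagram which meets the column opposite to
   [p], this goes by induction from [-p] to the left (a ladder). The vectors of
   the decomposition of [d] are nested in such a way that ladders always exist,
   except near the arrows between two rows of a small diagram, where one uses that
   the coefficients of [x] are skew, and for the pairs [(p, p)], where [om] is
   alternating. *)

Require Import Defs.
From HB Require Import structures.
From mathcomp Require Import all_boot all_order all_algebra.
From mathcomp Require Import all_field mpoly zify ring.

Set Implicit Arguments.
Unset Strict Implicit.
Unset Printing Implicit Defensive.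

Import Order.TTheory GRing.Theory Num.Theory.

(** * Germs of rational functions *)

Section Germs.
Local Open Scope ring_scope.
Variable k : closedFieldType.

(** The curves are Cayley transforms rather than exponentials: for skew [z],
    [(1 - t z)^-1 (1 + t z)] is an isometry in every characteristic, while exponentials need
    factorials to be invertible. Its velocity at 0 is [2 z], which explains many of the halves
    below. Such curves have poles, hence the calculus with numerators and denominators. Surjectivity
    of the commutator map is proved instead of a count of dimensions, since in characteristic [p] an
    orbit can be dense although the differential of the orbit map is not onto. Polynomials here have
    all the [N * N] matrix entries as variables while the orbit lies in the subspace [uu]; the
    tangent argument is therefore applied to the preimage of the orbit under a linear projection
    onto [uu]. For the unipotent radical, each test element of [P(d)] yields a polynomial identity
    on a single element of [K]. Root elements do not suffice in the middle block, which may be an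
    orthogonal group of dimension 1 or 2; reflections exist as soon as this block is nonzero. *)

Lemma poly_eq0_fun (p : {poly k}) : (forall t, p.[t] = 0) -> p = 0.
Proof.
move=> p0; apply/eqP/negPn/negP=> pn0.
have sp : (1 < size p)%N.
  rewrite ltn_neqAle eq_sym size_poly_gt0 pn0 andbT.
  apply/negP=> /size_poly1P [c cn0 pc].
  by have := p0 0; rewrite pc hornerC => /eqP; rewrite (negPf cn0).
(* At a root of [p + 1] the value of [p] is -1. *)
have /closed_rootP [x] : size (p + 1) != 1%N.
  by rewrite size_polyDl ?size_poly1 // neq_ltn sp orbT.
by rewrite /root hornerD hornerC p0 add0r oner_eq0.
Qed.

Lemma poly_neq0_fun (p : {poly k}) : p != 0 -> exists t, p.[t] != 0.
Proof.
move=> pn0; apply/(closed_nonrootP _ pn0).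
Qed.

(* [f] agrees near [0] with a rational function regular at [0], with value [a]
   and derivative [b] there. *)
Definition germ (f : k -> k) (a b : k) : Prop :=
  exists p q : {poly k},
    [/\ q.[0] = 1, forall t, q.[t] != 0 -> f t * q.[t] = p.[t],
        a = p.[0] & b = p^`().[0] - a * q^`().[0]].

(** Multiplied by [q q' r], the difference [p q' - p' q] vanishes at every [t], so it is the zero
    polynomial; its value and its derivative at 0 give the two equalities. *)
Lemma germ_uniq f g a b a' b' (r : {poly k}) :
  germ f a b -> germ g a' b' -> r.[0] != 0 ->
  (forall t, r.[t] != 0 -> f t = g t) -> a = a' /\ b = b'.
Proof.
move=> [p [q [q0 fq -> ->]]] [p' [q' [q'0 gq -> ->]]] r0 fg.
have e : p * q' = p' * q.
  have nz : q * q' * r != 0.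
    by apply/eqP=> /(congr1 (horner^~ 0)); rewrite /= !hornerE q0 q'0 !mul1r => /eqP; rewrite (negPf r0).
  apply: (mulIf nz); apply/eqP; rewrite -subr_eq0; apply/eqP/poly_eq0_fun=> t.
  rewrite !hornerE /=.
  case: (eqVneq q.[t] 0) => [->|qt]; first by ring.
  case: (eqVneq q'.[t] 0) => [->|qt']; first by ring.
  case: (eqVneq r.[t] 0) => [->|rt]; first by ring.
  by rewrite -fq // -gq // fg //; ring.
have := congr1 (horner^~ 0) e; have := congr1 (fun u => (u^`()).[0]) e.
rewrite /= !derivM !hornerE q0 q'0 !mulr1 => e2 e1; split=> //.
rewrite e1 in e2 *.
suff -> : p^`().[0] = p'^`().[0] + p'.[0] * q^`().[0] - p'.[0] * q'^`().[0] by ring.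
by rewrite -e2; ring.
Qed.

Lemma germ_ext f g a b : f =1 g -> germ f a b -> germ g a b.
Proof.
by move=> fg [p [q [h1 h2 h3 h4]]]; exists p, q; split=> // t; rewrite -fg; apply: h2.
Qed.

Lemma germ_poly (p : {poly k}) : germ (fun t => p.[t]) p.[0] p^`().[0].
Proof. exists p, 1%:P; split=> [|t _||]; rewrite ?derivC ?hornerC ?mulr1 ?mulr0 ?subr0 //. Qed.

Lemma germ_const c : germ (fun=> c) c 0.
Proof.
have := germ_poly c%:P; rewrite derivC !hornerE.
by apply: germ_ext=> t; rewrite hornerE.
Qed.

Lemma germ_id : germ id 0 1.
Proof.
have := germ_poly 'X; rewrite derivX !hornerE.
by apply: germ_ext=> t; rewrite hornerE.
Qed.

Lemma germD f g a b a' b' : germ f a b -> germ g a' b' ->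
  germ (fun t => f t + g t) (a + a') (b + b').
Proof.
move=> [p [q [q0 fq -> ->]]] [p' [q' [q'0 gq -> ->]]].
exists (p * q' + p' * q), (q * q'); split.
- by rewrite !(hornerD, hornerM) q0 q'0 mulr1.
- move=> t; rewrite !(hornerD, hornerM) mulf_eq0 negb_or => /andP [h1 h2].
  rewrite -fq // -gq //; ring.
- by rewrite !(hornerD, hornerM) q0 q'0 !mulr1.
- by rewrite !derivD !derivM !(hornerD, hornerM) q0 q'0; ring.
Qed.

Lemma germM f g a b a' b' : germ f a b -> germ g a' b' ->
  germ (fun t => f t * g t) (a * a') (b * a' + a * b').
Proof.
move=> [p [q [q0 fq -> ->]]] [p' [q' [q'0 gq -> ->]]].
exists (p * p'), (q * q'); split.
- by rewrite !(hornerD, hornerM) q0 q'0 mulr1.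
- move=> t; rewrite !(hornerD, hornerM) mulf_eq0 negb_or => /andP [h1 h2].
  by rewrite -fq // -gq //; ring.
- by rewrite !(hornerD, hornerM).
- by rewrite !derivM !(hornerD, hornerM) q0 q'0; ring.
Qed.

Lemma germ_sum (I : finType) (f : I -> k -> k) (a b : I -> k) :
  (forall i, germ (f i) (a i) (b i)) ->
  germ (fun t => \sum_i f i t) (\sum_i a i) (\sum_i b i).
Proof.
move=> fab; elim: (index_enum I) => [|i s IH].
  rewrite !big_nil; apply: germ_ext (germ_const 0) => t.
  by rewrite big_nil.
rewrite !big_cons; apply: germ_ext (germD (fab i) IH) => t.
by rewrite big_cons.
Qed.

(** Used for the chain rule and for substitutions, which need to be checked only on constants,
    variables, sums and products. *)
Lemma mpoly_ring_ind n (P : {mpoly k[n]} -> Prop) :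
  (forall c, P c%:MP) -> (forall i, P 'X_i) ->
  (forall p q, P p -> P q -> P (p + q)) ->
  (forall p q, P p -> P q -> P (p * q)) -> forall p, P p.
Proof.
move=> PC PX PD PM p; rewrite (mpolyE p).
elim: (msupp p) => [|m s IH]; first by rewrite big_nil -mpolyC0.
rewrite big_cons; apply: (PD) => //; rewrite -mul_mpolyC; apply: (PM) => //.
rewrite mpolyXE_id; elim: (index_enum _) => [|i r IHr].
  by rewrite big_nil -mpolyC1.
rewrite big_cons; apply: (PM) => //; elim: (m i) => [|j IHj].
  by rewrite expr0 -mpolyC1.
by rewrite exprS; apply: (PM).
Qed.

(** The chain rule, with formal partial derivatives. *)
Lemma germ_meval n (f : {mpoly k[n]}) (c : 'I_n -> k -> k) (v w : 'I_n -> k) :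
  (forall i, germ (c i) (v i) (w i)) ->
  germ (fun t => f.@[fun i => c i t]) f.@[v] (\sum_i f^`M(i).@[v] * w i).
Proof.
move=> cvw; elim/mpoly_ring_ind: f => [a|i|p q IHp IHq|p q IHp IHq].
- rewrite mevalC big1 => [|i _]; last by rewrite mderivC meval0 mul0r.
  by apply: germ_ext (germ_const a) => t; rewrite mevalC.
- rewrite mevalXU (bigD1 i) //= big1 => [|j ji]; last first.
    by rewrite mderivX mnm1E eq_sym (negPf ji) scale0r meval0 mul0r.
  rewrite mderivX mnm1E eqxx scale1r.
  have -> : (U_(i) - U_(i))%MM = 0%MM :> 'X_{1..n}.
    by apply/mnmP=> j; rewrite mnmBE mnm0E subnn.
  rewrite mpolyX0 meval1 mul1r addr0.
  by apply: germ_ext (cvw i) => t; rewrite mevalXU.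
- rewrite mevalD.
  have -> : \sum_i (p + q)^`M(i).@[v] * w i =
      \sum_i p^`M(i).@[v] * w i + \sum_i q^`M(i).@[v] * w i.
    by rewrite -big_split; apply: eq_bigr => i _; rewrite mderivD mevalD mulrDl.
  by apply: germ_ext (germD IHp IHq) => t; rewrite mevalD.
- rewrite mevalM.
  have -> : \sum_i (p * q)^`M(i).@[v] * w i =
      (\sum_i p^`M(i).@[v] * w i) * q.@[v] + p.@[v] * \sum_i q^`M(i).@[v] * w i.
    rewrite mulr_suml mulr_sumr -big_split; apply: eq_bigr => i _ /=.
    by rewrite mderivM mevalD !mevalM; ring.
  by apply: germ_ext (germM IHp IHq) => t; rewrite mevalM.
Qed.

(* If all partial derivatives of [F] vanish, then [F] is constant in
   characteristic [0] and a [p]-th power in characteristic [p]. *)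
Lemma mderiv0_root n (F : {mpoly k[n]}) :
  (forall i, F^`M(i) = 0) -> (1 < msize F)%N ->
  exists (G : {mpoly k[n]}) (e : nat),
    [/\ (msize G < msize F)%N, F = G ^+ e & (0 < e)%N].
Proof.
move=> dF sF.
(* The derivative in the variable [i] has at [m - U_(i)] the coefficient [m i] times [F@_m]: every
   exponent that occurs in [F] is zero in [k]. *)
have dF' m i : m \in msupp F -> (m i)%:R = 0 :> k.
  move=> mF; case: (posnP (m i)) => [->//|mi].
  have /mpolyP /(_ (m - U_(i))%MM) := dF i.
  rewrite mcoeff_deriv mcoeff0 submK; last first.
    by rewrite lep1mP -lt0n.
  rewrite mnmBE mnm1E eqxx subn1 prednK // => /eqP.
  by rewrite -[_ *+ _]mulr_natr mulf_eq0; move: mF; rewrite mcoeff_msupp => /negPf -> /= /eqP.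
have [m mF [i mi]] : exists2 m, m \in msupp F & exists i, (0 < m i)%N.
  have : (1 < \max_(m <- msupp F) (mdeg m).+1)%N by rewrite -msizeE.
  elim: (msupp F) => [|m s IH]; first by rewrite big_nil.
  rewrite big_cons; case: (posnP (mdeg m)) => [->|dm _].
    by rewrite leq_max ltnn /= => /IH [m' h1 h2]; exists m'; rewrite // in_cons h1 orbT.
  exists m; first by rewrite mem_head.
  apply/existsP; apply: contraTT dm; rewrite negb_exists -leqNgt leqn0 mdegE.
  move=> /forallP h; rewrite sum_nat_eq0; apply/forallP=> i.
  by have := h i; rewrite -leqNgt leqn0.
have [p pch] : exists p, p \in [pchar k]%R.
  by have /eqP := dF' m i mF; move/(natf0_pchar mi).
have pp : prime p := pcharf_prime pch.
have p0 : (0 < p)%N := prime_gt0 pp.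
have dvd j m' : m' \in msupp F -> (p %| m' j)%N.
  by move=> m'F; rewrite (dvdn_pcharf pch); apply/eqP/dF'.
have rootP (c : k) : exists b, b ^+ p = c.
  have /closed_rootP [b] : size ('X^p - c%:P) != 1%N.
    by rewrite size_XnsubC // eqSS -lt0n.
  by rewrite /root hornerD hornerN hornerC hornerXn subr_eq0 => /eqP; exists b.
have pchM : p \in [pchar {mpoly k[n]}]%R.
  rewrite inE pp -mpolyC_nat (pcharf0 pch) mpolyC0 eqxx //.
have frobD (x y : {mpoly k[n]}) : (x + y) ^+ p = x ^+ p + y ^+ p.
  by have := pFrobenius_autD_comm pchM (mulrC x y).
(* A [p]-th root is built monomial by monomial: exponents are divided by [p] and coefficients
   replaced by [p]-th roots. As [msize] is the degree plus one, the bound says [p deg G <= deg F],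
   in a form which also covers [G = 0]. *)
have [G GE sG] : exists2 G : {mpoly k[n]},
    \sum_(m <- msupp F) F@_m *: 'X_[m] = G ^+ p &
    (msize G * p <= msize F + p.-1)%N.
  have : {subset msupp F <= msupp F} by [].
  elim: {1 3}(msupp F) => [|m' s IH] sF'.
    exists 0; first by rewrite big_nil expr0n gtn_eqF.
    by rewrite msize0.
  have [|G GE sG] := IH; first by move=> x xs; apply: sF'; rewrite in_cons xs orbT.
  have m'F : m' \in msupp F by apply: sF'; rewrite mem_head.
  have [b bE] := rootP F@_m'.
  pose q : 'X_{1..n} := [multinom (m' j %/ p)%N | j < n].
  have qE : m' = (q *+ p)%MM.
    by apply/mnmP=> j; rewrite mulmnE mnmE divnK // dvd.
  exists (b *: 'X_[q] + G).
    by rewrite big_cons GE frobD exprZn bE mpolyXn -qE.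
  have sq : (msize (b *: 'X_[k, q]) * p <= msize F + p.-1)%N.
    have sm : (msize (b *: 'X_[k, q]) <= (mdeg q).+1)%N.
      by apply: leq_trans (msizeZ_le _ _) _; rewrite msizeX.
    apply: leq_trans (leq_mul sm (leqnn p)) _.
    have := msize_mdeg_lt m'F; rewrite qE mdegMn; nia.
  case: (leqP (msize (b *: 'X_[k, q])) (msize G)) => h.
    apply: leq_trans sG; rewrite leq_mul2r (leq_trans (msizeD_le _ _)) ?orbT //.
    by rewrite geq_max h leqnn.
  apply: leq_trans sq; rewrite leq_mul2r (leq_trans (msizeD_le _ _)) ?orbT //.
  by rewrite geq_max leqnn ltnW.
exists G, p; split=> //; last by rewrite -GE -mpolyE.
have := prime_gt1 pp; move: sF sG; case: (msize G) => [|g]; nia.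
Qed.

(* The hypothesis says that [S] is smooth of full dimension at each point. *)
Lemma mpoly_eq0_dominant n (S : ('I_n -> k) -> Prop) :
  (exists v, S v) ->
  (forall F : {mpoly k[n]}, (forall v, S v -> F.@[v] = 0) ->
     forall i v, S v -> F^`M(i).@[v] = 0) ->
  forall F : {mpoly k[n]}, (forall v, S v -> F.@[v] = 0) -> F = 0.
Proof.
move=> [v0 Sv0] dS F; have [m] := ubnP (msize F).
elim: m F => // m IH F; rewrite ltnS => sF F0.
case: (leqP (msize F) 1) => [/msize1_polyC FE|sF1].
  by have := F0 _ Sv0; rewrite FE mevalC => ->; rewrite mpolyC0.
(* The partial derivatives vanish on [S] as well and have smaller degree, so the induction applies
   to them. *)
have dF i : F^`M(i) = 0.
  apply: IH => [|v Sv]; last exact: dS.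
  apply: leq_trans sF; rewrite msizeE -(prednK (ltnW sF1)) ltnS.
  apply/bigmax_leqP_seq=> m' m'd _; have m'F : (m' + U_(i))%MM \in msupp F.
    move: m'd; rewrite !mcoeff_msupp mcoeff_deriv; apply: contra => /eqP ->.
    by rewrite mul0rn.
  by have := msize_mdeg_lt m'F; rewrite mdegD mdeg1; lia.
have [G [e [sG FE e0]]] := mderiv0_root dF sF1.
rewrite FE (IH G) ?expr0n ?gtn_eqF //.
  exact: leq_trans sG sF.
move=> v Sv; have /eqP := F0 v Sv; rewrite FE rmorphXn expf_eq0 => /andP [_ /eqP] //.
Qed.
End Germs.

(** * Chevalley's theorem by quantifier elimination *)

Section Constructible.
Local Open Scope ring_scope.
Variable k : closedFieldType.
Implicit Types (t : GRing.term k) (f : GRing.formula k).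

Lemma nth_codom_ord (T : Type) (x0 : T) n (v : 'I_n -> T) (i : 'I_n) :
  nth x0 (codom v) i = v i.
Proof.
by rewrite codomE (nth_map i) ?size_enum_ord // nth_ord_enum.
Qed.

Lemma rterm_mpoly n t : GRing.rterm t ->
  exists p : {mpoly k[n]}, forall v, GRing.eval (codom v) t = p.@[v].
Proof.
elim: t => //=.
(* Variables of index at least [n] read the default value 0 of [nth]. *)
- move=> i _; case: (ltnP i n) => [lt_in|le_ni].
    exists 'X_(Ordinal lt_in) => v.
    by rewrite mevalXU -(nth_codom_ord 0 v (Ordinal lt_in)).
  exists 0 => v; rewrite meval0 nth_default // size_codom card_ord //.
- by move=> c _; exists c%:MP => v; rewrite mevalC.
- by move=> m _; exists (m%:R)%:MP => v; rewrite mevalC.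
- move=> t1 IH1 t2 IH2 /andP [/IH1 [p1 h1] /IH2 [p2 h2]].
  by exists (p1 + p2) => v; rewrite mevalD h1 h2.
- by move=> t1 IH1 /IH1 [p h]; exists (- p) => v; rewrite mevalN h.
- by move=> t1 IH1 m /IH1 [p h]; exists (p *+ m) => v; rewrite mevalMn h.
- move=> t1 IH1 t2 IH2 /andP [/IH1 [p1 h1] /IH2 [p2 h2]].
  by exists (p1 * p2) => v; rewrite mevalM h1 h2.
- by move=> t1 IH1 m /IH1 [p h]; exists (p ^+ m) => v; rewrite rmorphXn /= h.
Qed.

(** An equation between two polynomials either holds identically or fails off the hypersurface of
    their difference; connectives multiply the exceptional polynomials. *)
Lemma qf_eval_generic n f : GRing.qf_form f && GRing.rformula f ->
  exists2 h : {mpoly k[n]}, h != 0 &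
  exists b, forall v, h.@[v] != 0 -> GRing.qf_eval (codom v) f = b.
Proof.
elim: f => //=.
- by move=> b _; exists 1; rewrite ?oner_eq0 //; exists b.
- move=> t1 t2 /andP [/(@rterm_mpoly n) [p1 h1] /(@rterm_mpoly n) [p2 h2]].
  case: (eqVneq p1 p2) => [p12|np12].
    by exists 1; rewrite ?oner_eq0 //; exists true => v _; rewrite h1 h2 p12 eqxx.
  exists (p1 - p2); first by rewrite subr_eq0.
  by exists false => v; rewrite mevalB subr_eq0 h1 h2 => /negPf.
- move=> f1 IH1 f2 IH2 /andP [/andP [q1 q2] /andP [r1 r2]].
  have [|h1 h1n [b1 e1]] := IH1; first by rewrite q1.
  have [|h2 h2n [b2 e2]] := IH2; first by rewrite q2.
  exists (h1 * h2); rewrite ?mulf_neq0 //; exists (b1 && b2) => v.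
  by rewrite mevalM mulf_eq0 negb_or => /andP [/e1 -> /e2 ->].
- move=> f1 IH1 f2 IH2 /andP [/andP [q1 q2] /andP [r1 r2]].
  have [|h1 h1n [b1 e1]] := IH1; first by rewrite q1.
  have [|h2 h2n [b2 e2]] := IH2; first by rewrite q2.
  exists (h1 * h2); rewrite ?mulf_neq0 //; exists (b1 || b2) => v.
  by rewrite mevalM mulf_eq0 negb_or => /andP [/e1 -> /e2 ->].
- move=> f1 IH1 f2 IH2 /andP [/andP [q1 q2] /andP [r1 r2]].
  have [|h1 h1n [b1 e1]] := IH1; first by rewrite q1.
  have [|h2 h2n [b2 e2]] := IH2; first by rewrite q2.
  exists (h1 * h2); rewrite ?mulf_neq0 //; exists (b1 ==> b2) => v.
  by rewrite mevalM mulf_eq0 negb_or => /andP [/e1 -> /e2 ->].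
- move=> f1 IH1 qr; have [//|h1 h1n [b1 e1]] := IH1.
  by exists h1 => //; exists (~~ b1) => v /e1 ->.
Qed.

Fixpoint exists_vars (n m : nat) f : GRing.formula k :=
  if m is m'.+1 then GRing.Exists n (exists_vars n.+1 m' f) else f.

Lemma holds_exists_vars n m f (e : seq k) : size e = n ->
  GRing.holds e (exists_vars n m f) <->
  exists2 w, size w = m & GRing.holds (e ++ w) f.
Proof.
elim: m n e => [|m IH] n e se /=.
  split=> [h|[w /size0nil ->]]; last by rewrite cats0.
  by exists [::]; rewrite ?cats0.
have se' x : set_nth 0 e n x = rcons e x.
  by rewrite -se set_nthE ltnn subnn /= cats1.
split=> [[x]|[[//|x w] [sw] h]].
  rewrite se' => /IH []; first by rewrite size_rcons se.
  by move=> w sw; rewrite cat_rcons => h; exists (x :: w); rewrite //= sw.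
exists x; rewrite se'; apply/IH; first by rewrite size_rcons se.
by exists w; rewrite ?cat_rcons.
Qed.

Lemma rformula_exists_vars n m f :
  GRing.rformula (exists_vars n m f) = GRing.rformula f.
Proof. by elim: m n => //= m IH n. Qed.

(** Functions of the environment that are given by division-free terms. Closure under the ring
    operations avoids writing matrix identities as explicit formulas. *)
Definition termfun (phi : (nat -> k) -> k) : Prop :=
  exists2 t, GRing.rterm t & forall e : seq k, GRing.eval e t = phi (nth 0 e).

Lemma termfun_const c : termfun (fun=> c).
Proof. by exists (GRing.Const c). Qed.

Lemma termfun_var i : termfun (fun e => e i).
Proof. by exists (GRing.Var _ i). Qed.

Lemma termfunD phi psi :
  termfun phi -> termfun psi -> termfun (fun e => phi e + psi e).
Proof.
move=> [t rt te] [u ru ue]; exists (GRing.Add t u); rewrite /= ?rt //.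
by move=> e; rewrite te ue.
Qed.

Lemma termfunM phi psi :
  termfun phi -> termfun psi -> termfun (fun e => phi e * psi e).
Proof.
move=> [t rt te] [u ru ue]; exists (GRing.Mul t u); rewrite /= ?rt //.
by move=> e; rewrite te ue.
Qed.

Lemma termfun_ext phi psi : phi =1 psi -> termfun phi -> termfun psi.
Proof. by move=> e [t rt te]; exists t => // x; rewrite te e. Qed.

Lemma termfunN phi : termfun phi -> termfun (fun e => - phi e).
Proof.
by move=> [t rt te]; exists (GRing.Opp t) => //= x; rewrite te.
Qed.

Lemma termfun_sum (I : finType) (phi : I -> (nat -> k) -> k) :
  (forall i, termfun (phi i)) -> termfun (fun e => \sum_i phi i e).
Proof.
move=> h; elim: (index_enum I) => [|i s IH].
  by apply: termfun_ext (termfun_const 0) => e; rewrite big_nil.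
by apply: termfun_ext (termfunD (h i) IH) => e; rewrite big_cons.
Qed.

(* Chevalley: the projection of an algebraic set is constructible, so that it
   contains a nonempty open set as soon as it is dense. *)
Lemma dense_projection_open n m (I : finType) (phi : I -> (nat -> k) -> k)
    (S : ('I_n -> k) -> Prop) :
  (forall i, termfun (phi i)) ->
  (forall v, S v <-> exists2 w, size w = m &
     forall i, phi i (nth 0 (codom v ++ w)) = 0) ->
  (forall F : {mpoly k[n]}, (forall v, S v -> F.@[v] = 0) -> F = 0) ->
  (forall v, S v \/ ~ S v) /\
  exists2 h : {mpoly k[n]}, h != 0 & forall v, h.@[v] != 0 -> S v.
Proof.
move=> /fin_all_exists2 [ts rts tsE] SE Sdense.
pose f := foldr (fun i => GRing.And (GRing.Equal (ts i) (GRing.Const 0)))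
  (GRing.Bool true) (enum I).
have rf : GRing.rformula f.
  by rewrite /f; elim: (enum I) => //= i s ->; rewrite rts.
have hf e : GRing.holds e f <-> forall i, phi i (nth 0 e) = 0.
  have : GRing.holds e f <-> forall i, i \in enum I -> phi i (nth 0 e) = 0.
    rewrite /f; elim: (enum I) => //= j s IH; split.
      by rewrite tsE => -[h1 /IH h2] i; rewrite in_cons => /orP [/eqP ->|/h2].
    move=> h; split; first by rewrite tsE h ?mem_head.
    by apply/IH=> i si; apply: h; rewrite in_cons si orbT.
  by move=> -> ; split=> h i; [apply: h; rewrite mem_enum | move=> _; apply: h].
pose g := exists_vars n m f.
have rg : GRing.rformula g by rewrite rformula_exists_vars.
pose q := GRing.quantifier_elim (@ClosedFieldQE.ex_elim k) g.
have qP e : reflect (GRing.holds e g) (GRing.qf_eval e q).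
  have ok := ClosedFieldQE.holds_ex_elim (@GRing.solve_monicpoly k).
  exact: GRing.quantifier_elim_rformP (@ClosedFieldQE.wf_ex_elim k) ok _ _ rg.
have wq : GRing.qf_form q && GRing.rformula q.
  by apply: GRing.quantifier_elim_wf => //; exact: ClosedFieldQE.wf_ex_elim.
have Sq v : S v <-> GRing.qf_eval (codom v) q.
  rewrite SE; have := @holds_exists_vars n m f (codom v).
  rewrite size_codom card_ord => /(_ erefl) hE.
  split=> [[w sw h]|/qP/hE [w sw /hf]]; last by exists w.
  by apply/qP/hE; exists w => //; apply/hf.
split=> [v|].
  by case: (boolP (GRing.qf_eval (codom v) q)) => [qv|/negP nqv]; [left|right]; rewrite Sq.
have [h hn0 [b hb]] := @qf_eval_generic n q wq.
case: b hb => hb; first by exists h => // v /hb; rewrite Sq => ->.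
(* If the generic truth value were [false], then [h] would vanish on [S]. *)
case/negP: hn0; apply/eqP/Sdense=> v /Sq qv.
by apply/eqP/negPn/negP=> /hb; rewrite qv.
Qed.

End Constructible.

(** * Polynomial functions of matrices and curves of matrices *)

Section MatrixPolynomials.
Local Open Scope ring_scope.
Variables (k : closedFieldType) (N : nat).
Implicit Types (phi psi : 'M[k]_N -> k) (f : {mpoly k[N * N]}).

Definition mxpolyfun phi : Prop := exists f, forall A, mxeval A f = phi A.

Lemma mxpolyfun_ext phi psi : phi =1 psi -> mxpolyfun phi -> mxpolyfun psi.
Proof. by move=> e [f fE]; exists f => A; rewrite fE e. Qed.

Lemma mxpolyfun_const c : mxpolyfun (fun=> c).
Proof. by exists c%:MP => A; rewrite /mxeval mevalC. Qed.

Lemma mxpolyfun_entry a b : mxpolyfun (fun A => A a b).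
Proof. by exists 'X_(mxvec_index a b) => A; rewrite /mxeval mevalXU mxvecE. Qed.

Lemma mxpolyfunD phi psi :
  mxpolyfun phi -> mxpolyfun psi -> mxpolyfun (fun A => phi A + psi A).
Proof.
by move=> [f fE] [g gE]; exists (f + g) => A; rewrite -fE -gE /mxeval mevalD.
Qed.

Lemma mxpolyfunN phi : mxpolyfun phi -> mxpolyfun (fun A => - phi A).
Proof. by move=> [f fE]; exists (- f) => A; rewrite -fE /mxeval mevalN. Qed.

Lemma mxpolyfunM phi psi :
  mxpolyfun phi -> mxpolyfun psi -> mxpolyfun (fun A => phi A * psi A).
Proof.
by move=> [f fE] [g gE]; exists (f * g) => A; rewrite -fE -gE /mxeval mevalM.
Qed.

Lemma mxpolyfun_sum (I : finType) (phi : I -> 'M[k]_N -> k) :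
  (forall i, mxpolyfun (phi i)) -> mxpolyfun (fun A => \sum_i phi i A).
Proof.
move=> h; elim: (index_enum I) => [|i s IH].
  by apply: mxpolyfun_ext (mxpolyfun_const 0) => e; rewrite big_nil.
by apply: mxpolyfun_ext (mxpolyfunD (h i) IH) => e; rewrite big_cons.
Qed.

Lemma mxpolyfun_mulmx (F G : 'M[k]_N -> 'M[k]_N) :
  (forall a b, mxpolyfun (fun A => F A a b)) ->
  (forall a b, mxpolyfun (fun A => G A a b)) ->
  forall a b, mxpolyfun (fun A => (F A *m G A) a b).
Proof.
move=> hF hG a b; apply: mxpolyfun_ext (_ : mxpolyfun (fun A => \sum_j F A a j * G A j b)).
  by move=> A; rewrite mxE.
by apply: mxpolyfun_sum => j; apply: mxpolyfunM.
Qed.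

Lemma mxpolyfun_comp f (F : 'M[k]_N -> 'M[k]_N) :
  (forall a b, mxpolyfun (fun A => F A a b)) ->
  mxpolyfun (fun A => mxeval (F A) f).
Proof.
move=> hF; elim/mpoly_ring_ind: f => [c|l|p q hp hq|p q hp hq].
- by apply: mxpolyfun_ext (mxpolyfun_const c) => A; rewrite /mxeval mevalC.
- case/mxvec_indexP: l => a b; apply: mxpolyfun_ext (hF a b) => A.
  by rewrite /mxeval mevalXU mxvecE.
- by apply: mxpolyfun_ext (mxpolyfunD hp hq) => A; rewrite /mxeval mevalD.
- by apply: mxpolyfun_ext (mxpolyfunM hp hq) => A; rewrite /mxeval mevalM.
Qed.

Lemma zclosed_family (I : Type) (phi : I -> 'M[k]_N -> k) :
  (forall i, mxpolyfun (phi i)) -> zclosed (fun A => forall i, phi i A = 0).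
Proof.
move=> h; exists (fun f => exists i, forall A, mxeval A f = phi i A) => A.
split=> [Z f [i ->] // | Z i].
by have [f fE] := h i; rewrite -fE; apply: Z; exists i.
Qed.

(** [A] is the value of the curve at 0 and [X] its velocity; at the poles [c] is unconstrained. *)
Definition mxgerm (c : k -> 'M[k]_N) (A X : 'M[k]_N) : Prop :=
  forall a b, germ (fun t => c t a b) (A a b) (X a b).

Lemma mxgerm_eval c A X f : mxgerm c A X ->
  germ (fun t => mxeval (c t) f) (mxeval A f) (mxdiff A X f).
Proof.
move=> cAX; apply: germ_meval => l.
case/mxvec_indexP: l => a b; rewrite !mxvecE.
by apply: germ_ext (cAX a b) => t; rewrite mxvecE.
Qed.

Lemma mxgermM c d A X B Y : mxgerm c A X -> mxgerm d B Y ->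
  mxgerm (fun t => c t *m d t) (A *m B) (X *m B + A *m Y).
Proof.
move=> hc hd a b; rewrite !mxE -big_split /=.
apply: germ_ext (_ : germ (fun t => \sum_j c t a j * d t j b) _ _).
  by move=> t; rewrite mxE.
by apply: germ_sum => j; apply: germM.
Qed.

Lemma mxgerm_uniq c d A X B Y (r : {poly k}) :
  mxgerm c A X -> mxgerm d B Y -> r.[0] != 0 ->
  (forall t, r.[t] != 0 -> c t = d t) -> A = B /\ X = Y.
Proof.
move=> hc hd r0 cd; split; apply/matrixP=> a b;
by have [] := germ_uniq (hc a b) (hd a b) r0 (fun t rt => congr1 (fun M : 'M_N => M a b) (cd t rt)).
Qed.

Lemma mxgerm_const A : mxgerm (fun=> A) A 0.
Proof. by move=> a b; rewrite mxE; apply: germ_const. Qed.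

Lemma mxgerm_line A X : mxgerm (fun t => A + t *: X) A X.
Proof.
move=> a b; have := germD (germ_const (A a b)) (germM (germ_id k) (germ_const (X a b))).
rewrite mul0r addr0 mul1r mulr0 addr0 add0r; apply: germ_ext=> t.
by rewrite !mxE.
Qed.

Lemma mxgermD c d A X B Y : mxgerm c A X -> mxgerm d B Y ->
  mxgerm (fun t => c t + d t) (A + B) (X + Y).
Proof.
move=> hc hd a b; rewrite !mxE; apply: germ_ext (germD (hc a b) (hd a b)) => t.
by rewrite mxE.
Qed.

End MatrixPolynomials.

(** * The Cayley curve *)

Section Cayley.
Local Open Scope ring_scope.
Variables (k : closedFieldType) (N : nat).

(** Supplies the exceptional parameters of the Cayley curve: [1 - t z] is invertible off the roots
    of [r], and 0 is not one of them. *)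
Lemma det_line (z : 'M[k]_N) : exists r : {poly k},
  r.[0] = 1 /\ forall t, r.[t] = \det (1%:M - t *: z).
Proof.
exists (\det (1%:M - 'X *: map_mx polyC z)).
have h t : (\det (1%:M - 'X *: map_mx polyC z)).[t] = \det (1%:M - t *: z).
  rewrite -[LHS]/(horner_eval t _) -det_map_mx; congr (\det _).
  apply/matrixP=> a b; rewrite !mxE [LHS]horner_evalE hornerD hornerN hornerM hornerX hornerC.
  by rewrite hornerMn hornerC.
by split=> //; rewrite h scale0r subr0 det1.
Qed.

(** By Cramer's rule the entries of the inverse are germs with some value [B] and velocity [X].
    These are then read off from the product rule for [(1 - t z) (1 - t z)^-1 = 1], without
    differentiating the adjugate. *)
Lemma cayley_germ (z : 'M[k]_N) :
  mxgerm (fun t => invmx (1%:M - t *: z) *m (1%:M + t *: z)) 1%:M (z + z).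
Proof.
have [r [r0 rE]] := det_line z.
have hz : mxgerm (fun t => 1%:M - t *: z) 1%:M (- z).
  move=> a b; apply: germ_ext (mxgerm_line 1%:M (- z) a b) => t.
  by rewrite scalerN.
have [B [X hB]] : exists B X, mxgerm (fun t => invmx (1%:M - t *: z)) B X.
  pose adj := \adj (1%:M - 'X *: map_mx polyC z).
  have adjE t : map_mx (horner_eval t) adj = \adj (1%:M - t *: z).
    rewrite /adj map_mx_adj; congr (\adj _).
    apply/matrixP=> a b; rewrite !mxE [LHS]horner_evalE hornerD hornerN hornerM hornerX hornerC.
    by rewrite hornerMn hornerC.
  exists (\matrix_(a, b) (adj a b).[0]).
  exists (\matrix_(a, b) ((adj a b)^`().[0] - (adj a b).[0] * r^`().[0])).
  move=> a b; exists (adj a b), r; split=> //; rewrite ?mxE // => t rt.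
  have u : 1%:M - t *: z \in unitmx by rewrite unitmxE -rE unitfE.
  rewrite /invmx u mxE -rE -adjE !mxE /horner_eval mulrC mulrA mulfV // mul1r //.
have [B1 X1] : 1%:M *m B = 1%:M /\ - z *m B + 1%:M *m X = 0.
  apply: (mxgerm_uniq (mxgermM hz hB) (mxgerm_const _) (r := r)).
    by rewrite r0 oner_eq0.
  by move=> t rt; rewrite mulmxV // unitmxE -rE unitfE.
rewrite mul1mx in B1; rewrite B1 mulmx1 mul1mx in X1.
have Xz : X = z by apply/eqP; rewrite -subr_eq0 addrC X1.
have := mxgermM hB (mxgerm_line 1%:M z).
by rewrite B1 Xz mul1mx mulmx1 mul1mx.
Qed.

End Cayley.

(** * The parabolic subgroup and its unipotent radical *)

Section Adjoint.
Local Open Scope ring_scope.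
Variables (k : closedFieldType) (N : nat).
Implicit Types (A B g h : 'M[k]_N).

Lemma lab_add_eq0 (a b : 'I_N) : (lab N a + lab N b == 0) = (b == rev_ord a).
Proof.
rewrite -val_eqE /= /lab; have := ltn_ord a; have := ltn_ord b.
move=> bN aN; have := odd_double_half N; case: (odd N) => /= nN; first by lia.
by case: (ltnP a _) => ?; case: (ltnP b _) => ?; lia.
Qed.

Local Notation J := (form_mx k N).

Lemma form_mxE (a b : 'I_N) : J a b = (b == rev_ord a)%:R.
Proof. by rewrite mxE lab_add_eq0. Qed.

Lemma rev_ord_eq (a b : 'I_N) : (b == rev_ord a) = (a == rev_ord b).
Proof. by apply/eqP/eqP=> ->; rewrite rev_ordK. Qed.

Lemma mul_form m (A : 'M[k]_(m, N)) a b : (A *m J) a b = A a (rev_ord b).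
Proof.
rewrite mxE (bigD1 (rev_ord b)) //= form_mxE rev_ordK eqxx mulr1.
rewrite big1 ?addr0 // => j jb; rewrite form_mxE rev_ord_eq.
by rewrite (negPf jb) mulr0.
Qed.

Lemma form_mul m (A : 'M[k]_(N, m)) a b : (J *m A) a b = A (rev_ord a) b.
Proof.
rewrite mxE (bigD1 (rev_ord a)) //= form_mxE eqxx mul1r.
by rewrite big1 ?addr0 // => j jb; rewrite form_mxE (negPf jb) mul0r.
Qed.

Lemma form_sqr : J *m J = 1%:M.
Proof.
by apply/matrixP=> a b; rewrite form_mul form_mxE mxE rev_ordK eq_sym.
Qed.

Lemma tr_form : J^T = J.
Proof. by apply/matrixP=> a b; rewrite mxE !form_mxE rev_ord_eq. Qed.

(** The adjoint for the bilinear form. The matrix of the form is the antidiagonal permutation, so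
    the adjoint is the reflection in the antidiagonal. *)
Definition adjm A : 'M[k]_N := \matrix_(a, b) A (rev_ord b) (rev_ord a).

Lemma adjmE A a b : adjm A a b = A (rev_ord b) (rev_ord a).
Proof. by rewrite mxE. Qed.

Lemma adjm_def A : adjm A = J *m A^T *m J.
Proof. by apply/matrixP=> a b; rewrite adjmE mul_form form_mul mxE. Qed.

Lemma adjmK : involutive adjm.
Proof. by move=> A; apply/matrixP=> a b; rewrite !adjmE !rev_ordK. Qed.

Lemma adjm1 : adjm 1%:M = 1%:M.
Proof. by rewrite adjm_def trmx1 mulmx1 form_sqr. Qed.

Lemma adjmM A B : adjm (A *m B) = adjm B *m adjm A.
Proof.
rewrite !adjm_def trmx_mul !mulmxA -(mulmxA _ J J) form_sqr mulmx1 //.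
Qed.

Lemma adjmD A B : adjm (A + B) = adjm A + adjm B.
Proof. by apply/matrixP=> a b; rewrite !(adjmE, mxE). Qed.

Lemma adjmN A : adjm (- A) = - adjm A.
Proof. by apply/matrixP=> a b; rewrite !(adjmE, mxE). Qed.

Lemma adjmZ c A : adjm (c *: A) = c *: adjm A.
Proof. by apply/matrixP=> a b; rewrite !(adjmE, mxE). Qed.

Lemma tr_adjm A : \tr (adjm A) = \tr A.
Proof. by rewrite adjm_def mxtrace_mulC mulmxA form_sqr mul1mx mxtrace_tr. Qed.

Lemma det_adjm A : \det (adjm A) = \det A.
Proof.
by rewrite adjm_def !det_mulmx det_tr mulrC mulrA -det_mulmx form_sqr det1 mul1r.
Qed.

Lemma orthogonal_groupP g : orthogonal_group g <-> g *m adjm g = 1%:M.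
Proof.
rewrite /orthogonal_group adjm_def !mulmxA; split=> [->|]; first exact: form_sqr.
move=> /(congr1 (mulmx^~ J)); rewrite -!mulmxA form_sqr mulmx1 mul1mx //.
Qed.

Lemma orthogonal_unit g : orthogonal_group g -> g \in unitmx.
Proof. by move=> /orthogonal_groupP /mulmx1_unit []. Qed.

Lemma orthogonal_inv g : orthogonal_group g -> invmx g = adjm g.
Proof.
move=> og; have ug := orthogonal_unit og; move/orthogonal_groupP: og => e.
by rewrite -[RHS](mulKmx ug) e mulmx1.
Qed.

Lemma orthogonal1 : orthogonal_group (1%:M : 'M[k]_N).
Proof. by apply/orthogonal_groupP; rewrite adjm1 mulmx1. Qed.

Lemma orthogonalM g h :
  orthogonal_group g -> orthogonal_group h -> orthogonal_group (g *m h).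
Proof.
move=> /orthogonal_groupP eg /orthogonal_groupP eh; apply/orthogonal_groupP.
by rewrite adjmM mulmxA -(mulmxA g) eh mulmx1.
Qed.

Lemma orthogonalV g : orthogonal_group g -> orthogonal_group (invmx g).
Proof.
move=> og; apply/orthogonal_groupP; rewrite {1}orthogonal_inv // -adjmM.
by rewrite mulVmx ?adjm1 // orthogonal_unit.
Qed.

End Adjoint.

(** * Triangular isometries, their unipotent part and its Lie algebra *)

Section Flags.
Local Open Scope ring_scope.
Variables (k : closedFieldType) (N : nat) (col : 'I_N -> int).
Hypothesis colN : forall a, col (rev_ord a) = - col a.
Hypothesis char2 : (2%:R : k) != 0.
Implicit Types (A B g h z : 'M[k]_N).

(* For the grading of [k^N] by [col]: [Pg] is the parabolic subgroup, [Ug] its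
   unipotent radical, [pp] and [uu] their Lie algebras. *)
Definition tri A : Prop := forall a b, (col a < col b)%R -> A a b = 0.
Definition strict A : Prop := forall a b, (col a <= col b)%R -> A a b = 0.
Definition so A : Prop := adjm A = - A.
Definition pp A : Prop := so A /\ tri A.
Definition uu A : Prop := so A /\ strict A.
Definition Pg g : Prop := orthogonal_group g /\ tri g.
Definition Ug g : Prop := orthogonal_group g /\ strict (g - 1%:M).

Lemma triD A B : tri A -> tri B -> tri (A + B).
Proof. by move=> hA hB a b ab; rewrite mxE hA ?hB ?addr0. Qed.
Lemma triN A : tri A -> tri (- A).
Proof. by move=> hA a b ab; rewrite mxE hA ?oppr0. Qed.
Lemma triZ c A : tri A -> tri (c *: A).
Proof. by move=> hA a b ab; rewrite mxE hA ?mulr0. Qed.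
Lemma tri1 : tri 1%:M.
Proof. by move=> a b; rewrite mxE; case: eqP => // ->; rewrite ltxx. Qed.
Lemma strictD A B : strict A -> strict B -> strict (A + B).
Proof. by move=> hA hB a b ab; rewrite mxE hA ?hB ?addr0. Qed.
Lemma strictN A : strict A -> strict (- A).
Proof. by move=> hA a b ab; rewrite mxE hA ?oppr0. Qed.
Lemma strictZ c A : strict A -> strict (c *: A).
Proof. by move=> hA a b ab; rewrite mxE hA ?mulr0. Qed.
Lemma strict_tri A : strict A -> tri A.
Proof. by move=> hA a b ab; rewrite hA // ltW. Qed.

Lemma triM A B : tri A -> tri B -> tri (A *m B).
Proof.
move=> hA hB a b ab; rewrite mxE big1 // => j _.
by case: (ltP (col a) (col j)) => h; [rewrite hA ?mul0r | rewrite hB ?mulr0 // (le_lt_trans h)].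
Qed.

Lemma tri_strictM A B : tri A -> strict B -> strict (A *m B).
Proof.
move=> hA hB a b ab; rewrite mxE big1 // => j _.
by case: (ltP (col a) (col j)) => h; [rewrite hA ?mul0r | rewrite hB ?mulr0 // (le_trans h)].
Qed.

Lemma strict_triM A B : strict A -> tri B -> strict (A *m B).
Proof.
move=> hA hB a b ab; rewrite mxE big1 // => j _.
by case: (leP (col a) (col j)) => h; [rewrite hA ?mul0r | rewrite hB ?mulr0 // (lt_le_trans h)].
Qed.

Lemma tri_adjm A : tri A -> tri (adjm A).
Proof. by move=> hA a b ab; rewrite adjmE hA // !colN ltrN2. Qed.

(** A projection whose row space is a step of the flag; [tri] amounts to the stability of all these
    steps. *)
Definition upto (c : int) : 'M[k]_N := diag_mx (\row_a (col a <= c)%R%:R).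

Lemma mul_upto A c a b : (A *m upto c) a b = A a b *+ (col b <= c)%R.
Proof.
rewrite mul_mx_diag !mxE; case: (col b <= c)%R; by rewrite ?mulr1 ?mulr0.
Qed.

Lemma upto_mul A c a b : (upto c *m A) a b = A a b *+ (col a <= c)%R.
Proof.
rewrite mul_diag_mx !mxE; case: (col a <= c)%R; by rewrite ?mul1r ?mul0r.
Qed.

Lemma upto_idem c : upto c *m upto c = upto c.
Proof.
by apply/matrixP=> a b; rewrite mul_upto !mxE; case: eqP => [->|];
   case: (col b <= c)%R; rewrite ?mulr1n ?mulr0n.
Qed.

Lemma sub_upto m (A : 'M[k]_(m, N)) c : (A <= upto c)%MS -> A *m upto c = A.
Proof. by move=> /submxP [D ->]; rewrite -mulmxA upto_idem. Qed.

Lemma tri_upto A c : tri A -> (upto c *m A <= upto c)%MS.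
Proof.
move=> hA; have -> : upto c *m A = upto c *m A *m upto c.
  apply/matrixP=> a b; rewrite mul_upto upto_mul.
  case: leP => h1; case: leP => h2; rewrite // ?mul0rn ?mulr1n ?mulr0n //.
  by rewrite hA // (le_lt_trans h1).
by rewrite submxMl.
Qed.

Lemma upto_tri A : (forall c, (upto c *m A <= upto c)%MS) -> tri A.
Proof.
move=> h a b ab; have /sub_upto /matrixP /(_ a b) := h (col a).
by rewrite mul_upto upto_mul lexx leNgt ab /= mulr1n mulr0n => <-.
Qed.

(** An invertible map preserves ranks, so a subspace mapped into itself is mapped onto itself. *)
Lemma sub_mul_unit (F A : 'M[k]_N) :
  A \in unitmx -> (F *m A <= F)%MS -> (F *m invmx A <= F)%MS.
Proof.
move=> uA FA; have : (F <= F *m A)%MS.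
  have := mxrank_leqif_sup FA; case=> _ <-.
  by rewrite mxrankMfree ?row_free_unit.
by move=> /(submxMr (invmx A)); rewrite -mulmxA mulmxV // mulmx1.
Qed.

Lemma triV A : A \in unitmx -> tri A -> tri (invmx A).
Proof.
move=> uA hA; apply: upto_tri => c; apply: sub_mul_unit => //.
exact: tri_upto.
Qed.

Lemma Pg1 : Pg 1%:M.
Proof. by split; [exact: orthogonal1 | exact: tri1]. Qed.

Lemma PgM g h : Pg g -> Pg h -> Pg (g *m h).
Proof. by move=> [og tg] [oh th]; split; [exact: orthogonalM | exact: triM]. Qed.

Lemma PgV g : Pg g -> Pg (invmx g).
Proof.
move=> [og tg]; split; first exact: orthogonalV.
by rewrite orthogonal_inv //; apply: tri_adjm.
Qed.

Lemma Pg_unit g : Pg g -> g \in unitmx.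
Proof. by move=> [/orthogonal_unit]. Qed.

Lemma Ug_Pg g : Ug g -> Pg g.
Proof.
move=> [og sg]; split=> //; rewrite -(subrK 1%:M g).
by apply: triD; [exact: strict_tri | exact: tri1].
Qed.

Lemma Ug1 : Ug 1%:M.
Proof. by split; [exact: orthogonal1 | move=> a b _; rewrite subrr mxE]. Qed.

Lemma UgM g h : Ug g -> Ug h -> Ug (g *m h).
Proof.
move=> Ugg Uh; have [og sg] := Ugg; have [oh sh] := Uh.
split; first exact: orthogonalM.
have -> : g *m h - 1%:M = (g - 1%:M) *m h + (h - 1%:M).
  by rewrite mulmxBl mul1mx addrA subrK.
by apply: strictD => //; apply: strict_triM => //; have [] := Ug_Pg Uh.
Qed.

Lemma UgJ g h : Pg g -> Ug h -> Ug (invmx g *m h *m g).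
Proof.
move=> Pgg [oh sh]; have ug := Pg_unit Pgg; have [og tg] := Pgg.
have [oi ti] := PgV Pgg; split; first by do 2!apply: orthogonalM => //.
have -> : invmx g *m h *m g - 1%:M = invmx g *m (h - 1%:M) *m g.
  by rewrite mulmxBr mulmxBl mulmx1 mulVmx.
by apply: strict_triM => //; apply: tri_strictM.
Qed.

Lemma UgV g : Ug g -> Ug (invmx g).
Proof.
move=> Ugg; have Pgg := Ug_Pg Ugg; have ug := Pg_unit Pgg.
have [og sg] := Ugg; split; first exact: orthogonalV.
have -> : invmx g - 1%:M = - (invmx g *m (g - 1%:M)).
  by rewrite mulmxBr mulVmx // mulmx1 opprB.
by apply/strictN/tri_strictM => //; have [] := PgV Pgg.
Qed.

Lemma Ug_subgroup : is_subgroup Ug.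
Proof.
split; [|exact: Ug1|exact: UgM|exact: UgV].
by move=> g /Ug_Pg /Pg_unit.
Qed.

Lemma mxpolyfun_trmx (F : 'M[k]_N -> 'M[k]_N) :
  (forall a b, mxpolyfun (fun A => F A a b)) ->
  forall a b, mxpolyfun (fun A => (F A)^T a b).
Proof. by move=> h a b; apply: mxpolyfun_ext (h b a) => A; rewrite mxE. Qed.

Lemma orthogonal_eq_polyfun a b :
  mxpolyfun (fun A => (A *m form_mx k N *m A^T - form_mx k N) a b).
Proof.
apply: mxpolyfun_ext (_ : mxpolyfun (fun A => (A *m form_mx k N *m A^T) a b + - form_mx k N a b)).
  by move=> A; rewrite [RHS]mxE [X in _ = _ + X]mxE.
apply: mxpolyfunD; last exact: mxpolyfun_const.
apply: mxpolyfun_mulmx.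
  by apply: mxpolyfun_mulmx => *; [exact: mxpolyfun_entry | exact: mxpolyfun_const].
by apply: mxpolyfun_trmx => *; exact: mxpolyfun_entry.
Qed.

Lemma Ug_closed : closed_subgroup Ug.
Proof.
split; first exact: Ug_subgroup.
exists Ug => //.
pose phi (i : ('I_N * 'I_N) + ('I_N * 'I_N)) (A : 'M[k]_N) : k :=
  match i with
  | inl (a, b) => (A *m form_mx k N *m A^T - form_mx k N) a b
  | inr (a, b) => if (col a <= col b)%R then A a b + - (1%:M : 'M[k]_N) a b else 0
  end.
have [] : zclosed (fun A => forall i, phi i A = 0).
  apply: zclosed_family => -[[a b]|[a b]] /=; first exact: orthogonal_eq_polyfun.
  rewrite /phi; case: (col a <= col b)%R; last exact: mxpolyfun_const.
  by apply: mxpolyfunD; [exact: mxpolyfun_entry | exact: mxpolyfun_const].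
move=> F FE; exists F => A; rewrite -FE; split.
  move=> [oA sA] [[a b]|[a b]] /=; first by rewrite oA subrr mxE.
  by case: ifP => // ab; rewrite -(sA a b ab) !mxE.
move=> h; split.
  apply/eqP; rewrite -subr_eq0; apply/eqP/matrixP=> a b.
  by rewrite [RHS]mxE; have := h (inl (a, b)).
by move=> a b ab; have := h (inr (a, b)); rewrite /= ab !mxE.
Qed.

Lemma Ug_normal : normal_in Ug Pg.
Proof. by split; [exact: Ug_Pg | move=> g h; exact: UgJ]. Qed.

Lemma strict_nilpotent A : strict A -> exists m, A ^+ m = 0.
Proof.
move=> hA.
have hm m : forall a b, (A ^+ m) a b != 0 -> (col b + m%:Z <= col a)%R.
  elim: m => [|m IH] a b.
    by rewrite expr0 mxE; case: (a =P b) => [->|]; rewrite ?eqxx // addr0.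
  rewrite exprS mxE => h.
  have /existsP [j] : [exists j, (A a j * (A ^+ m) j b) != 0].
    apply: contraNT h => /existsPn h'; apply/eqP/big1 => j _.
    by apply/eqP; have := h' j; rewrite negbK.
  rewrite mulf_eq0 negb_or => /andP [h1 /IH h2].
  have : (col j < col a)%R by rewrite ltNge; apply: contra h1 => /hA ->.
  by lia.
(* All abscissas lie between [- M] and [M], so a nonzero entry of the [m]-th power forces
   [m <= 2 M]. *)
pose M := \max_a `|col a|%N; exists (M.*2.+1)%N.
apply/matrixP=> a b; rewrite mxE; apply/eqP/negPn/negP=> /hm.
have := leq_bigmax (F := fun a => `|col a|%N) a.
have := leq_bigmax (F := fun a => `|col a|%N) b.
rewrite -/M; lia.
Qed.

Lemma Ug_unipotent : is_unipotent_group Ug.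
Proof. by move=> g [_ sg]; apply: strict_nilpotent. Qed.

(* Contraction to the identity by the cocharacter with weights [col]. *)
Lemma Ug_connected : zconnected Ug.
Proof.
move=> Z1 Z2 [F1 F1E] [F2 F2E] h12 hdis.
have curve g : Ug g -> exists c : k -> 'M[k]_N,
    [/\ forall t, Ug (c t), c 0 = 1%:M, c 1 = g &
        forall f, exists p : {poly k}, forall t, p.[t] = mxeval (c t) f].
  move=> [og sg].
  have tg : tri g by have [] := Ug_Pg (conj og sg).
  (* Conjugation by the cocharacter multiplies the entry [(a, b)] by [t] to the power
     [col a - col b]. The absolute value alters this only where [g] is zero, and makes the curve
     polynomial in [t], hence defined at 0. *)
  pose e (a b : 'I_N) : nat := `|col a - col b|%N.
  pose c t : 'M[k]_N := \matrix_(a, b) (t ^+ e a b * g a b).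
  have cstrict t : strict (c t - 1%:M).
    move=> a b ab; have := sg a b ab; rewrite !mxE => /eqP.
    rewrite subr_eq0 => /eqP ->; rewrite /e.
    case: eqP => [->|_]; last by rewrite mulr0 subr0.
    by rewrite subrr absz0 expr0 mul1r subrr.
  exists c; split.
  - move=> t; split=> //; apply/orthogonal_groupP/matrixP=> a b.
    have /matrixP /(_ a b) := (orthogonal_groupP g).1 og.
    rewrite !mxE => ob.
    have -> : \sum_j c t a j * adjm (c t) j b = t ^+ e a b * \sum_j g a j * adjm g j b.
      rewrite mulr_sumr; apply: eq_bigr => j _; rewrite !adjmE !mxE.
      case: (ltP (col a) (col j)) => h1; first by rewrite tg // !(mulr0, mul0r).
      case: (ltP (col j) (col b)) => h2.
        by rewrite [g (rev_ord b) _]tg ?colN ?ltrN2 // !mulr0.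
      have -> : e a b = (e a j + e (rev_ord b) (rev_ord j))%N by rewrite /e !colN; lia.
      by rewrite exprD; ring.
    rewrite ob; case: eqP => [->|_]; last by rewrite mulr0.
    by rewrite /e subrr absz0 expr0 mul1r.
  - apply/matrixP=> a b; case: (leP (col a) (col b)) => h.
      by have := cstrict 0 a b h; rewrite !mxE => /eqP; rewrite subr_eq0 => /eqP.
    rewrite !mxE expr0n; have -> : (e a b == 0)%N = false by apply/eqP; rewrite /e; lia.
    by rewrite mul0r; case: eqP => // ab; move: h; rewrite ab ltxx.
  - by apply/matrixP=> a b; rewrite mxE expr1n mul1r.
  - elim/mpoly_ring_ind=> [x|l|p q [p' hp] [q' hq]|p q [p' hp] [q' hq]].
    + by exists x%:P => t; rewrite hornerC /mxeval mevalC.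
    + case/mxvec_indexP: l => a b; exists ((g a b)%:P * 'X^(e a b)) => t.
      by rewrite /mxeval mevalXU mxvecE !mxE hornerM hornerC hornerXn mulrC.
    + by exists (p' + q') => t; rewrite hornerD hp hq /mxeval mevalD.
    + by exists (p' * q') => t; rewrite hornerM hp hq /mxeval mevalM.
(* If [f1] were nonzero at [g] and [f2] at the identity, a point of the curve would avoid both
   closed sets, as two nonzero polynomials in [t] have a common nonroot. *)
have main Za Zb Fa Fb : (forall A, Za A <-> forall f, Fa f -> mxeval A f = 0) ->
    (forall A, Zb A <-> forall f, Fb f -> mxeval A f = 0) ->
    (forall A, Ug A -> Za A \/ Zb A) -> (forall A, Ug A -> ~ (Za A /\ Zb A)) ->
    Za 1%:M -> forall A, Ug A -> Za A.
  move=> FaE FbE hab hd Z1a g Ugg; apply/FaE => f1 Ff1.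
  apply/eqP/negPn/negP=> f1g.
  have [c [cU c0 c1 cp]] := curve g Ugg.
  have nZb : ~ Zb 1%:M by move=> Zb1; exact: (hd _ Ug1).
  apply: nZb; apply/FbE => f2 Ff2; apply/eqP/negPn/negP=> f21.
  have [p1 p1E] := cp f1; have [p2 p2E] := cp f2.
  have n1 : p1 != 0 by apply: contra f1g => /eqP p0; rewrite -c1 -p1E p0 horner0.
  have n2 : p2 != 0 by apply: contra f21 => /eqP p0; rewrite -c0 -p2E p0 horner0.
  have [t] := poly_neq0_fun (mulf_neq0 n1 n2).
  rewrite hornerM mulf_eq0 negb_or p1E p2E => /andP [t1 t2].
  have [/FaE /(_ _ Ff1) e|/FbE /(_ _ Ff2) e] := hab _ (cU t).
    by rewrite e eqxx in t1.
  by rewrite e eqxx in t2.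
have [Z11|Z21] := h12 _ Ug1; [left|right].
  exact: (main Z1 Z2 F1 F2).
apply: (main Z2 Z1 F2 F1) => // A UA; first by have [] := h12 A UA; [right|left].
by move=> [? ?]; exact: (hdis A UA).
Qed.

(** For skew [z] the adjoint exchanges [1 - t z] and [1 + t z], and these commute. *)
Lemma cayley_orthogonal z t : so z -> 1%:M - t *: z \in unitmx ->
  orthogonal_group (invmx (1%:M - t *: z) *m (1%:M + t *: z)).
Proof.
set A := 1%:M - t *: z; set B := 1%:M + t *: z => sz uA.
have adjA : adjm A = B by rewrite adjmD adjm1 adjmN adjmZ sz scalerN opprK.
have adjB : adjm B = A by rewrite -adjA adjmK.
have uB : B \in unitmx by rewrite unitmxE -adjA det_adjm -unitmxE.
have AB : A *m B = B *m A.
  have -> : B = 1%:M + 1%:M - A by rewrite /A /B opprB addrA addrAC addrK.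
  by clearbody A; rewrite mulmxBr mulmxBl mulmxDr mulmxDl mulmx1 mul1mx.
have adjV : adjm (invmx A) = invmx B.
  have h : adjm (invmx A) *m B = 1%:M by rewrite -adjA -adjmM mulmxV // adjm1.
  by rewrite -[LHS]mulmx1 -(mulmxV uB) mulmxA h mul1mx.
apply/orthogonal_groupP; rewrite adjmM adjB adjV.
rewrite mulmxA -(mulmxA _ B) -AB mulmxA mulVmx // mul1mx mulmxV //.
Qed.

Lemma cayley_Pg z t : pp z -> 1%:M - t *: z \in unitmx ->
  Pg (invmx (1%:M - t *: z) *m (1%:M + t *: z)).
Proof.
move=> [sz tz] u; split; first exact: cayley_orthogonal.
apply: triM; last by apply: triD; [exact: tri1 | exact: triZ].
by apply: triV => //; apply: triD; [exact: tri1 | exact/triN/triZ].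
Qed.

Lemma cayley_Ug z t : uu z -> 1%:M - t *: z \in unitmx ->
  Ug (invmx (1%:M - t *: z) *m (1%:M + t *: z)).
Proof.
move=> [sz tz] u; split; first exact: cayley_orthogonal.
have -> : invmx (1%:M - t *: z) *m (1%:M + t *: z) - 1%:M =
    invmx (1%:M - t *: z) *m (t *: z + t *: z).
  rewrite -[X in _ - X](mulVmx u) -mulmxBr; congr (_ *m _).
  by rewrite opprB addrC addrA subrK.
apply: tri_strictM; last by apply: strictD; exact: strictZ.
apply: triV => //; apply: triD; [exact: tri1 | exact/triN/triZ/strict_tri].
Qed.

(** In one direction the equations of [Ug] are differentiated along the line [1 + t X]. In the
    other, polynomials vanishing on [Ug] are differentiated along the Cayley curve, whose velocity
    is [2 X]. *)
Lemma LieU X : Lie Ug X <-> uu X.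
Proof.
split=> [LX|uX f fU].
  have diff_line f phi : (forall A, mxeval A f = phi A) ->
      (forall g, Ug g -> phi g = 0) -> forall b, 
      germ (fun t => phi (1%:M + t *: X)) (phi 1%:M) b -> b = 0.
    move=> fE phi0 b gb.
    have := mxgerm_eval f (mxgerm_line 1%:M X).
    rewrite LX => [h|g Ugg]; last by rewrite fE phi0.
    have [||_ ->] // := germ_uniq (r := 1) gb h.
      by rewrite hornerC oner_neq0.
  split.
    have tr_id : mxgerm (fun t => adjm (1%:M + t *: X)) 1%:M (adjm X).
      move=> a b; rewrite adjmE.
      have := mxgerm_line 1%:M X (rev_ord b) (rev_ord a).
      rewrite !mxE (inj_eq rev_ord_inj) eq_sym; apply: germ_ext => t.
      by rewrite adjmE.
    apply/eqP; rewrite -addr_eq0 addrC; apply/eqP/matrixP=> a b; rewrite [RHS]mxE.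
    have [||f fE] := @mxpolyfunD k N (fun A => (A *m adjm A) a b) (fun=> - (1%:M : 'M[k]_N) a b).
      - apply: mxpolyfun_mulmx => [|i j]; first exact: mxpolyfun_entry.
        apply: mxpolyfun_ext (mxpolyfun_entry k (rev_ord j) (rev_ord i)) => A.
        by rewrite adjmE.
      - exact: mxpolyfun_const.
    apply: (diff_line _ _ fE) => [g [/orthogonal_groupP -> _]|]; first by rewrite subrr.
    have := germD (mxgermM (mxgerm_line 1%:M X) tr_id a b) (germ_const (- (1%:M : 'M[k]_N) a b)).
    by rewrite adjm1 !mulmx1 !mul1mx addr0.
  move=> a b ab.
  have [||f fE] := @mxpolyfunD k N (fun A => A a b) (fun=> - (1%:M : 'M[k]_N) a b).
  - exact: mxpolyfun_entry.
  - exact: mxpolyfun_const.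
  apply: (diff_line _ _ fE) => [g [_ sg]|].
    by have := sg a b ab; rewrite !mxE.
  have := germD (mxgerm_line 1%:M X a b) (germ_const (- (1%:M : 'M[k]_N) a b)).
  by rewrite addr0.
have [r [r0 rE]] := det_line X.
have := mxgerm_eval f (cayley_germ X).
have := germ_const (0 : k) => h0 h1.
have [||_ ] := germ_uniq (r := r) h1 h0.
- by rewrite r0 oner_neq0.
- move=> t rt; apply: fU; apply: cayley_Ug => //.
  by rewrite unitmxE -rE unitfE.
have -> : mxdiff 1%:M (X + X) f = 2%:R * mxdiff 1%:M X f.
  rewrite /mxdiff mulr_sumr; apply: eq_bigr => l _.
  by case/mxvec_indexP: l => a b; rewrite !mxvecE mxE; ring.
by move=> /eqP; rewrite mulf_eq0 (negPf char2) => /eqP.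
Qed.

End Flags.

(** * Traces of unipotent matrices *)

Section NilpotentTrace.
Local Open Scope ring_scope.
Variables (k : closedFieldType) (N : nat).

Lemma nilpotent_eigen (A : 'M[k]_N) m (w : 'rV[k]_N) c :
  A ^+ m = 0 -> w *m A = c *: w -> w != 0 -> c = 0.
Proof.
move=> Am wA w0; have : w *m (A ^+ m) = c ^+ m *: w.
  elim: m {Am} => [|m IH]; first by rewrite !expr0 mulmx1 scale1r.
  by rewrite exprSr [A ^+ m * A]/(_ *m _) mulmxA IH -scalemxAl wA scalerA exprSr.
rewrite Am mulmx0 => /esym/eqP; rewrite scaler_eq0 (negPf w0) orbF.
by rewrite expf_eq0 => /andP [_ /eqP].
Qed.

(** All eigenvalues are 0, so the characteristic polynomial is [X^N], and the trace is one of its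
    coefficients up to sign. *)
Lemma nilpotent_tr (A : 'M[k]_N) m : A ^+ m = 0 -> \tr A = 0.
Proof.
move=> Am; case: (posnP N) => [N0|N0].
  rewrite /mxtrace big1 // => i _; have := ltn_ord i; rewrite {2}N0 //.
have [r rE] := closed_field_poly_normal (char_poly A).
rewrite (monicP (char_poly_monic A)) scale1r in rE.
have r0 : all (pred1 0) r.
  apply/allP=> c cr; apply/eqP.
  have : root (char_poly A) c by rewrite rE root_prod_XsubC.
  rewrite -eigenvalue_root_char => /eigenvalueP [w wA wn0].
  exact: nilpotent_eigen Am wA wn0.
have sr : size r = N.
  by have := size_char_poly A; rewrite rE size_prod_XsubC => -[].
have cX : char_poly A = 'X^N.
  rewrite rE -sr; elim: r r0 {rE sr} => [|c r IH] /=; first by rewrite big_nil.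
  by move=> /andP [/eqP -> /IH]; rewrite big_cons exprS subr0 => ->.
have := char_poly_trace A N0; rewrite cX coefXn.
rewrite (ltn_eqF (_ : N.-1 < N)%N) ?prednK // => /esym/eqP.
by rewrite oppr_eq0 => /eqP.
Qed.

Lemma unipotent_tr (g : 'M[k]_N) : unipotent_mx g -> \tr g = N%:R.
Proof.
move=> [m /nilpotent_tr /eqP]; rewrite raddfB /= mxtrace1 subr_eq0 => /eqP //.
Qed.

End NilpotentTrace.

(** * Normal unipotent subgroups of the parabolic subgroup *)

Section Maximality.
Local Open Scope ring_scope.
Variables (k : closedFieldType) (N : nat) (col : 'I_N -> int).
Hypothesis colN : forall a, col (rev_ord a) = - col a.
Hypothesis char2 : (2%:R : k) != 0.
Implicit Types (A B g h z : 'M[k]_N).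

Local Notation Pg := (@Pg k N col).
Local Notation Ug := (@Ug k N col).
Local Notation tri := (@tri k N col).
Local Notation J := (form_mx k N).

Variable K : 'M[k]_N -> Prop.
Hypothesis Ksub : is_subgroup K.
Hypothesis Knorm : normal_in K Pg.
Hypothesis Kuni : is_unipotent_group K.

Lemma K_Pg g : K g -> Pg g. Proof. exact: Knorm.1. Qed.

Lemma K_tri g : K g -> tri g. Proof. by move=> /K_Pg []. Qed.

Lemma K_inv g : K g -> invmx g = adjm g.
Proof. by move=> /K_Pg [/orthogonal_inv]. Qed.

(** By normality the commutator of [g] and [h] lies in [K], so it is unipotent; for isometries the
    inverses are adjoints. *)
Lemma K_commutator g h : K g -> Pg h ->
  \tr (adjm g *m adjm h *m g *m h) = N%:R.
Proof.
move=> Kg Ph; apply: unipotent_tr; apply: Kuni.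
have [_ _ KM KV] := Ksub.
have := KM _ _ (KV _ Kg) (Knorm.2 _ _ Ph Kg).
by rewrite K_inv // orthogonal_inv ?mulmxA //; have [] := Ph.
Qed.

Lemma tr_adjm_conj g A :
  \tr (adjm g *m adjm A *m g *m adjm A) = \tr (adjm g *m A *m g *m A).
Proof.
have e (X Y Z W : 'M[k]_N) : adjm (X *m Y *m Z *m W) = adjm W *m (adjm Z *m (adjm Y *m adjm X)).
  by rewrite !adjmM.
by rewrite -[LHS]tr_adjm e !adjmK mxtrace_mulC (mulmxA (adjm g)).
Qed.

(** With [M] the rank one map [u |-> phi(u) e_a], the test element is [h = 1 + M - adjm M], which
    acts by transvections on the block of [a] and on the opposite one. In the trace of the
    commutator the terms of degree one vanish, the terms mixing [M] and [adjm M] vanish by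
    triangularity, and the two others coincide: twice the trace of [adjm g *m M *m g *m M] is 0. *)
Lemma K_transvection g a (phi : 'rV[k]_N) : K g -> col a != 0 ->
  phi 0 a = 0 -> (forall b, col b != col a -> phi 0 b = 0) ->
  (\sum_b g a b * phi 0 b) * (\sum_b adjm g a b * phi 0 b) = 0.
Proof.
move=> Kg a0 pa pb; have tg := K_tri Kg.
have ts : tri (adjm g) by apply: tri_adjm.
pose ea : 'rV[k]_N := delta_mx 0 a.
pose M : 'M[k]_N := phi^T *m ea.
have ME i j : M i j = phi 0 i * (j == a)%:R.
  by rewrite mxE big_ord1 !mxE eqxx.
(* These four products vanish because [phi] is zero at [a] and the columns [col a] and [- col a] are
   distinct. *)
have MM : M *m M = 0.
  apply/matrixP=> i j; rewrite !mxE big1 // => l _; rewrite !ME.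
  by case: eqP => [->|_]; rewrite ?pa !(mulr0, mul0r).
have MsM : adjm M *m M = 0.
  apply/matrixP=> i j; rewrite !mxE big1 // => l _; rewrite adjmE !ME.
  case: (eqVneq (col l) (col a)) => [la|/pb ->]; last by rewrite mul0r mulr0.
  rewrite [phi 0 (rev_ord l)]pb ?mul0r // colN la.
  by apply: contra a0 => /eqP; lia.
have MMs : M *m adjm M = 0.
  apply/matrixP=> i j; rewrite !mxE big1 // => l _; rewrite adjmE !ME.
  case: eqP => [->|_]; last by rewrite mulr0 mul0r.
  case: eqP => [ra|_]; last by rewrite !mulr0.
  by case/negP: a0; have := colN a; rewrite ra => /eqP; lia.
have MsMs : adjm M *m adjm M = 0 by rewrite -adjmM MM; apply/matrixP=> i j; rewrite adjmE !mxE.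
pose n := M - adjm M.
have nn : n *m n = 0.
  by rewrite mulmxBl !mulmxBr MM MMs MsM MsMs !subr0.
have sn : adjm n = - n by rewrite adjmD adjmN adjmK opprB addrC.
pose h := 1%:M + n.
have hs : adjm h = 1%:M - n by rewrite adjmD adjm1 sn.
have tM : tri M.
  move=> i j ij; rewrite ME; case: eqP => [ja|_]; last by rewrite mulr0.
  by rewrite pb ?mul0r // -ja lt_eqF.
have Ph : Pg h.
  split; last by apply: triD; [exact: tri1 | apply: triD => //; apply/triN/tri_adjm].
  apply/orthogonal_groupP; rewrite hs mulmxDl mul1mx (mulmxBr n) nn subr0 mulmx1.
  exact: subrK.
have := K_commutator Kg Ph; rewrite hs.
have gg : adjm g *m g = 1%:M.
  by rewrite -K_inv // mulVmx // (Pg_unit (K_Pg Kg)).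
have -> : adjm g *m (1%:M - n) *m g *m h =
    1%:M + n - adjm g *m n *m g - adjm g *m n *m g *m n.
  rewrite mulmxBr mulmx1 mulmxBl gg mulmxBl mul1mx mulmxDr mulmx1.
  by rewrite opprD addrA.
have trM : \tr M = 0.
  rewrite /mxtrace big1 // => i _; rewrite ME; case: eqP => [->|_]; by rewrite ?pa ?mul0r ?mulr0.
have trn : \tr n = 0 by rewrite raddfB /= tr_adjm trM subr0.
have cyc : \tr (adjm g *m n *m g) = \tr n.
  rewrite mxtrace_mulC mulmxA.
  have -> : g *m adjm g = 1%:M by apply/orthogonal_groupP; have [] := K_Pg Kg.
  by rewrite mul1mx.
rewrite raddfB raddfB raddfD /= mxtrace1 cyc trn addr0 subr0.
move=> /eqP; rewrite -subr_eq0 addrAC subrr add0r oppr_eq0 => /eqP tr0.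
(* The trace is a product of two scalars. If [col a < 0] the first one is an entry of [Y] above the
   diagonal blocks; if [col a > 0] the second one involves only such entries of [X]. *)
have zero X : tri X -> forall Y, tri Y -> \tr (X *m M *m Y *m adjm M) = 0.
  move=> tX Y tY; have -> : X *m M *m Y *m adjm M = X *m phi^T *m (ea *m Y *m adjm M).
    by rewrite /M !mulmxA.
  rewrite mxtrace_mulC adjm_def /M trmx_mul trmxK.
  have -> : ea *m Y *m (J *m (ea^T *m phi) *m J) *m (X *m phi^T) =
     (ea *m (Y *m J) *m ea^T) *m (phi *m J *m X *m phi^T).
    by rewrite !mulmxA.
  have -> : ea *m (Y *m J) *m ea^T = (Y a (rev_ord a))%:M.
    apply/matrixP=> i j; rewrite !ord1 trmx_delta -rowE -colE !mxE eqxx mulr1n.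
    by rewrite -(mul_form Y a a) mxE.
  rewrite mul_scalar_mx mxtraceZ /mxtrace big_ord1.
  case: (ltP (col a) 0) => ha.
    by rewrite tY ?mul0r // colN; lia.
  rewrite (_ : (phi *m J *m X *m phi^T) 0 0 = 0) ?mulr0 //.
  rewrite mxE big1 // => l _; rewrite mxE mulr_suml big1 // => j _.
  rewrite mxE [phi^T l 0]mxE.
  case: (eqVneq (col l) (col a)) => [la|/pb ->]; last by rewrite mulr0.
  have -> : (\sum_i phi 0 i * J i j) = phi 0 (rev_ord j).
    rewrite (bigD1 (rev_ord j)) //= form_mxE rev_ordK eqxx mulr1 big1 ?addr0 // => i ij.
    by rewrite form_mxE rev_ord_eq (negPf ij) mulr0.
  case: (eqVneq (col (rev_ord j)) (col a)) => [ja|/pb ->]; last by rewrite !mul0r.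
  rewrite colN in ja; rewrite tX ?(mulr0, mul0r) // la.
  by move: a0 => /eqP; lia.
have diag X Y : \tr (X *m M *m Y *m M) = (\sum_b X a b * phi 0 b) * (\sum_b Y a b * phi 0 b).
  have -> : X *m M *m Y *m M = X *m phi^T *m (ea *m Y *m phi^T *m ea).
    by rewrite /M !mulmxA.
  have e Z : ea *m Z *m phi^T = (\sum_b Z a b * phi 0 b)%:M.
    apply/matrixP=> i j; rewrite !ord1 -rowE !mxE eqxx mulr1n.
    by apply: eq_bigr => b _; rewrite !mxE.
  rewrite mxtrace_mulC e mul_scalar_mx -scalemxAl mulmxA e.
  by rewrite mxtraceZ mxtrace_scalar mulr1n mulrC.
have : \tr (adjm g *m M *m g *m M) + \tr (adjm g *m M *m g *m M) = 0.
  move: tr0; rewrite /n.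
  have -> : adjm g *m (M - adjm M) *m g *m (M - adjm M) =
     adjm g *m M *m g *m M + adjm g *m adjm M *m g *m adjm M
     - adjm g *m M *m g *m adjm M - adjm g *m adjm M *m g *m M.
    rewrite !(mulmxBr, mulmxBl) opprB; set x1 := _ *m M; set x2 := _ *m _; set x3 := _ *m _.
    by rewrite [RHS]addrAC -!addrA; congr (_ + _); rewrite [RHS]addrC -addrA; congr (_ + _); rewrite addrC.
  rewrite !raddfB raddfD /= zero // subr0.
  have -> : \tr (adjm g *m adjm M *m g *m M) = 0.
    by rewrite -(mulmxA (adjm g *m adjm M)) mxtrace_mulC (mulmxA (g *m M)) zero.
  rewrite subr0; have -> // : \tr (adjm g *m adjm M *m g *m adjm M) = \tr (adjm g *m M *m g *m M).
  exact: tr_adjm_conj.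
rewrite diag -mulr2n -mulr_natl => /eqP; rewrite mulf_eq0 (negPf char2) /= => /eqP.
by rewrite mulrC.
Qed.

(** Taking [phi] supported on [b] and a second index [c] shows that if [g a b] is nonzero, then the
    row [a] of [adjm g] has no other entry in its block than the diagonal one. The products of this
    row with the columns [a] and [b] of [g] are then contradictory. *)
Lemma K_offdiag g a b : K g -> col a != 0 -> a != b -> col b = col a -> g a b = 0.
Proof.
move=> Kg a0 ab ba; have tg := K_tri Kg.
have ts : tri (adjm g) by apply: tri_adjm.
pose phi (x y : k) (c : 'I_N) : 'rV[k]_N := \row_i (x * (i == b)%:R + y * (i == c)%:R).
have sum_phi X x y c : \sum_i X a i * phi x y c 0 i = x * X a b + y * X a c :> k.
  rewrite (eq_bigr (fun i => x * (X a i * (i == b)%:R) + y * (X a i * (i == c)%:R))); last first.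
    by move=> i _; rewrite mxE; ring.
  rewrite big_split -!mulr_sumr /=; congr (_ * _ + _ * _).
    by rewrite (bigD1 b) //= eqxx mulr1 big1 ?addr0 // => i /negPf ->; rewrite mulr0.
  by rewrite (bigD1 c) //= eqxx mulr1 big1 ?addr0 // => i /negPf ->; rewrite mulr0.
have main x y c : col c = col a -> a != c ->
    (x * g a b + y * g a c) * (x * adjm g a b + y * adjm g a c) = 0.
  move=> ca ac; rewrite -!sum_phi; apply: K_transvection => //.
    by rewrite mxE (negPf ab) (negPf ac) !mulr0 addr0.
  move=> i ia; rewrite mxE.
  case: eqP => [ib|_]; first by rewrite ib ba eqxx in ia.
  case: eqP => [ic|_]; first by rewrite ic ca eqxx in ia.
  by rewrite !mulr0 addr0.
apply/eqP/negPn/negP=> gab.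
have b0 : adjm g a b = 0.
  have := main 1 0 b ba ab; rewrite !mul1r !mul0r !addr0 => /eqP.
  by rewrite mulf_eq0 (negPf gab) => /eqP.
have c0 c : col c = col a -> a != c -> adjm g a c = 0.
  move=> ca ac; have := main 1 1 c ca ac; rewrite !mul1r b0 add0r.
  have := main 0 1 c ca ac; rewrite !mul1r !mul0r !add0r => e1.
  rewrite mulrDl e1 addr0 => /eqP; rewrite mulf_eq0 (negPf gab) => /eqP //.
have gg : adjm g *m g = 1%:M.
  by rewrite -K_inv // mulVmx // (Pg_unit (K_Pg Kg)).
have row c : col c = col a -> adjm g a a * g a c = (a == c)%:R.
  move=> ca; have <- : (adjm g *m g) a c = (a == c)%:R by rewrite gg mxE.
  rewrite [RHS]mxE.
  rewrite (bigD1 a) //= big1 ?addr0 // => j ja.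
  case: (ltgtP (col j) (col a)) => h.
  - by rewrite [g j c]tg ?mulr0 // ca.
  - by rewrite ts ?mul0r.
  - by rewrite c0 ?mul0r // eq_sym.
have := row b ba; rewrite (negPf ab) => /eqP; rewrite mulf_eq0 (negPf gab) orbF.
by have := row a erefl; rewrite eqxx => + /eqP e0; rewrite e0 mul0r => /esym/eqP; rewrite oner_eq0.
Qed.

(** Within the block the row [a] of [g] is now diagonal, so the powers of [g - 1] have there the
    powers of [g a a - 1]. *)
Lemma K_diag g a : K g -> col a != 0 -> g a a = 1.
Proof.
move=> Kg a0; have [m gm] := Kuni Kg.
have tg : tri (g - 1%:M) by apply: triD; [exact: K_tri | apply/triN/tri1].
have tX i : tri ((g - 1%:M) ^+ i).
  by elim: i => [|i IH]; [rewrite expr0; exact: tri1 | rewrite exprS; exact: triM].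
have : ((g - 1%:M) ^+ m) a a = (g a a - 1) ^+ m.
  elim: m {gm} => [|m IH]; first by rewrite !expr0 mxE eqxx.
  rewrite !exprS mxE (bigD1 a) //= IH big1 ?addr0 => [|j ja]; first by rewrite !mxE eqxx.
  case: (ltgtP (col j) (col a)) => h.
  - by rewrite (tX m j a) // mulr0.
  - by rewrite tg ?mul0r.
  - by rewrite eq_sym in ja; rewrite !mxE (K_offdiag Kg a0 ja h) (negPf ja) subr0 mul0r.
by rewrite gm mxE => /esym/eqP; rewrite expf_eq0 subr_eq0 => /andP [_ /eqP].
Qed.

Definition bil (u v : 'rV[k]_N) : k := (u *m J *m v^T) 0 0.

Lemma bilC u v : bil u v = bil v u.
Proof.
rewrite /bil -[in RHS](trmxK v) -[in RHS](tr_form k N) -[in RHS](trmxK u).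
by rewrite -!trmx_mul mulmxA [in RHS]mxE !trmxK.
Qed.

Lemma bilDl u v w : bil (u + v) w = bil u w + bil v w.
Proof. by rewrite /bil !mulmxDl mxE. Qed.

Lemma bilZl c u w : bil (c *: u) w = c * bil u w.
Proof. by rewrite /bil -!scalemxAl mxE. Qed.

Lemma bilDr u v w : bil w (u + v) = bil w u + bil w v.
Proof. by rewrite bilC bilDl !(bilC w). Qed.

Lemma bilZr c u w : bil w (c *: u) = c * bil w u.
Proof. by rewrite bilC bilZl bilC. Qed.

Lemma bil_adjm g u v : bil (u *m adjm g) v = bil u (v *m g).
Proof.
by rewrite /bil adjm_def trmx_mul !mulmxA -(mulmxA _ J J) form_sqr mulmx1.
Qed.

Lemma bil_delta i j : bil (delta_mx 0 i) (delta_mx 0 j) = (j == rev_ord i)%:R.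
Proof. by rewrite /bil trmx_delta -rowE -colE !mxE lab_add_eq0. Qed.

Lemma bil_deltaM A i j : bil (delta_mx 0 i *m A) (delta_mx 0 j) = A i (rev_ord j).
Proof.
by rewrite /bil trmx_delta -(mulmxA _ A) -rowE -colE mxE [LHS]mxE mul_form.
Qed.

Definition level0 (v : 'rV[k]_N) : Prop := forall a, col a != 0 -> v 0 a = 0.

Lemma level0D u v : level0 u -> level0 v -> level0 (u + v).
Proof. by move=> hu hv a a0; rewrite mxE hu ?hv ?addr0. Qed.

Lemma level0Z c u : level0 u -> level0 (c *: u).
Proof. by move=> hu a a0; rewrite mxE hu ?mulr0. Qed.

Lemma level0_delta a : col a = 0 -> level0 (delta_mx 0 a).
Proof. by move=> a0 b b0; rewrite mxE /=; case: eqP => // ba; rewrite ba a0 eqxx in b0. Qed.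

(** The reflection [u |-> u - 2 (u, v) / (v, v) v], acting on row vectors from the right. *)
Definition refl (v : 'rV[k]_N) : 'M[k]_N :=
  1%:M - (2%:R / bil v v) *: (J *m v^T *m v).

Lemma adjm_rank1 (v : 'rV[k]_N) : adjm (J *m v^T *m v) = J *m v^T *m v.
Proof.
by rewrite adjm_def !trmx_mul trmxK tr_form !mulmxA -(mulmxA _ J J) form_sqr mulmx1.
Qed.

Lemma refl_adjm v : adjm (refl v) = refl v.
Proof. by rewrite /refl adjmD adjm1 adjmN adjmZ adjm_rank1. Qed.

Lemma rank1_sqr v : (J *m v^T *m v) *m (J *m v^T *m v) = bil v v *: (J *m v^T *m v).
Proof.
have -> : J *m v^T *m v *m (J *m v^T *m v) = J *m v^T *m (v *m J *m v^T) *m v.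
  by rewrite !mulmxA.
by rewrite [v *m J *m v^T]mx11_scalar -/(bil v v) mul_mx_scalar -scalemxAl.
Qed.

Lemma tri_rank1 v : level0 v -> tri (J *m v^T *m v).
Proof.
move=> v0 a b ab; rewrite mxE big_ord1 form_mul mxE.
case: (eqVneq (col b) 0) => [b0|/v0 ->]; last by rewrite mulr0.
by rewrite v0 ?mul0r // colN; apply/eqP; lia.
Qed.

Lemma refl_Pg v : level0 v -> bil v v != 0 -> Pg (refl v).
Proof.
move=> v0 q0; split; last first.
  by apply: triD; [exact: tri1 | apply/triN/triZ/tri_rank1].
apply/orthogonal_groupP; rewrite refl_adjm /refl.
set W := J *m v^T *m v; set s := _ / _.
have WW : W *m W = bil v v *: W by exact: rank1_sqr.
clearbody W.
rewrite mulmxBl mul1mx -scalemxAl mulmxBr mulmx1 -scalemxAr WW !scalerA.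
have -> : s * bil v v = 2%:R by rewrite /s mulfVK.
apply/matrixP=> a b; rewrite !mxE; ring.
Qed.

(** With [s = 2 / (v, v)], the commutator with the reflection in [v] has trace
    [N - 4 + (s (v g, v))^2]. *)
Lemma K_isometry_sqr g v : K g -> level0 v -> bil v v != 0 ->
  bil (v *m g) v ^+ 2 = bil v v ^+ 2.
Proof.
move=> Kg v0 q0; have := K_commutator Kg (refl_Pg v0 q0).
rewrite refl_adjm /refl; set W := J *m v^T *m v; set s := _ / _.
have trW : \tr W = bil v v.
  by rewrite /W mxtrace_mulC mulmxA /mxtrace big_ord1.
have gg : g *m adjm g = 1%:M by apply/orthogonal_groupP; have [] := K_Pg Kg.
have gg' : adjm g *m g = 1%:M by exact: mulmx1C.
have trW' : \tr (adjm g *m W *m g) = bil v v.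
  by rewrite mxtrace_mulC mulmxA gg mul1mx trW.
have trWW : \tr (adjm g *m W *m g *m W) = bil (v *m g) v ^+ 2.
  have -> : adjm g *m W *m g *m W = adjm g *m J *m v^T *m (v *m g *m J *m v^T) *m v.
    by rewrite /W !mulmxA.
  rewrite [v *m g *m J *m v^T]mx11_scalar -/(bil (v *m g) v) mul_mx_scalar -scalemxAl.
  rewrite mxtraceZ mxtrace_mulC !mulmxA /mxtrace big_ord1 -/(bil _ v) bil_adjm.
  by rewrite bilC expr2.
clearbody W.
have -> : adjm g *m (1%:M - s *: W) *m g *m (1%:M - s *: W) =
    1%:M - s *: W - s *: (adjm g *m W *m g) + (s * s) *: (adjm g *m W *m g *m W).
  have -> : adjm g *m (1%:M - s *: W) *m g = 1%:M - s *: (adjm g *m W *m g).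
    by rewrite mulmxBr mulmx1 mulmxBl gg' -scalemxAr -scalemxAl.
  rewrite mulmxBr mulmx1 mulmxBl mul1mx -scalemxAr -scalemxAl scalerA.
  by rewrite opprB addrA addrAC [1%:M - _ - _]addrAC.
rewrite !raddfD !raddfN /= !mxtraceZ mxtrace1 trW trW' trWW.
have sq : s * bil v v = 2%:R by rewrite /s mulfVK.
rewrite sq -!addrA => /eqP; rewrite -subr_eq0 addrAC subrr add0r => /eqP h.
have : (s * bil (v *m g) v) ^+ 2 = (s * bil v v) ^+ 2.
  rewrite sq exprMn [s ^+ 2]expr2; apply/eqP; rewrite -subr_eq0 -h; apply/eqP; ring.
have s0 : s != 0 by rewrite /s mulf_eq0 invr_eq0 negb_or char2 q0.
by clearbody s; rewrite !exprMn; apply: mulfI; rewrite expf_eq0.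
Qed.

Lemma level0_anisotropic : (exists a, col a = 0) ->
  exists2 v, level0 v & bil v v != 0.
Proof.
move=> [a a0]; exists (delta_mx 0 a + delta_mx 0 (rev_ord a)).
  by apply: level0D; apply: level0_delta; rewrite // colN a0 oppr0.
rewrite bilDl !bilDr !bil_delta rev_ordK !eqxx.
rewrite [rev_ord a == a]eq_sym; case: (a == rev_ord a) => /=.
  by rewrite [X in X != 0](_ : _ = 2%:R * 2%:R :> k) ?mulf_neq0 //; ring.
by rewrite add0r addr0.
Qed.

(** A priori the sign of [(v g, v) / (v, v)] depends on [v]. Along the line [v0 + t v] both sides
    are polynomials in [t] with equal squares, so they agree up to one sign; the coefficients of
    degree 0 and 2 carry it from [v0] to [v]. *)
Lemma K_sign g : (exists a, col a = 0) -> K g -> exists2 e : k,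
  e = 1 \/ e = -1 & forall v, level0 v -> bil (v *m g) v = e * bil v v.
Proof.
move=> /level0_anisotropic [v0 lv0 q0] Kg.
have [e e1 e0] : exists2 e : k, e = 1 \/ e = -1 & bil (v0 *m g) v0 = e * bil v0 v0.
  have /eqP := K_isometry_sqr Kg lv0 q0; rewrite eqf_sqr => /orP [] /eqP h.
    by exists 1; [left | rewrite mul1r].
  by exists (-1); [right | rewrite mulN1r].
exists e => // v lv.
pose pA := (bil (v0 *m g) v0)%:P + (bil (v0 *m g) v + bil (v *m g) v0)%:P * 'X
  + (bil (v *m g) v)%:P * 'X^2.
pose pQ := (bil v0 v0)%:P + (bil v0 v + bil v v0)%:P * 'X + (bil v v)%:P * 'X^2.
have pAE t : pA.[t] = bil ((v0 + t *: v) *m g) (v0 + t *: v).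
  rewrite !hornerD !hornerM !hornerC hornerX ?hornerXn mulmxDl -scalemxAl.
  by rewrite !(bilDl, bilDr, bilZl, bilZr); ring.
have pQE t : pQ.[t] = bil (v0 + t *: v) (v0 + t *: v).
  rewrite !hornerD !hornerM !hornerC hornerX ?hornerXn.
  by rewrite !(bilDl, bilDr, bilZl, bilZr); ring.
have pQ0 : pQ != 0.
  by apply: contra q0 => /eqP p0; have := pQE 0; rewrite p0 horner0 scale0r addr0 => <-.
have A2 : bil (v *m g) v = pA`_2.
  by rewrite !coefD !coefCM !coefC coefX coefXn /= !mulr0 mulr1 !add0r.
have Q2 : bil v v = pQ`_2.
  by rewrite !coefD !coefCM !coefC coefX coefXn /= !mulr0 mulr1 !add0r.
have A0 : bil (v0 *m g) v0 = pA`_0.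
  by rewrite !coefD !coefCM !coefC coefX coefXn /= !mulr0 !addr0.
have Q0 : bil v0 v0 = pQ`_0.
  by rewrite !coefD !coefCM !coefC coefX coefXn /= !mulr0 !addr0.
clearbody pA pQ.
have : (pA - pQ) * (pA + pQ) = 0.
  apply: (mulfI pQ0); rewrite mulr0; apply: poly_eq0_fun => t.
  case: (eqVneq pQ.[t] 0) => [h|h]; first by rewrite hornerM h mul0r.
  have := @K_isometry_sqr g (v0 + t *: v) Kg; rewrite -pQE -pAE => e2.
  rewrite -subr_sqr hornerM hornerD hornerN !horner_exp e2 ?subrr ?mulr0 //.
  by apply: level0D => //; apply: level0Z.
have n11 : (1 : k) + 1 != 0 by rewrite -mulr2n.
move=> /eqP; rewrite mulf_eq0 subr_eq0 addr_eq0 => /orP [] /eqP pAQ.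
  have : (e - 1) * bil v0 v0 = 0 by rewrite mulrBl mul1r -e0 A0 Q0 pAQ subrr.
  move=> /eqP; rewrite mulf_eq0 (negPf q0) orbF subr_eq0 => /eqP ->.
  by rewrite A2 Q2 pAQ mul1r.
have : (e + 1) * bil v0 v0 = 0 by rewrite mulrDl mul1r -e0 A0 Q0 pAQ coefN addNr.
move=> /eqP; rewrite mulf_eq0 (negPf q0) orbF addr_eq0 => /eqP ->.
by rewrite A2 Q2 pAQ coefN mulN1r.
Qed.

Definition corner A : 'M[k]_N := \matrix_(a, b) (A a b *+ ((col a == 0) && (col b == 0))).
Local Notation Z := (corner 1%:M).

(** For triangular factors, an index between two indices of column 0 contributes only if it has
    column 0 too. *)
Lemma cornerM A B : tri A -> tri B -> corner (A *m B) = corner A *m corner B.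
Proof.
move=> tA tB; apply/matrixP=> a b; rewrite !mxE -sumrMnl; apply: eq_bigr => j _.
rewrite !mxE; case: (eqVneq (col a) 0) => a0 /=; last by rewrite !mulr0n mul0r.
case: (eqVneq (col b) 0) => b0 /=; last by rewrite !andbF !mulr0n mulr0.
case: (ltgtP (col j) 0) => h /=; rewrite ?mulr1n ?mulr0n ?mul0r ?mulr0 //.
  by rewrite tB ?mulr0 // b0.
by rewrite tA ?mul0r // a0.
Qed.

Lemma cornerD A B : corner (A + B) = corner A + corner B.
Proof. by apply/matrixP=> a b; rewrite !mxE mulrnDl. Qed.

Lemma cornerN A : corner (- A) = - corner A.
Proof. by apply/matrixP=> a b; rewrite !mxE mulNrn. Qed.

Lemma cornerZ c A : corner (c *: A) = c *: corner A.
Proof. by apply/matrixP=> a b; rewrite !mxE mulrnAr. Qed.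

Lemma corner_adjm A : corner (adjm A) = adjm (corner A).
Proof.
by apply/matrixP=> a b; rewrite !mxE !colN !oppr_eq0 andbC.
Qed.

Lemma corner_mul1 A : Z *m corner A = corner A.
Proof.
apply/matrixP=> a b; rewrite !mxE (bigD1 a) //= big1 => [|j ja].
  by rewrite !mxE eqxx; case: (_ == 0); rewrite ?mul1r ?mul0r ?addr0.
by rewrite !mxE eq_sym (negPf ja) mul0rn mul0r.
Qed.

Lemma mul1_corner A : corner A *m Z = corner A.
Proof.
apply/matrixP=> a b; rewrite !mxE (bigD1 b) //= big1 => [|j jb].
  by rewrite !mxE eqxx; case: (col a == 0); case: (col b == 0); rewrite ?mulr1 ?mulr0 ?mul0r ?addr0.
by rewrite !mxE (negPf jb) mul0rn mulr0.
Qed.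

Lemma corner_rank1 v : level0 v -> corner (J *m v^T *m v) = J *m v^T *m v.
Proof.
move=> v0; apply/matrixP=> a b; rewrite [LHS]mxE.
case: (eqVneq (col a) 0) => a0 /=; last first.
  by rewrite mxE big_ord1 form_mul mxE v0 ?mul0r // colN oppr_eq0.
case: (eqVneq (col b) 0) => b0 //=.
by rewrite mxE big_ord1 v0 ?mulr0.
Qed.

Lemma refl_conj_expand (E W n : 'M[k]_N) (s q : k) :
  E *m E = E -> E *m n = n -> n *m E = n -> E *m W = W -> W *m E = W ->
  W *m W = q *: W -> W *m n *m W = 0 -> s * q = 2%:R ->
  (E - s *: W) *m (E + n) *m (E - s *: W) = E + (n - s *: (W *m n + n *m W)).
Proof.
move=> EE En nE EW WE WW WnW sq.
have -> : (E - s *: W) *m (E + n) = E + n - s *: W - s *: (W *m n).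
  by rewrite mulmxBl mulmxDr EE En -scalemxAl mulmxDr WE scalerDr opprD addrA.
rewrite mulmxBr -scalemxAr.
have -> : (E + n - s *: W - s *: (W *m n)) *m E = E + n - s *: W - s *: (W *m n).
  by rewrite !mulmxBl mulmxDl -!scalemxAl -mulmxA EE nE WE.
have -> : (E + n - s *: W - s *: (W *m n)) *m W = W + n *m W - 2%:R *: W.
  by rewrite !mulmxBl mulmxDl -!scalemxAl EW WW WnW scaler0 subr0 scalerA sq.
apply/matrixP=> a b; rewrite !mxE; ring.
Qed.

Lemma K_polar g e : (forall v, level0 v -> bil (v *m g) v = e * bil v v) ->
  corner g + adjm (corner g) = (2%:R * e) *: Z.
Proof.
move=> h; rewrite -corner_adjm -cornerD -cornerZ; apply/matrixP=> a b.
rewrite [LHS]mxE [RHS]mxE; case: (eqVneq (col a) 0) => a0 //=.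
case: (eqVneq (col b) 0) => b0 //=; rewrite !mulr1n.
have la := level0_delta a0; have lb : level0 (delta_mx 0 (rev_ord b)).
  by apply: level0_delta; rewrite colN b0 oppr0.
have := h _ (level0D la lb); rewrite mulmxDl !(bilDl, bilDr) (h _ la) (h _ lb).
rewrite !bil_deltaM !bil_delta !rev_ordK !mxE.
rewrite (inj_eq rev_ord_inj) [b == a]eq_sym => e1; apply/eqP; rewrite -subr_eq0.
move/eqP: e1; rewrite -subr_eq0 => /eqP <-; apply/eqP; ring.
Qed.

Lemma K_tri1 g : K g -> tri (g - 1%:M).
Proof. by move=> Kg; apply: triD; [exact: K_tri | exact/triN/tri1]. Qed.

(** Unipotence excludes the sign -1. With the sign 1, the nilpotent part [n] of the middle block is
    skew with square 0. The same information on the product of [g] with its conjugate by the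
    reflection in [v] shows that [n] kills every anisotropic [v], hence every vector of the
    block. *)
Lemma K_corner g : K g -> corner g = Z.
Proof.
move=> Kg.
case: (boolP [exists a, col a == 0]) => [/existsP [a0 /eqP a00]|/existsPn no0]; last first.
  by apply/matrixP=> a b; rewrite !mxE (negPf (no0 a)).
have ex0 : exists a, col a = 0 by exists a0.
have K_corner_adjm h : K h -> corner h *m adjm (corner h) = Z.
  move=> Kh; rewrite -corner_adjm -cornerM.
  - by congr corner; apply/orthogonal_groupP; have [] := K_Pg Kh.
  - exact: K_tri.
  - by apply: tri_adjm => //; exact: K_tri.
have sgn h : K h -> forall v, level0 v -> bil (v *m h) v = bil v v.
  move=> Kh; have [e [->|e1] he] := K_sign ex0 Kh.
    by move=> v /he; rewrite mul1r.
  exfalso; have pol := K_polar he; have GG := K_corner_adjm h Kh.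
  have Gs : adjm (corner h) = (2%:R * e) *: Z - corner h by rewrite -pol addrC addKr.
  (* For the sign -1, the block [G] satisfies [G + adjm G = - 2 Z] and [G *m adjm G = Z], so [G + Z]
     has square 0 and -1 is an eigenvalue of the block. *)
  pose H := corner h + Z.
  have HH : H *m H = 0.
    have e2 : corner h *m ((2%:R * e) *: Z - corner h) = Z by rewrite -Gs.
    rewrite mulmxBr -scalemxAr mul1_corner e1 in e2.
    rewrite /H mulmxDl !mulmxDr corner_mul1 mul1_corner corner_mul1 -e2.
    apply/matrixP=> a b; rewrite !mxE; ring.
  have HZ : H *m Z = H by rewrite mulmxDl mul1_corner corner_mul1.
  have [w w0 [wZ wG]] : exists2 w : 'rV[k]_N, w != 0 & w *m Z = w /\ w *m corner h = - w.
    have red (w : 'rV[k]_N) : w *m Z = w -> w *m H = 0 -> w *m corner h = - w.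
      by move=> wZ; rewrite mulmxDr wZ => /eqP; rewrite addr_eq0 => /eqP.
    case: (eqVneq H 0) => [H0|].
      have dZ : (delta_mx 0 a0 : 'rV[k]_N) *m Z = delta_mx 0 a0.
        apply/matrixP=> i j; rewrite -rowE !mxE !ord1 a00 !eqxx /= eq_sym.
        by case: eqP => [->|_]; rewrite ?a00 ?eqxx ?mul0rn.
      exists (delta_mx 0 a0); last by split=> //; apply: red => //; rewrite H0 mulmx0.
      by apply/eqP=> /matrixP /(_ 0 a0) /eqP; rewrite !mxE !eqxx oner_eq0.
    move=> Hn0; have /existsP [i Hi] : [exists i, row i H != 0].
      apply: contraNT Hn0 => /existsPn h0; apply/eqP/row_matrixP=> i.
      by rewrite row0; apply/eqP; have := h0 i; rewrite negbK.
    have rZ : row i H *m Z = row i H by rewrite -row_mul HZ.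
    exists (row i H) => //; split=> //; apply: red => //.
    by rewrite -row_mul HH row0.
  have [m hm] := Kuni Kh.
  have tX i : tri ((h - 1%:M) ^+ i).
    elim: i => [|i IH]; first by rewrite expr0; exact: tri1.
    by rewrite exprS; apply: triM => //; exact: K_tri1.
  have : w *m corner ((h - 1%:M) ^+ m) = (- 2%:R) ^+ m *: w.
    elim: m {hm} => [|m IH]; first by rewrite !expr0 scale1r.
    rewrite exprSr [_ ^+ m * _]/(_ *m _) cornerM //; last exact: K_tri1.
    rewrite mulmxA IH -scalemxAl cornerD cornerN mulmxBr wG wZ exprSr -scalerA.
    by congr (_ *: _); apply/matrixP=> a b; rewrite !mxE; ring.
  rewrite hm (_ : corner 0 = 0); last by apply/matrixP=> a b; rewrite !mxE mul0rn.
  move=> /esym/eqP; rewrite mulmx0 scaler_eq0 (negPf w0) orbF expf_eq0 oppr_eq0.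
  by rewrite (negPf char2) andbF.
have pol h : K h -> corner h + adjm (corner h) = 2%:R *: Z.
  move=> Kh; have := @K_polar h 1; rewrite mulr1; apply=> v lv.
  by rewrite mul1r sgn.
have skew h : K h -> adjm (corner h) = 2%:R *: Z - corner h.
  by move=> Kh; rewrite -(pol h Kh) addrC addKr.
pose n := corner (g - 1%:M).
have GE : corner g = Z + n by rewrite -cornerD addrC subrK.
have Zn : Z *m n = n by exact: corner_mul1.
have nZ : n *m Z = n by exact: mul1_corner.
have ZZ : Z *m Z = Z by exact: corner_mul1.
have adjZ : adjm Z = Z by rewrite -corner_adjm adjm1.
have sn : adjm n = - n.
  have := skew g Kg; rewrite GE adjmD adjZ => e1.
  by apply: (addrI Z); rewrite e1; apply/matrixP=> a b; rewrite !mxE; ring.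
have nn : n *m n = 0.
  have := K_corner_adjm g Kg; rewrite GE adjmD adjZ sn mulmxDl !mulmxBr ZZ Zn nZ.
  by rewrite addrA subrK => /eqP; rewrite -subr_eq0 addrAC subrr add0r oppr_eq0 => /eqP.
have vnv v : level0 v -> bil (v *m n) v = 0.
  move=> lv; have vZ (X : 'M[k]_N) : tri X -> bil (v *m corner X) v = bil (v *m X) v.
    move=> _; rewrite /bil -!mulmxA !mxE; apply: eq_bigr => a _.
    case: (eqVneq (col a) 0) => [a0'|/lv ->]; last by rewrite !mul0r.
    congr (_ * _); rewrite !mxE; apply: eq_bigr => b _.
    rewrite [corner X a b]mxE a0' eqxx /= form_mul mxE.
    case: (eqVneq (col b) 0) => [b0|b0]; first by rewrite mulr1n.
    by rewrite [v 0 _]lv ?mulr0 // colN oppr_eq0.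
  rewrite vZ; last exact: K_tri1.
  rewrite mulmxBr mulmx1 -[- v]scaleN1r bilDl bilZl sgn //; ring.
have vn v : level0 v -> bil v v != 0 -> v *m n = 0.
  move=> lv q0; pose W := J *m v^T *m v; pose s := 2%:R / bil v v.
  have PR := refl_Pg lv q0.
  have RE : refl v = 1%:M - s *: W by [].
  have [_ _ KM _] := Ksub.
  have Kg' := Knorm.2 _ _ PR Kg.
  have iR : invmx (refl v) = refl v by rewrite orthogonal_inv ?refl_adjm //; have [] := PR.
  have tR : tri (refl v) by have [] := PR.
  have R0 : corner (refl v) = Z - s *: W.
    by rewrite RE cornerD cornerN cornerZ corner_rank1.
  have WW : W *m W = bil v v *: W by exact: rank1_sqr.
  have ZW : Z *m W = W by rewrite /W -(corner_rank1 lv) corner_mul1.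
  have WZ : W *m Z = W by rewrite /W -(corner_rank1 lv) mul1_corner.
  have WnW : W *m n *m W = 0.
    have -> : W *m n *m W = J *m v^T *m (v *m n *m J *m v^T) *m v by rewrite /W !mulmxA.
    rewrite [v *m n *m J *m v^T]mx11_scalar -/(bil (v *m n) v) vnv //.
    by rewrite mul_mx_scalar scale0r mul0mx.
  pose n' := n - s *: (W *m n + n *m W).
  have G'E : corner (invmx (refl v) *m g *m refl v) = Z + n'.
    have tg := K_tri Kg.
    rewrite iR !cornerM //; last exact: triM.
    rewrite R0 GE /n'.
    by apply: (@refl_conj_expand _ _ _ _ (bil v v)) => //; rewrite /s mulfVK.
  (* The polar identity for this product reduces to [n n' + n' n = 0], and both terms equal
     [- s n W n]. *)
  have Kgg' : K (g *m (invmx (refl v) *m g *m refl v)) by apply: KM.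
  have := pol _ Kgg'; rewrite cornerM; [|exact: K_tri|exact: K_tri].
  rewrite G'E GE adjmM.
  have -> : adjm (Z + n') = Z - n'.
    have aW : adjm W = W := adjm_rank1 v.
    rewrite adjmD adjZ /n' adjmD adjmN adjmZ adjmD !adjmM aW sn mulmxN mulNmx.
    by apply/matrixP=> a b; rewrite !mxE; ring.
  rewrite adjmD adjZ sn.
  have n'n : n' *m n = - (s *: (n *m W *m n)).
    rewrite mulmxBl nn -scalemxAl mulmxDl -(mulmxA W) nn mulmx0 !add0r //.
  have nn' : n *m n' = - (s *: (n *m W *m n)).
    by rewrite mulmxBr nn -scalemxAr mulmxDr (mulmxA n n) nn mul0mx addr0 (mulmxA n W) add0r.
  have n'Z : n' *m Z = n' by rewrite mulmxBl nZ -scalemxAl mulmxDl -(mulmxA W) -(mulmxA n) nZ WZ.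
  have Zn' : Z *m n' = n' by rewrite mulmxBr Zn -scalemxAr mulmxDr (mulmxA Z W) (mulmxA Z n) ZW Zn.
  clearbody n'.
  rewrite mulmxDl !mulmxDr !mulmxN !mulmxBl ZZ nZ n'Z Zn Zn' nn' n'n => e1.
  have {e1} : (2%:R * s) *: (n *m W *m n) = 0.
    apply/eqP; rewrite -oppr_eq0; move/eqP: e1; rewrite -subr_eq0; congr (_ == _).
    by apply/matrixP=> a b; rewrite !mxE; ring.
  move=> /eqP; rewrite scaler_eq0 !mulf_eq0 invr_eq0 (negPf char2) (negPf q0) /=.
  (* As [n] is skew, [n W n] is up to sign the square of the row [v n], a rank one matrix which
     vanishes only with [v n]. *)
  have -> : n *m W *m n = - (J *m (v *m n)^T *m (v *m n)).
    have nJ : n *m J = - (J *m n^T).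
      have := congr1 (mulmx^~ J) sn; rewrite adjm_def -mulmxA form_sqr mulmx1 mulNmx => ->.
      by rewrite opprK.
    by rewrite trmx_mul /W !mulmxA nJ !mulNmx.
  rewrite oppr_eq0 -mulmxA; move: (v *m n) => x /eqP /(congr1 (mulmx J)).
  rewrite mulmxA form_sqr mul1mx mulmx0 => e1.
  apply/matrixP=> i j; rewrite ord1 [RHS]mxE.
  move/matrixP: e1 => /(_ j j); rewrite !mxE big_ord1 mxE => /eqP.
  by rewrite mulf_eq0 orbb => /eqP.
have vn_all v : level0 v -> v *m n = 0.
  move=> lv; case: (eqVneq (bil v v) 0) => [q0|]; last exact: vn.
  have [v0 lv0 q1] := level0_anisotropic ex0.
  have vn0 := vn v0 lv0 q1.
  case: (eqVneq (bil (v0 + v) (v0 + v)) 0) => h; last first.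
    by have := vn _ (level0D lv0 lv) h; rewrite mulmxDl vn0 add0r.
  (* For isotropic [v] the quadratic form takes at [v0 + v] and [v0 - v] values of sum [2 (v0, v0)],
     so one of them is nonzero. *)
  have lm : level0 (v0 + (-1) *: v) by apply: level0D => //; apply: level0Z.
  have : bil (v0 + (-1) *: v) (v0 + (-1) *: v) != 0.
    apply/eqP=> h2; have : 2%:R * bil v0 v0 = 0.
      rewrite -[RHS](addr0 0) -{1}h -h2 !(bilDl, bilDr, bilZl, bilZr) q0; ring.
    by apply/eqP; rewrite mulf_neq0.
  move=> /(vn _ lm); rewrite mulmxDl vn0 add0r scaleN1r mulNmx => /eqP.
  by rewrite oppr_eq0 => /eqP.
rewrite GE; suff -> : n = 0 by rewrite addr0.
apply/row_matrixP=> a; rewrite row0 rowE.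
case: (eqVneq (col a) 0) => [/level0_delta/vn_all //|a0'].
by rewrite -rowE; apply/matrixP=> i j; rewrite !mxE (negPf a0') mulr0n.
Qed.

Lemma K_Ug g : K g -> Ug g.
Proof.
move=> Kg; split; first by have [] := K_Pg Kg.
move=> a b ab; rewrite !mxE.
case: (eqVneq (col a) (col b)) => [e|ne]; last first.
  rewrite K_tri // ?lt_neqAle ?ne //; case: eqP => [h|_]; last by rewrite subr0.
  by rewrite h eqxx in ne.
case: (eqVneq (col a) 0) => [a0|a0].
  have /matrixP /(_ a b) := K_corner Kg; rewrite !mxE -e a0 eqxx /= !mulr1n => ->.
  by rewrite subrr.
case: (eqVneq a b) => [<-|nab]; first by rewrite K_diag // subrr.
by rewrite K_offdiag // subrr.
Qed.

End Maximality.

(** * Density of the orbit *)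

Section Orbit.
Local Open Scope ring_scope.
Variables (k : closedFieldType) (N : nat) (col : 'I_N -> int).
Hypothesis colN : forall a, col (rev_ord a) = - col a.
Hypothesis char2 : (2%:R : k) != 0.
Implicit Types (A B g h z X Y : 'M[k]_N).

Local Notation Pg := (@Pg k N col).
Local Notation Ug := (@Ug k N col).
Local Notation tri := (@tri k N col).
Local Notation uu := (@uu k N col).
Local Notation pp := (@pp k N col).
Local Notation J := (form_mx k N).

Definition pr A : 'M[k]_N :=
  \matrix_(a, b) ((2%:R^-1 * (A a b - adjm A a b)) *+ (col b < col a)%R).

Lemma pr_uu A : uu (pr A).
Proof.
split; last by move=> a b ab; rewrite mxE ltNge ab.
apply/matrixP=> a b; rewrite !mxE !rev_ordK !colN ltrN2.
by case: (_ < _)%R; rewrite ?mulr0n ?oppr0 // !mulr1n -mulrN opprB.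
Qed.

Lemma pr_id X : uu X -> pr X = X.
Proof.
move=> [sX tX]; apply/matrixP=> a b; rewrite mxE sX mxE opprK.
case: ltP => ab; last by rewrite mulr0n tX.
by rewrite mulr1n (_ : _ + _ = 2%:R * X a b) ?mulKf //; ring.
Qed.

Lemma prD A B : pr (A + B) = pr A + pr B.
Proof.
by apply/matrixP=> a b; rewrite !mxE; case: (_ < _)%R; rewrite ?mulr0n ?addr0 // !mulr1n; ring.
Qed.

Lemma prZ c A : pr (c *: A) = c *: pr A.
Proof.
by apply/matrixP=> a b; rewrite !mxE; case: (_ < _)%R; rewrite ?mulr0n ?mulr0 // !mulr1n; ring.
Qed.

Lemma prN A : pr (- A) = - pr A.
Proof. by rewrite -scaleN1r prZ scaleN1r. Qed.

Lemma pr_sub A : pr (A - pr A) = 0.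
Proof. by rewrite prD prN (pr_id (pr_uu A)) subrr. Qed.

Lemma invmxM g h : g \in unitmx -> h \in unitmx ->
  invmx (g *m h) = invmx h *m invmx g.
Proof.
move=> ug uh; have ugh : g *m h \in unitmx by rewrite unitmx_mul ug.
have e : g *m h *m (invmx h *m invmx g) = 1%:M.
  by rewrite mulmxA -(mulmxA g) mulmxV // mulmx1 mulmxV.
by rewrite -[LHS]mulmx1 -e mulKmx.
Qed.

Lemma Ad_comp g h X : g \in unitmx -> h \in unitmx -> Ad h (Ad g X) = Ad (g *m h) X.
Proof. by move=> ug uh; rewrite /Ad invmxM // !mulmxA. Qed.

Lemma Ad1 X : Ad 1%:M X = X.
Proof. by rewrite /Ad invmx1 mul1mx mulmx1. Qed.

Lemma Ad_so g X : orthogonal_group g -> so X -> so (Ad g X).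
Proof.
move=> og sX; rewrite /so /Ad orthogonal_inv // !adjmM adjmK sX.
by rewrite mulNmx mulmxN mulmxA.
Qed.

Lemma Ad_uu g X : Pg g -> uu X -> uu (Ad g X).
Proof.
move=> Pgg [sX tX]; split; first by apply: Ad_so => //; have [] := Pgg.
apply: strict_triM; last by have [] := Pgg.
by apply: tri_strictM => //; have [] := PgV colN Pgg.
Qed.

Lemma Ad_pp g X : Pg g -> pp X -> pp (Ad g X).
Proof.
move=> Pgg [sX tX]; split; first by apply: Ad_so => //; have [] := Pgg.
apply: triM; last by have [] := Pgg.
by apply: triM => //; have [] := PgV colN Pgg.
Qed.

Variable x : 'M[k]_N.
Hypothesis xu : uu x.
Hypothesis xsurj : forall y, uu y -> exists2 z, pp z & y = x *m z - z *m x.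

Local Notation O := (Ad_orbit Pg x).

Lemma orbit_uu Y : O Y -> uu Y.
Proof. by move=> [g Pgg ->]; apply: Ad_uu. Qed.

Lemma orbit_Ad g Y : Pg g -> O Y -> O (Ad g Y).
Proof.
move=> Pgg [h Ph ->]; exists (h *m g); first exact: PgM.
by rewrite Ad_comp // (Pg_unit (k := k) (col := col)).
Qed.

(** The tangent argument is needed at each point of the orbit; conjugation carries surjectivity from
    [x] to it. *)
Lemma orbit_surj Y y : O Y -> uu y -> exists2 z, pp z & y = Y *m z - z *m Y.
Proof.
move=> [g Pgg ->] uy; have Pi := PgV colN Pgg; have ug := Pg_unit Pgg.
have [z pz yE] := xsurj (Ad_uu Pi uy).
exists (Ad g z); first exact: Ad_pp.
have -> : y = Ad g (Ad (invmx g) y).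
  by rewrite Ad_comp ?unitmx_inv // mulVmx // Ad1.
rewrite yE /Ad mulmxBr mulmxBl.
have e (A B : 'M[k]_N) : invmx g *m A *m g *m (invmx g *m B *m g) = invmx g *m (A *m B) *m g.
  by rewrite !mulmxA -(mulmxA _ g (invmx g)) mulmxV // mulmx1.
by rewrite !e.
Qed.

Definition ofvec (v : 'I_(N * N) -> k) : 'M[k]_N := vec_mx (\row_l v l).

Lemma mxeval_ofvec v f : mxeval (ofvec v) f = f.@[v].
Proof. by apply: meval_eq => l; rewrite vec_mxK mxE. Qed.

Lemma ofvecK A : ofvec (fun l => mxvec A 0 l) = A.
Proof. by rewrite /ofvec -[RHS]mxvecK; congr vec_mx; apply/rowP=> l; rewrite mxE. Qed.

Lemma ofvecE v a b : ofvec v a b = v (mxvec_index a b).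
Proof. by rewrite !mxE. Qed.

(** The orbit thickened by the kernel of [pr]. Unlike the orbit itself, it can be of full dimension
    in the space of matrices, as [mpoly_eq0_dominant] requires. *)
Definition preorbit (v : 'I_(N * N) -> k) : Prop := O (pr (ofvec v)).

(** An elementary direction [B] splits into [pr B], the velocity of a curve conjugating [y] by
    Cayley transforms, and [B - pr B], along which the preimage is invariant. *)
Lemma preorbit_tangent (F : {mpoly k[N * N]}) :
  (forall v, preorbit v -> F.@[v] = 0) ->
  forall l v, preorbit v -> F^`M(l).@[v] = 0.
Proof.
move=> F0 l v Sv; pose A := ofvec v; pose y := pr A.
case/mxvec_indexP: l => i j; pose B : 'M[k]_N := delta_mx i j.
(* The velocity of the Cayley curve is [2 z], hence the equation is solved for half of [pr B]. *)
have [z pz zE] : exists2 z, pp z & pr B = (y *m z - z *m y) + (y *m z - z *m y).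
  have [|z pz zE] := @orbit_surj y (2%:R^-1 *: pr B) Sv.
    by have [s t] := pr_uu B; split; [rewrite /so adjmZ s scalerN | exact: strictZ].
  exists z => //; rewrite -zE -scalerDl.
  have -> : 2%:R^-1 + 2%:R^-1 = 1 :> k.
    by rewrite -[X in X + X]mul1r -mulrDl; exact: mulfV.
  by rewrite scale1r.
pose c t := invmx (1%:M - t *: z) *m (1%:M + t *: z).
have hc : mxgerm c 1%:M (z + z) := cayley_germ z.
have hs : mxgerm (fun t => adjm (c t)) 1%:M (- (z + z)).
  have [sz _] := pz; move=> a b; have := hc (rev_ord b) (rev_ord a).
  rewrite !mxE (inj_eq rev_ord_inj) eq_sym => h.
  have e : z (rev_ord b) (rev_ord a) = - z a b by rewrite -adjmE sz mxE.
  by rewrite e -opprD in h; apply: germ_ext h => t; rewrite !mxE.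
have [r [r0 rE]] := det_line z.
have hg : mxgerm (fun t => adjm (c t) *m y *m c t + ((A - y) + t *: (B - pr B))) A B.
  have := mxgermD (mxgermM (mxgermM hs (mxgerm_const y)) hc) (mxgerm_line (A - y) (B - pr B)).
  rewrite mul1mx mulmx1 mulmx0 addr0 mulmx1 mulNmx => h.
  have e1 : y + (A - y) = A by rewrite addrC subrK.
  have e2 : - ((z + z) *m y) + y *m (z + z) + (B - pr B) = B.
    rewrite zE mulmxDl mulmxDr; apply/matrixP=> a b; rewrite !mxE; ring.
  by rewrite e1 e2 in h.
have [||_] := germ_uniq (r := r) (mxgerm_eval F hg) (germ_const 0).
- by rewrite r0 oner_neq0.
- move=> t rt; have u : 1%:M - t *: z \in unitmx by rewrite unitmxE -rE unitfE.
  have Pc : Pg (c t) by apply: cayley_Pg.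
  set G := (_ + _ : 'M_N); rewrite -(ofvecK G) mxeval_ofvec; apply: F0.
  rewrite /preorbit ofvecK /G !prD prZ pr_sub prN (pr_id (pr_uu A)) subrr add0r.
  rewrite scaler0 addr0 -(orthogonal_inv (proj1 Pc)) -/(Ad _ _) pr_id.
    exact: orbit_Ad.
  by apply: Ad_uu => //; exact: pr_uu.
rewrite /mxdiff (bigD1 (mxvec_index i j)) //= big1 => [|l li]; last first.
  case/mxvec_indexP: l li => a b li; rewrite mxvecE mxE.
  case: eqP => [ai|_]; last by rewrite mulr0.
  case: eqP => [bj|_]; last by rewrite mulr0.
  by rewrite ai bj eqxx in li.
by rewrite mxvecE mxE !eqxx mulr1 addr0 mxeval_ofvec.
Qed.

Lemma preorbit_dense (F : {mpoly k[N * N]}) :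
  (forall v, preorbit v -> F.@[v] = 0) -> F = 0.
Proof.
apply: mpoly_eq0_dominant; last exact: preorbit_tangent.
exists (fun l => mxvec x 0 l); rewrite /preorbit ofvecK pr_id //.
by exists 1%:M; [exact: Pg1 | rewrite Ad1].
Qed.

Definition mxterm (F : (nat -> k) -> 'M[k]_N) : Prop :=
  forall a b, termfun (fun e => F e a b).

Lemma mxterm_const A : mxterm (fun=> A).
Proof. by move=> a b; exact: termfun_const. Qed.

Lemma mxtermM F G : mxterm F -> mxterm G -> mxterm (fun e => F e *m G e).
Proof.
move=> hF hG a b; apply: termfun_ext (_ : termfun (fun e => \sum_j F e a j * G e j b)).
  by move=> e; rewrite mxE.
by apply: termfun_sum => j; apply: termfunM.
Qed.

Lemma mxtermB F G : mxterm F -> mxterm G -> mxterm (fun e => F e - G e).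
Proof.
move=> hF hG a b; apply: termfun_ext (termfunD (hF a b) (termfunN (hG a b))) => e.
by rewrite !mxE.
Qed.

Lemma mxterm_tr F : mxterm F -> mxterm (fun e => (F e)^T).
Proof. by move=> hF a b; apply: termfun_ext (hF b a) => e; rewrite mxE. Qed.

Lemma mxterm_pr F : mxterm F -> mxterm (fun e => pr (F e)).
Proof.
move=> hF a b; case ab: (col b < col a)%R; last first.
  by apply: termfun_ext (termfun_const 0) => e; rewrite mxE ab.
apply: termfun_ext (termfunM (termfun_const 2%:R^-1)
  (termfunD (hF a b) (termfunN (hF (rev_ord b) (rev_ord a))))) => e.
by rewrite !mxE ab.
Qed.

Lemma preorbit_open : (forall v, preorbit v \/ ~ preorbit v) /\
  exists2 h : {mpoly k[N * N]}, h != 0 & forall v, h.@[v] != 0 -> preorbit v.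
Proof.
(* The first [N * N] variables are the entries of the matrix, the next [N * N] those of the
   conjugating element, which is quantified. *)
pose EA (e : nat -> k) : 'M[k]_N := \matrix_(a, b) e (mxvec_index a b).
pose EG (e : nat -> k) : 'M[k]_N := \matrix_(a, b) e (N * N + mxvec_index a b)%N.
have hA : mxterm EA.
  by move=> a b; apply: termfun_ext (termfun_var k (mxvec_index a b)) => e; rewrite mxE.
have hG : mxterm EG.
  by move=> a b; apply: termfun_ext (termfun_var k (N * N + mxvec_index a b)) => e; rewrite mxE.
(* Conjugacy is expressed as [g *m pr A = x *m g], which involves no inverse. *)
pose phi (i : ('I_N * 'I_N) + (('I_N * 'I_N) + ('I_N * 'I_N))) (e : nat -> k) : k :=
  match i with
  | inl (a, b) => (EG e *m J *m (EG e)^T - J) a b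
  | inr (inl (a, b)) => (EG e) a b * (col a < col b)%R%:R
  | inr (inr (a, b)) => (EG e *m pr (EA e) - x *m EG e) a b
  end.
apply: (@dense_projection_open k _ (N * N) _ phi); last exact: preorbit_dense.
  move=> [[a b]|[[a b]|[a b]]]; rewrite /phi.
  - apply: mxtermB; last exact: mxterm_const.
    by apply: mxtermM; [apply: mxtermM => //; exact: mxterm_const | exact: mxterm_tr].
  - by apply: termfunM; [exact: hG | exact: termfun_const].
  - apply: mxtermB; first by apply: mxtermM => //; exact: mxterm_pr.
    by apply: mxtermM => //; exact: mxterm_const.
have EAE v w : EA (nth 0 (codom v ++ w)) = ofvec v.
  apply/matrixP=> a b; rewrite ofvecE mxE nth_cat size_codom card_ord ltn_ord.
  by rewrite nth_codom_ord.
move=> v; split=> [[g Pgg gE]|[w sw h]].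
  exists (codom (fun l => mxvec g 0 l)); first by rewrite size_codom card_ord.
  have EGE : EG (nth 0 (codom v ++ codom (fun l => mxvec g 0 l))) = g.
    apply/matrixP=> a b; rewrite mxE nth_cat size_codom card_ord.
    have -> i : (N * N + i < N * N)%N = false by lia.
    by rewrite addKn nth_codom_ord mxvecE.
  have [og tg] := Pgg.
  move=> [[a b]|[[a b]|[a b]]]; rewrite /phi EGE.
  - by rewrite og subrr mxE.
  - by case: ltP => ab; rewrite ?mulr0 // tg ?mul0r.
  - by rewrite EAE gE /Ad !mulmxA mulmxV ?(Pg_unit Pgg) // mul1mx subrr mxE.
pose g := EG (nth 0 (codom v ++ w)).
have Pgg : Pg g.
  split.
    apply/eqP; rewrite -subr_eq0; apply/eqP/matrixP=> a b.
    by rewrite [RHS]mxE; exact: (h (inl (a, b))).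
  move=> a b ab; have := h (inr (inl (a, b))); rewrite /phi ab mulr1.
  by [].
have ug := Pg_unit Pgg.
exists g => //; rewrite /Ad.
have e : g *m pr (ofvec v) = x *m g.
  apply/eqP; rewrite -subr_eq0; apply/eqP/matrixP=> a b.
  by rewrite [RHS]mxE; have := h (inr (inr (a, b))); rewrite /phi EAE.
by rewrite -mulmxA -e mulKmx.
Qed.

(** An orbit which contains one nonempty open set is the union of its translates, hence open. *)
Lemma Richardson_of_surj : Richardson Pg x.
Proof.
exists Ug; split.
  split; last by move=> K [[Ksub _] _ Knorm Kuni] g; exact: K_Ug.
  split; [exact: Ug_closed|exact: Ug_connected|exact: Ug_normal|exact: Ug_unipotent].
have LE X : Lie Ug X <-> uu X by exact: LieU.
have [Odec [h h0 hO]] := preorbit_open.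
split; first by rewrite LE.
- split; first by move=> A /orbit_uu; rewrite LE.
  pose I := {p : 'M[k]_N * 'M[k]_N | Pg p.1 /\ pr p.2 = 0}.
  (* The complement is cut out by all translates of [h]. Those by the kernel of [pr] are needed
     because [h], a nonzero polynomial on all matrices, could vanish on the whole of [uu]. *)
  exists (fun Y => forall p : I, mxeval (Ad (sval p).1 Y + (sval p).2) h = 0).
    apply: zclosed_family => -[[g B] /= [Pgg B0]].
    apply: mxpolyfun_comp => a b.
    apply: mxpolyfun_ext (_ : mxpolyfun (fun A => (invmx g *m A *m g) a b + B a b)).
      by move=> A; rewrite [RHS]mxE.
    apply: mxpolyfunD; last exact: mxpolyfun_const.
    apply: mxpolyfun_mulmx => *; last exact: mxpolyfun_const.
    by apply: mxpolyfun_mulmx => *; [exact: mxpolyfun_const | exact: mxpolyfun_entry].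
  move=> Y; rewrite LE => uY; split.
    move=> [g Pgg YE] Z0; case/negP: h0; apply/eqP/preorbit_dense=> v [g' Pg' vE].
    rewrite -mxeval_ofvec.
    have PI : Pg (invmx g *m g') /\ pr (ofvec v - pr (ofvec v)) = 0.
      by split; [apply: PgM => //; exact: PgV | exact: pr_sub].
    have := Z0 (exist _ (invmx g *m g', ofvec v - pr (ofvec v)) PI); rewrite /= YE.
    have ug := Pg_unit Pgg; have ug' := Pg_unit Pg'.
    rewrite Ad_comp ?unitmx_mul ?unitmx_inv ?ug // mulKVmx // -vE addrC subrK //.
  (* Quantifier elimination makes membership in the orbit decidable, so one may argue by
     contradiction. *)
  move=> nZ; have [|nS] := Odec (fun l => mxvec Y 0 l).
    by rewrite /preorbit ofvecK pr_id.
  case: nZ => -[[g B] /= [Pgg B0]]; apply/eqP/negPn/negP.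
  rewrite -(ofvecK (_ + _)) mxeval_ofvec => /hO; rewrite /preorbit ofvecK prD B0 addr0.
  rewrite pr_id; last exact: Ad_uu.
  move=> /(orbit_Ad (PgV colN Pgg)); rewrite Ad_comp ?unitmx_inv ?(Pg_unit Pgg) //.
  rewrite mulmxV ?(Pg_unit Pgg) // Ad1 => OY; apply: nS.
  by rewrite /preorbit ofvecK pr_id.
- split; first by move=> A /orbit_uu; rewrite LE.
  move=> Z [F ZE] OZ Y; rewrite LE => uY; apply/ZE => f Ff.
  (* Composition with [pr] turns an equation valid on the orbit into one valid on its preimage. *)
  have [f' f'E] : mxpolyfun (fun A => mxeval (pr A) f).
    apply: mxpolyfun_comp => a b; case ab: (col b < col a)%R; last first.
      by apply: mxpolyfun_ext (mxpolyfun_const N 0) => A; rewrite mxE ab.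
    apply: mxpolyfun_ext (mxpolyfunM (mxpolyfun_const N 2%:R^-1)
      (mxpolyfunD (mxpolyfun_entry k a b) (mxpolyfunN (mxpolyfun_entry k (rev_ord b) (rev_ord a))))) => A.
    by rewrite !mxE ab.
  have f'0 : f' = 0.
    apply: preorbit_dense => v Sv; rewrite -mxeval_ofvec f'E.
    by apply: (ZE _).1 => //; exact: OZ.
  by rewrite -(pr_id uY) -f'E f'0 /mxeval meval0.
Qed.

End Orbit.

(** * Surjectivity by duality for the trace form *)

Section Duality.
Local Open Scope ring_scope.
Variables (k : closedFieldType) (N : nat) (col : 'I_N -> int).
Hypothesis colN : forall a, col (rev_ord a) = - col a.
Hypothesis char2 : (2%:R : k) != 0.
Implicit Types (A B g h z X Y : 'M[k]_N).

Local Notation tri := (@tri k N col).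
Local Notation strict := (@strict k N col).
Local Notation uu := (@uu k N col).
Local Notation pp := (@pp k N col).

Lemma tr_mul_mxvec A (c : 'cV[k]_(N * N)) :
  \tr (A *m \matrix_(i, j) c (mxvec_index j i) 0) = (mxvec A *m c) 0 0.
Proof.
rewrite [RHS]mxE (reindex _ (curry_mxvec_bij N N)) /=.
transitivity (\sum_i \sum_j A i j * c (mxvec_index i j) 0).
  by apply: eq_bigr => i _; rewrite mxE; apply: eq_bigr => j _; rewrite mxE.
by rewrite pair_big /=; apply: eq_bigr => -[i j] _ /=; rewrite mxvecE.
Qed.

Lemma so_commutator X Y : so X -> so Y -> so (X *m Y - Y *m X).
Proof.
move=> sX sY; rewrite /so adjmD adjmN !adjmM sX sY !mulNmx !mulmxN !opprK.
by rewrite opprB.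
Qed.

Lemma tr_so_sub X A : so X -> \tr (X *m (A - adjm A)) = 2%:R * \tr (X *m A).
Proof.
move=> sX; rewrite mulmxBr raddfB /= -[X in _ - X]tr_adjm adjmM adjmK sX mulmxN.
by rewrite raddfN /= [\tr (A *m X)]mxtrace_mulC; ring.
Qed.

(* The trace form identifies [uu] with the dual of [so / pp]. *)
Lemma surj_of_dual (x : 'M[k]_N) : uu x ->
  (forall w, so w -> strict (w *m x - x *m w) -> tri w) ->
  forall y, uu y -> exists2 z, pp z & y = x *m z - z *m x.
Proof.
move=> [sx tx] core y [sy ty].
(* The matrices [z l] are the elementary matrices made skew and cut to the triangular part; the rows
   of [F] are their commutators with [x]. *)
pose e (l : 'I_(N * N)) : 'M[k]_N := vec_mx (delta_mx 0 l).
pose z (l : 'I_(N * N)) : 'M[k]_N :=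
  \matrix_(a, b) ((e l a b - adjm (e l) a b) *+ (col b <= col a)%R).
have zpp l : pp (z l).
  split; last by move=> a b ab; rewrite mxE leNgt ab.
  apply/matrixP=> a b; rewrite !mxE !rev_ordK !colN lerN2.
  by case: (_ <= _)%R; rewrite ?mulr0n ?oppr0 // !mulr1n opprB.
pose F : 'M[k]_(N * N) := \matrix_(l, m) mxvec (x *m z l - z l *m x) 0 m.
have rowF l : row l F = mxvec (x *m z l - z l *m x).
  by apply/rowP=> m; rewrite !mxE.
case: (boolP (mxvec y <= F)%MS) => [/submxP [D yE]|nyF].
  exists (\sum_l D 0 l *: z l).
    split; last first.
      move=> a b ab; rewrite summxE big1 // => l _.
      by rewrite mxE (zpp l).2 ?mulr0.
    rewrite /so -sumrN.
    have -> : adjm (\sum_l D 0 l *: z l) = \sum_l adjm (D 0 l *: z l).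
      apply: (big_morph (@adjm k N)); first exact: adjmD.
      by apply/matrixP=> a b; rewrite !mxE.
    by apply: eq_bigr => l _; rewrite adjmZ (zpp l).1 scalerN.
  apply: (can_inj mxvecK); rewrite yE mulmx_sum_row mulmx_sumr mulmx_suml -sumrB raddf_sum.
  apply: eq_bigr => l _; rewrite rowF -scalemxAr -scalemxAl -scalerBr.
  by rewrite -[RHS]/(mxvec (D 0 l *: (x *m z l - z l *m x))) linearZ.
(* Otherwise a linear form kills all these commutators but not [y]. *)
have [c Fc yc] : exists2 c : 'cV[k]_(N * N), F *m c = 0 & (mxvec y *m c) 0 0 != 0.
  have : mxvec y *m cokermx F != 0 by rewrite -submxE.
  move=> nz; have /existsP [j hj] : [exists j, (mxvec y *m cokermx F) 0 j != 0].
    apply: contraNT nz => /existsPn h; apply/eqP/rowP=> j; rewrite [RHS]mxE.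
    by apply/eqP; have := h j; rewrite negbK.
  exists (matrix.col j (cokermx F)).
    by rewrite colE mulmxA mulmx_coker mul0mx.
  by rewrite colE mulmxA -colE mxE.
(* The linear form is written as the trace against [W], hence the exchanged indices; on skew
   matrices only the skew part of [W] counts. *)
pose W : 'M[k]_N := \matrix_(i, j) c (mxvec_index j i) 0.
have WE A : \tr (A *m W) = (mxvec A *m c) 0 0 by exact: tr_mul_mxvec.
clearbody W.
pose w := W - adjm W.
have sw : so w by rewrite /so /w adjmD adjmN adjmK opprB addrC.
have trw A : so A -> \tr (A *m w) = 2%:R * \tr (A *m W) by exact: tr_so_sub.
clearbody w; have sB := so_commutator sw sx.
(* Invariance of the trace form moves the commutator from [z l] to [w]. *)
have z0 l : \tr (z l *m (w *m x - x *m w)) = 0.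
  have : \tr ((x *m z l - z l *m x) *m w) = 0.
    rewrite trw; last by apply: so_commutator => //; have [] := zpp l.
    by rewrite WE -rowF -row_mul Fc !mxE mulr0.
  move=> <-; rewrite mulmxBr mulmxBl !raddfB /= !mulmxA; congr (_ - _).
  by rewrite mxtrace_mulC mulmxA.
have stB : strict (w *m x - x *m w).
  move=> a b ab; have := z0 (mxvec_index b a).
  set B := w *m x - x *m w in sB *; clearbody B.
  (* In this position the triangular cut removes nothing, so the trace against [z] reads off twice
     the entry [(a, b)] of the commutator. *)
  have -> : z (mxvec_index b a) = delta_mx b a - adjm (delta_mx b a).
    have eE : e (mxvec_index b a) = delta_mx b a by rewrite /e vec_mx_delta.
    apply/matrixP=> i j; rewrite [LHS]mxE eE [RHS]mxE [X in _ = _ + X]mxE.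
    case: leP => ij; first by rewrite mulr1n.
    rewrite mulr0n adjmE !mxE.
    case: eqP => [ib|_] /=.
      case: eqP => [ja|_] /=; first by move: ij; rewrite ib ja ltNge ab.
      case: eqP => [jb|_] /=; last by rewrite subr0.
      case: eqP => [ia|_]; last by rewrite subr0.
      by move: ij ab; rewrite -jb -ia !colN lerN2 ltNge => /negP ij /ij.
    case: eqP => [jb|_] /=; last by rewrite subr0.
    case: eqP => [ia|_]; last by rewrite subr0.
    by move: ij ab; rewrite -jb -ia !colN lerN2 ltNge => /negP ij /ij.
  rewrite mxtrace_mulC tr_so_sub // => /eqP; rewrite mulf_eq0 (negPf char2) /= => /eqP.
  rewrite /mxtrace (bigD1 a) //= big1 => [|i ia].
    rewrite mxE (bigD1 b) //= big1 => [|j jb]; first by rewrite mxE !eqxx mulr1 !addr0.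
    by rewrite mxE (negPf jb) mulr0.
  by rewrite mxE big1 // => j _; rewrite mxE (negPf ia) andbF mulr0.
have tw := core w sw stB.
have : \tr (y *m w) = 0.
  rewrite /mxtrace big1 // => i _; rewrite mxE big1 // => j _.
  by case: (leP (col i) (col j)) => ij; [rewrite ty ?mul0r | rewrite tw ?mulr0].
by rewrite trw // WE => /eqP; rewrite mulf_eq0 (negPf char2) (negPf yc).
Qed.

End Duality.

(** * Alternating forms on line diagrams *)

(* [lia] is slow in the presence of many non-arithmetic hypotheses. *)
Ltac arith_hyp T :=
  lazymatch T with
  | is_true (Order.lt _ _) => idtac
  | is_true (Order.le _ _) => idtac
  | is_true (leq _ _) => idtac
  | is_true (andb _ _) => idtac
  | @eq ?A _ _ => first [unify A int | unify A nat]
  | not (is_true (andb _ _)) => idtac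
  | is_true (negb (@eq_op ?A _ _)) =>
      first [unify (Equality.sort A) int | unify (Equality.sort A) nat]
  | or ?A ?B => arith_hyp A; arith_hyp B
  | ?A -> ?B => arith_hyp A; arith_hyp B
  | not (@eq ?A _ _) => first [unify A int | unify A nat]
  end.
Ltac zlia :=
  intros;
  repeat match goal with H : ?T |- _ => tryif arith_hyp T then fail else clear H end;
  lia.

Section AlternatingForm.
Local Open Scope ring_scope.
Variables (k : fieldType) (vs : seq vertex) (ar : rel vertex).
(* [F j c] is the entry of the [j]-th dimension vector at [c], [E] gives the
   coefficients of a skew matrix [x], and [om] is the alternating form attached to
   a skew matrix [w], whose commutator with [x] is strictly triangular. *)
Variables (E om : vertex -> vertex -> k) (F : nat -> int -> nat).
Implicit Types (p q z : vertex) (i j : nat) (a b c y : int).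

Hypothesis char2 : (2%:R : k) != 0.
Hypothesis vs_uniq : uniq vs.
Local Notation V := (fun p => p \in vs).

Hypothesis FN : forall j c, F j (- c) = F j c.
Hypothesis F_le2 : forall j c, (F j c <= 2)%N.
Hypothesis F0_neq1 : forall j, (0 < j)%N -> F j 0 <> 1%N.
Hypothesis F_row0 : forall c, (F 0 c <= 1)%N.

Hypothesis V_up : forall j c, (0 < j)%N ->
  V (c, j%:Z) = (if (0 <= c)%R then F j c != 0%N else F j c == 2%N).
Hypothesis V_low : forall j c, (0 < j)%N ->
  V (c, - j%:Z) = (if (c <= 0)%R then F j c != 0%N else F j c == 2%N).
Hypothesis V_mid : forall c, V (c, 0) = (F 0 c == 1%N).

Hypothesis ar_V : forall p q, ar p q -> V p /\ V q.
Hypothesis ar_lt : forall p q, ar p q -> (q.1 < p.1)%R.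
Hypothesis ar_row : forall r a b, ar (a, r) (b, r) <->
  [/\ V (a, r), V (b, r), (b < a)%R & forall y, V (y, r) -> ~ (b < y < a)%R].
Hypothesis ar_cross : forall p q, ar p q -> p.2 <> q.2 ->
  exists2 j, (0 < j)%N & p.2 = j%:Z /\ q.2 = - j%:Z.

Definition minsupp j l := [/\ (0 < l)%R, F j l <> 0%N &
  forall c, (0 < c)%R -> F j c <> 0%N -> (l <= c)%R].

Hypothesis cross_C : forall j l a b, (0 < j)%N -> F j 0 = 2%N ->
  (exists c, F j c = 1%N) -> minsupp j l ->
  ar (a, j%:Z) (b, - j%:Z) = ((a, b) == (l, 0)) || ((a, b) == (0, - l)).
Hypothesis cross_D1 : forall j a b, (0 < j)%N -> F j 0 = 0%N ->
  (forall c c', (0 < c)%R -> (0 < c')%R -> F j c = 1%N -> F j c' = 1%N -> c = c') ->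
  ar (a, j%:Z) (b, - j%:Z) = false.
Hypothesis cross_D2 : forall j l l' a b, (0 < j)%N -> F j 0 = 0%N ->
  (exists c c', [/\ (0 < c)%R, (c < c')%R, F j c = 1%N & F j c' = 1%N]) ->
  minsupp j l -> (l < l')%R -> F j l' <> 0%N ->
  (forall c, (l < c)%R -> F j c <> 0%N -> (l' <= c)%R) ->
  ar (a, j%:Z) (b, - j%:Z) = ((a, b) == (l, - l')) || ((a, b) == (l', - l)).

Definition vneg p : vertex := (- p.1, - p.2).
Hypothesis E_neq0 : forall p q, ar p q -> E p q != 0.
Hypothesis E_anti : forall p q, ar p q -> E p q = - E (vneg q) (vneg p).

Hypothesis om_anti : forall p q, om q p = - om p q.
Hypothesis om_rel : forall p q, V p -> V q -> (p.1 + q.1 <= 0)%R ->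
  \sum_(z <- vs | ar p z) E p z * om z q + \sum_(z <- vs | ar q z) E q z * om p z = 0.

Lemma om_alt p : om p p = 0.
Proof.
have /eqP := om_anti p p; rewrite -subr_eq0 opprK => h.
have : 2%:R * om p p = 0 by rewrite -[RHS](eqP h); ring.
by move=> /eqP; rewrite mulf_eq0 (negPf char2) => /eqP.
Qed.

Lemma sum_out0 p (g : vertex -> k) : (forall z, ar p z -> g z = 0) ->
  \sum_(z <- vs | ar p z) E p z * g z = 0.
Proof. by move=> g0; rewrite big1 // => z /g0 ->; rewrite mulr0. Qed.

Lemma sum_outD p q (g : vertex -> k) : ar p q ->
  \sum_(z <- vs | ar p z) E p z * g z =
  E p q * g q + \sum_(z <- vs | ar p z) E p z * (if z == q then 0 else g z).
Proof.
move=> pq; have [_ Vq] := ar_V pq.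
rewrite big_mkcond [X in _ + X]big_mkcond /= !(bigD1_seq q) //= pq eqxx mulr0 add0r.
by congr (_ + _); apply: eq_bigr => z /negPf ->.
Qed.

Lemma sum_out1 p q (g : vertex -> k) : ar p q ->
  (forall z, ar p z -> z <> q -> g z = 0) ->
  \sum_(z <- vs | ar p z) E p z * g z = E p q * g q.
Proof.
move=> pq g0; rewrite (sum_outD _ pq) sum_out0 ?addr0 // => z pz.
by case: eqP => // /(g0 _ pz).
Qed.

Lemma sum_out2 p q q' (g : vertex -> k) : ar p q -> ar p q' -> q <> q' ->
  (forall z, ar p z -> z <> q -> z <> q' -> g z = 0) ->
  \sum_(z <- vs | ar p z) E p z * g z = E p q * g q + E p q' * g q'.
Proof.
move=> pq pq' qq' g0; rewrite (sum_outD _ pq) (sum_out1 pq') => [|z pz zq'].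
  by case: eqP => // e; case: qq'.
by case: eqP => // zq; apply: g0.
Qed.

Definition good p q := (p.1 + q.1 < 0)%R -> om p q = 0.

Lemma good_sym p q : good p q -> good q p.
Proof. by move=> h pq; rewrite om_anti h ?oppr0 // addrC. Qed.

(** One rung: all terms of the relation for [p] and [q] vanish except the one of the arrow from [q]
    to [q0], whose coefficient is nonzero. *)
Lemma ladder p q q0 : V p -> ar q q0 -> (p.1 + q.1 <= 0)%R ->
  (forall z, ar p z -> om z q = 0) ->
  (forall z, ar q z -> z <> q0 -> om p z = 0) -> om p q0 = 0.
Proof.
move=> Vp qq0 pq zp zq; have [Vq _] := ar_V qq0.
have := om_rel Vp Vq pq; rewrite sum_out0 // add0r (sum_out1 qq0) //.
by move=> /eqP; rewrite mulf_eq0 (negPf (E_neq0 qq0)) => /eqP.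
Qed.

Lemma col_ind (P : vertex -> Prop) :
  (forall p, V p -> (forall q, V q -> (q.1 < p.1)%R -> P q) -> P p) ->
  forall p, V p -> P p.
Proof.
move=> H p; have [n] := ubnP (count (fun r : vertex => (r.1 < p.1)%R) vs).
elim: n p => // n IH p; rewrite ltnS => cp Vp; apply: (H) => // q Vq qp.
apply: IH => //; apply: leq_trans cp.
rewrite -!size_filter.
have : (size (q :: [seq r : vertex <- vs | (r.1 < q.1)%R]) <=
        size [seq r : vertex <- vs | (r.1 < p.1)%R])%N.
  apply: uniq_leq_size => [|r].
    by rewrite /= mem_filter ltxx filter_uniq.
  rewrite in_cons !mem_filter => /orP [/eqP ->|/andP [h ->]]; first by rewrite qp Vq.
  by rewrite (lt_trans h).
by [].
Qed.

Lemma int_ind_up (P : int -> Prop) :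
  (forall c, (0 < c)%R -> (forall c', (0 < c')%R -> (c' < c)%R -> P c') -> P c) ->
  forall c, (0 < c)%R -> P c.
Proof.
move=> H c; have [n] := ubnP `|c|%N; elim: n c => // n IH c cn c0.
by apply: (H) => // c' h1 h2; apply: IH => //; zlia.
Qed.

Lemma row_pred r c0 c : V (c0, r) -> V (c, r) -> (c0 < c)%R ->
  exists c1, [/\ ar (c1, r) (c0, r), (c0 < c1)%R & (c1 <= c)%R].
Proof.
move=> V0; have [n] := ubnP `|c - c0|%N.
elim: n c => // n IH c cn Vc c0c.
case: (boolP (has (fun y : vertex => (y.2 == r) && (c0 < y.1 < c)%R) vs)).
  move=> /hasP [[y r'] /= Vy /andP [/eqP rr yc]]; subst r'.
  by have [||c1 [h1 h2 h3]] := IH y _ Vy; [zlia|zlia|exists c1; split=> //; zlia].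
move=> /hasPn hn; exists c; split=> //; apply/ar_row; split=> // y Vy h.
by have := hn _ Vy; rewrite /= eqxx h.
Qed.

Lemma ar_row_uniq r a b b' : ar (a, r) (b, r) -> ar (a, r) (b', r) -> b = b'.
Proof.
move=> /ar_row [_ Vb ba nb] /ar_row [_ Vb' ba' nb'].
have := nb _ Vb'; have := nb' _ Vb; zlia.
Qed.

(** As the row has a vertex in the column opposite to [p], the predecessor [c1] of any column to its
    left satisfies [p.1 + c1 <= 0], so that the relation for [p] and [(c1, r)] is available. *)
Lemma ladder_row p r : V p -> V (- p.1, r) ->
  (forall z, ar p z -> forall c, V (c, r) -> good z (c, r)) ->
  (forall c z, ar (c, r) z -> z.2 <> r -> good p z) ->
  forall c, V (c, r) -> good p (c, r).
Proof.
move=> Vp Vr zg eg c0 V0; rewrite /good /= => pc0.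
have [|c1 [ar1 h1 h2]] := row_pred V0 Vr; first by zlia.
have [V1 _] := ar_V ar1.
apply: (ladder Vp ar1) => /=; first by zlia.
- move=> z pz; apply: zg => //=; have := ar_lt pz; zlia.
- move=> [b r'] az ne; case: (eqVneq r' r) => [rr|/eqP rr].
    by case: ne; rewrite rr in az *; rewrite (ar_row_uniq az ar1).
  by apply: (eg c1) => //=; have /= := ar_lt az; zlia.
Qed.

(** The vertices of the [j]-th small diagram. *)
Definition comp j p := V p /\ (p.2 = j%:Z \/ p.2 = - j%:Z).

Lemma comp_ar j p z : ar p z -> comp j p -> comp j z.
Proof.
move=> pz [Vp pj]; split; first by have [] := ar_V pz.
case: (eqVneq p.2 z.2) => [<- //|/eqP /(ar_cross pz) [i i0 [pi zi]]].
by move: pj; rewrite pi zi => -[]; zlia.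
Qed.

(** Both rows meet the column opposite to [p]. The lower row comes first, since no arrow leaves it;
    arrows from the upper row to the lower one then end in settled pairs. *)
Lemma ladder_rows2 j p : (0 < j)%N -> V p -> F j p.1 = 2%N ->
  (forall z, ar p z -> forall q, comp j q -> good z q) ->
  forall q, comp j q -> good p q.
Proof.
move=> j0 Vp Fp zg.
have Vr r : r = j%:Z \/ r = - j%:Z -> V (- p.1, r).
  by case=> ->; rewrite ?V_up ?V_low // FN Fp eqxx /= if_same.
have low c : V (c, - j%:Z) -> good p (c, - j%:Z).
  apply: ladder_row => //; first by apply: Vr; right.
    by move=> z pz c' Vc'; apply: zg => //; split=> //; right.
  move=> c' z az /= zj; have [|i i0 /= [e1 e2]] := ar_cross az; last by zlia.
  by move=> /= e; apply: zj.
move=> [c r] [Vq /= [] rj]; subst r; last exact: low.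
apply: ladder_row => //; first by apply: Vr; left.
  by move=> z pz c' Vc'; apply: zg => //; split=> //; left.
move=> c' [b r] az /= rj; have [|i i0 /= [e1 e2]] := ar_cross az.
  by move=> /= e; apply: rj.
have rE : r = - j%:Z by zlia.
by rewrite rE in az *; have [_ Vb] := ar_V az; exact: (low b Vb).
Qed.

Lemma V_comp c r : V (c, r) -> F `|r|%N c <> 0%N.
Proof.
case: (ltgtP r 0) => r0.
- have -> : r = - (`|r|%N)%:Z by zlia.
  rewrite V_low ?absz_gt0; last by zlia.
  rewrite abszN absz_nat; case: ifP => _ /eqP; zlia.
- have {1}-> : r = (`|r|%N)%:Z by zlia.
  by rewrite V_up ?absz_gt0; [case: ifP => _ /eqP; zlia|zlia].
- by rewrite r0 V_mid => /eqP; rewrite absz0 => ->.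
Qed.

Lemma comp_F j p : comp j p -> F j p.1 <> 0%N.
Proof.
case: p => c r [Vp /= rj]; have := V_comp Vp.
by have -> : `|r|%N = j by zlia.
Qed.

(** Every vertex on a path from [p] has two vertices of the [j]-th piece in the opposite column, so
    ladders exist at each stage of the induction on the abscissa. *)
Lemma good_nested i j : (0 < j)%N -> (forall c, F i c <> 0%N -> F j c = 2%N) ->
  forall p q, comp i p -> comp j q -> good p q.
Proof.
move=> j0 ij; suff H p : V p -> comp i p -> forall q, comp j q -> good p q.
  by move=> p q pi; apply: H => //; have [] := pi.
move: p; apply: col_ind => p Vp IH pi.
apply: (ladder_rows2 j0 Vp) => //; first by apply: ij; apply: comp_F.
move=> z pz q' q'j; have zi := comp_ar pz pi; have [Vz _] := zi.
apply: (IH) => //; exact: ar_lt.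
Qed.

Lemma good_nested0 i : (forall c, F i c <> 0%N -> F 0 c = 1%N) ->
  forall p q, comp i p -> comp 0 q -> good p q.
Proof.
move=> ij; suff H p : V p -> comp i p -> forall q, comp 0 q -> good p q.
  by move=> p q pi; apply: H => //; have [] := pi.
move: p; apply: col_ind => p Vp IH pi [c r] [Vq /= r0].
have {r0} r0 : r = 0 by zlia.
subst r; apply: ladder_row => //.
- by rewrite V_mid FN ij //; apply: comp_F.
- move=> z pz c' Vc'; have zi := comp_ar pz pi; have [Vz _] := zi.
  apply: (IH) => //; first exact: ar_lt.
  by split=> //; left.
- move=> c' z az /= z0; have [|i' i0 /= [e1 e2]] := ar_cross az; last by zlia.
  by move=> /= e; apply: z0.
Qed.

Lemma supp_next j b c : (b < c)%R -> F j c <> 0%N ->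
  exists l, [/\ (b < l)%R, F j l <> 0%N &
    forall c', (b < c')%R -> F j c' <> 0%N -> (l <= c')%R].
Proof.
move=> bc Fc; have ex : exists n : nat, F j (b + n.+1%:Z) != 0%N.
  exists `|c - b|%N.-1; have -> : b + (`|c - b|%N.-1).+1%:Z = c by zlia.
  by apply/eqP.
have [n /eqP Fn nmin] := ex_minnP ex; exists (b + n.+1%:Z); split=> //; first by zlia.
move=> c' bc' Fc'; have := nmin `|c' - b|%N.-1.
have -> : b + (`|c' - b|%N.-1).+1%:Z = c' by zlia.
move/eqP: Fc' => Fc' /(_ Fc'); zlia.
Qed.

Local Notation U i c := ((c, i%:Z) : vertex).
Local Notation Y i c := ((c, - i%:Z) : vertex).

Lemma out_low i c z : (0 < i)%N -> ar (Y i c) z -> z = Y i z.1.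
Proof.
case: z => c' r i0 az; case: (eqVneq (- i%:Z) r) => [<- //|/eqP ir].
by have [j j0 /= [e1 e2]] := ar_cross az ir; zlia.
Qed.

Lemma out_up i c z : (0 < i)%N -> ar (U i c) z -> z = U i z.1 \/ z = Y i z.1.
Proof.
case: z => c' r i0 az; case: (eqVneq (i%:Z) r) => [<-|/eqP ir]; first by left.
have [j j0 /= [e1 e2]] := ar_cross az ir; right; congr (_, _); zlia.
Qed.

Lemma comp_up i c : V (U i c) -> comp i (U i c).
Proof. by split=> //; left. Qed.

Lemma comp_low i c : V (Y i c) -> comp i (Y i c).
Proof. by split=> //; right. Qed.

Lemma suppN i c : F i c <> 0%N -> F i (- c) <> 0%N.
Proof. by rewrite FN. Qed.

Lemma V_up_supp i c : (0 < i)%N -> (0 <= c)%R -> F i c <> 0%N -> V (U i c).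
Proof. by move=> i0 c0 /eqP Fc; rewrite V_up // c0. Qed.

Lemma V_low_supp i c : (0 < i)%N -> (c <= 0)%R -> F i c <> 0%N -> V (Y i c).
Proof. by move=> i0 c0 /eqP Fc; rewrite V_low // c0. Qed.

Lemma goodE p q : (p.1 + q.1 < 0)%R -> good p q -> om p q = 0.
Proof. by move=> pq; apply. Qed.

(** In a negative column the upper row has a vertex only if the entry is 2, and its successors stay
    in the same situation. *)
Lemma good_up_neg i j : (0 < i)%N -> (0 < j)%N ->
  (forall c, F i c = 2%N -> F j c = 2%N) ->
  (forall c z, (c < 0)%R -> ar (U i c) z -> z = U i z.1) ->
  forall c, (c < 0)%R -> V (U i c) -> forall q, comp j q -> good (U i c) q.
Proof.
move=> i0 j0 ij nocross.
suff H p : V p -> p.2 = i%:Z -> (p.1 < 0)%R -> forall q, comp j q -> good p q.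
  by move=> c c0 Vc; apply: H.
move: p; apply: col_ind => -[c r] Vc IH /= rE c0; subst r.
have Fc : F i c = 2%N by move: Vc; rewrite V_up // leNgt c0 /= => /eqP.
apply: (ladder_rows2 j0 Vc); first exact: ij.
move=> z cz; have zE := nocross _ _ c0 cz; have [_ Vz] := ar_V cz.
have /= lt := ar_lt cz; apply: (IH) => //; first by rewrite zE.
exact: lt_trans lt c0.
Qed.

(** The upper row meets all positive columns of the support, so it contains the start [- p.1] of the
    ladder; the rungs stay to the right of [b], where no arrow leaves the row. *)
Lemma good_up_pos i j b : (0 < i)%N -> (0 < b)%R ->
  (forall c, F j c <> 0%N -> F i c <> 0%N) ->
  (forall c z, (b < c)%R -> ar (U i c) z -> z = U i z.1) ->
  forall p, V p -> comp j p -> forall c, (b <= c)%R -> V (U i c) -> good p (U i c).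
Proof.
move=> i0 b0 ji nocross; apply: col_ind => p Vp IH pj c bc Vc; rewrite /good /= => pc.
have Vp' : V (U i (- p.1)).
  by apply: V_up_supp => //; [zlia | apply/suppN/ji/comp_F].
have [|c1 [ar1 h1 h2]] := row_pred Vc Vp'; first by zlia.
apply: (ladder Vp ar1) => /=; first by zlia.
  move=> z pz; have [_ Vz] := ar_V pz; have lt := ar_lt pz.
  have [V1 _] := ar_V ar1; have zj := comp_ar pz pj.
  by apply: goodE => /=; [zlia | apply: (IH) => //; zlia].
have bc1 : (b < c1)%R by zlia.
by move=> z az; have zE := nocross _ _ bc1 az; rewrite zE in az *; rewrite (ar_row_uniq az ar1).
Qed.

(* The arrows [v -> t] and [w -> t] are opposite to two arrows [u -> w] and
   [u -> v]: by skewness of the coefficients, the two relations add up to a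
   multiple of [om p t] instead of cancelling. *)
Lemma skew_square p v w t (e1 e2 : k) : e1 != 0 -> e2 != 0 ->
  (forall z, ar p z -> e1 * om z v + e2 * om z w = 0) ->
  \sum_(z <- vs | ar p z) E p z * om z v - e2 * om p t = 0 ->
  \sum_(z <- vs | ar p z) E p z * om z w - e1 * om p t = 0 -> om p t = 0.
Proof.
move=> e1n e2n h /eqP; rewrite subr_eq0 => /eqP r1 /eqP; rewrite subr_eq0 => /eqP r2.
have : e1 * (e2 * om p t) + e2 * (e1 * om p t) = 0.
  rewrite -r1 -r2 !mulr_sumr -big_split /= big1 // => z pz.
  by rewrite -[RHS](mulr0 (E p z)) -(h z pz); ring.
have -> : e1 * (e2 * om p t) + e2 * (e1 * om p t) = 2%:R * (e1 * e2) * om p t by ring.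
by move=> /eqP; rewrite !mulf_eq0 (negPf char2) (negPf e1n) (negPf e2n) => /eqP.
Qed.

(** The arrows among the vertices of columns [l], [0] and [- l] form a square from [U i l] to
    [Y i (- l)]. Ladders in the upper row stop there, [skew_square] crosses it, and ladders resume
    in the lower row. The conditions on [F j] hold for [j = i] and for the vectors after a step of
    case C, so one argument serves both. *)
Lemma good_C i j : (0 < i)%N -> (0 < j)%N -> F i 0 = 2%N ->
  (exists c, F i c = 1%N) ->
  (forall c, F j c <> 0%N -> F i c <> 0%N) ->
  (forall c, F i c = 2%N -> F j c = 2%N) ->
  forall p q, comp j p -> comp i q -> good p q.
Proof.
move=> i0 j0 Fi0 one ji ij.
have [l lmin] : exists l, minsupp i l.
  have [c Fc] := one; have : F i `|c|%N <> 0%N.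
    by case: (ltP c 0) => c0; [rewrite ltz0_abs // FN Fc | rewrite gez0_abs // Fc].
  apply: supp_next; case: (eqVneq c 0) => [c0|]; [by rewrite c0 Fi0 in Fc | zlia].
have [l0 Fl lle] := lmin.
have crossE a b := cross_C a b i0 Fi0 one lmin.
have SN := @suppN i.
have compS p : comp j p -> F i p.1 <> 0%N by move=> /comp_F /ji.
have VU c := @V_up_supp i c i0; have VY c := @V_low_supp i c i0.
have G0 : F i 0 <> 0%N by rewrite Fi0.
have Ha c : (c < 0)%R -> V (U i c) -> forall p, comp j p -> good p (U i c).
  move=> c0 Vc p pj; apply: good_sym.
  apply: (good_up_neg i0 j0 ij) => // a z a0 az.
  case: (out_up i0 az) => [//|zE]; move: az; rewrite zE crossE.
  by rewrite !xpair_eqE => /orP [] /andP [/eqP ae _]; zlia.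
have Hb p : V p -> comp j p -> forall c, (0 < c)%R -> V (U i c) -> good p (U i c).
  move=> Vp pj c c0 Vc; apply: (good_up_pos i0 l0 ji) => // [a z la az|].
    case: (out_up i0 az) => // zE; move: az; rewrite zE crossE.
    by rewrite !xpair_eqE => /orP [] /andP [/eqP ae _]; zlia.
  by apply: lle => //; have := V_comp Vc; rewrite absz_nat.
have nosupp c : (0 < c < l)%R -> F i c = 0%N.
  by move=> /andP [c0 cl]; case: (F i c =P 0%N) => // Fc; have := lle c c0 Fc; zlia.
have nosuppN c : (- l < c < 0)%R -> F i c = 0%N.
  by move=> h; rewrite -FN nosupp //; zlia.
have a1 : ar (U i l) (U i 0).
  apply/ar_row; split; [apply: VU => //; zlia | exact: VU | by [] |].
  move=> y Vy yl; have := V_comp Vy; rewrite absz_nat.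
  by rewrite nosupp.
have a2 : ar (U i l) (Y i 0) by rewrite crossE eqxx.
have a3 : ar (U i 0) (Y i (- l)) by rewrite crossE eqxx orbT.
have a5 : ar (Y i 0) (Y i (- l)).
  apply/ar_row; split; [exact: VY | apply: VY; [zlia|exact: SN] | zlia |].
  move=> y Vy yl; have := V_comp Vy; rewrite abszN absz_nat.
  by rewrite nosuppN.
pose e1 := E (U i l) (U i 0); pose e2 := E (U i l) (Y i 0).
have e3 : E (U i 0) (Y i (- l)) = - e2.
  by rewrite (E_anti a3) /vneg /= !oppr0 !opprK.
have e5 : E (Y i 0) (Y i (- l)) = - e1.
  by rewrite (E_anti a5) /vneg /= !oppr0 !opprK.
have e1n : e1 != 0 by exact: E_neq0.
have e2n : e2 != 0 by exact: E_neq0.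
(* Both arrows from [U i l] end in column 0, so the relation yields only a combination of two
   unknown values. *)
have Hc p : comp j p -> (p.1 < 0)%R -> e1 * om p (U i 0) + e2 * om p (Y i 0) = 0.
  move=> pj p0; have [Vp _] := pj; have [Vl _] := ar_V a1.
  have pl : (p.1 + l <= 0)%R by have := lle _ _ (SN _ (compS p pj)); zlia.
  have := om_rel Vp Vl pl; rewrite sum_out0 ?add0r => [|z pz].
    rewrite (sum_out2 a1 a2) //; first by case; zlia.
    move=> z az n1 n2; exfalso.
    case: (out_up i0 az) => zE; rewrite zE in az n1 n2.
      by case: n1; rewrite (ar_row_uniq az a1).
    move: az; rewrite crossE !xpair_eqE => /orP [] /andP [/eqP ae /eqP be].
      by case: n2; rewrite be.
    by zlia.
  have [_ Vz] := ar_V pz; have lt := ar_lt pz.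
  by apply: goodE => /=; [zlia | apply: Hb => //; exact: comp_ar pz pj].
(* The relations with the two vertices of column 0 both end at [Y i (- l)], with coefficients [- e2]
   and [- e1] by skewness. *)
have Hd p : comp j p -> (p.1 <= 0)%R -> om p (Y i (- l)) = 0.
  move=> pj p0; have [Vp _] := pj.
  have r1 := om_rel Vp (VU 0 (lexx 0) G0); have r2 := om_rel Vp (VY 0 (lexx 0) G0).
  rewrite /= addr0 in r1 r2; move: (r1 p0) (r2 p0) => {r1 r2}.
  rewrite (sum_out1 a3) => [|z az ne]; last first.
    have /= lt := ar_lt az.
    case: (out_up i0 az) => zE; rewrite zE in az ne *; last first.
      case: ne; move: az; rewrite crossE !xpair_eqE => /orP [] /andP [/eqP ae /eqP be].
        by zlia.
      by rewrite be.
    have [_ Vz] := ar_V az; apply: goodE; first by rewrite /=; zlia.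
    exact: Ha.
  rewrite (sum_out1 a5) => [|z az ne]; last first.
    have zE := out_low i0 az; rewrite zE in az ne.
    by case: ne; rewrite (ar_row_uniq az a5).
  rewrite e3 e5 !mulNr; apply: (skew_square e1n e2n) => z pz.
  by apply: Hc; [exact: comp_ar pz pj | have := ar_lt pz; zlia].
have He c : (0 < c)%R -> F i c <> 0%N -> forall p, comp j p -> good p (Y i (- c)).
  move: c; apply: int_ind_up => c c0 IH Fc p pj; rewrite /good /= => pc.
  have [Vp _] := pj.
  case: (ltgtP c l) => [cl|lc|cl]; [by have := lle c c0 Fc; zlia | | ].
    have Vc : V (Y i (- c)) by apply: VY; [zlia | exact: SN].
    have Vl : V (Y i (- l)) by apply: VY; [zlia | exact: SN].
    have [|c1 [ar1 h1 h2]] := row_pred Vc Vl; first by zlia.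
    have [V1 _] := ar_V ar1; have F1 : F i (- c1) <> 0%N.
      by apply: SN; have := V_comp V1; rewrite abszN absz_nat.
    have pc1 : (p.1 + c1 <= 0)%R.
      (* Otherwise the column [- p.1], where the lower row has a vertex, would lie strictly inside
         an arrow. *)
      rewrite leNgt; apply/negP=> pc1; move/ar_row: ar1 => [_ _ _ /(_ (- p.1))].
      by apply; [apply: VY; [zlia | exact/SN/compS] | zlia].
    apply: (ladder Vp ar1) => //.
    - move=> z pz; have lt := ar_lt pz.
      have zg : good z (Y i c1).
        by rewrite -[c1]opprK; apply: IH => //; [zlia|zlia|exact: comp_ar pz pj].
      by apply: goodE zg => /=; zlia.
    - move=> z az ne; have zE := out_low i0 az; rewrite zE in az ne.
      by case: ne; rewrite (ar_row_uniq az ar1).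
  rewrite cl; apply: Hd => //; rewrite leNgt; apply/negP=> p0.
  by have := lle _ p0 (compS p pj); zlia.
(* Column 0 has both vertices in the [j]-th piece, so ladders for [U i 0] exist; its arrows end in
   pairs settled by [Ha] and [He]. *)
have Hf p : comp j p -> good p (U i 0).
  move=> pj; apply: good_sym; apply: (ladder_rows2 j0) => //.
  - exact: VU.
  - by rewrite /= ij.
  move=> z az q qj; apply: good_sym; have [_ Vz] := ar_V az; have /= lt := ar_lt az.
  case: (out_up i0 az) => zE; rewrite zE in az Vz *; first exact: Ha.
  move: az; rewrite crossE !xpair_eqE => /orP [] /andP [/eqP ae /eqP ->]; first by zlia.
  exact: He.
have Hg p : comp j p -> good p (Y i 0).
  move=> pj; rewrite /good /= addr0 => p0; have := Hc p pj p0.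
  rewrite (goodE _ (Hf p pj)) /= ?addr0 // mulr0 add0r => /eqP.
  by rewrite mulf_eq0 (negPf e2n) => /eqP.
have Hh c : (0 < c)%R -> V (Y i c) -> forall p, comp j p -> good p (Y i c).
  move: c; apply: int_ind_up => c c0 IH Vc p pj; apply: good_sym.
  apply: (ladder_rows2 j0) => //=.
    by apply: ij; move: Vc; rewrite V_low // leNgt c0 /= => /eqP.
  move=> z az q qj; apply: good_sym; have [_ Vz] := ar_V az; have /= lt := ar_lt az.
  have zE := out_low i0 az; rewrite zE in Vz *.
  case: (ltgtP z.1 0) => z0; last by rewrite z0; exact: Hg.
    rewrite -[z.1]opprK; apply: He => //; first by zlia.
    by apply: SN; have := V_comp Vz; rewrite abszN absz_nat.
  exact: IH.
move=> p [c r] pj [Vq /= [] rE]; subst r.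
  case: (ltgtP c 0) => c0; [exact: Ha | | by subst c; exact: Hf].
  by have [Vp _] := pj; exact: Hb.
case: (ltgtP c 0) => c0; [ | exact: Hh | by subst c; exact: Hg].
rewrite -[c]opprK; apply: He => //; first by zlia.
by apply: SN; have := V_comp Vq; rewrite abszN absz_nat.
Qed.

(* One positive column with a single vertex: the two rows are not nested, and
   the pairs which cannot be reached by a ladder are those connected to the
   pairs [(v, v)], where the form vanishes as it is alternating. *)
Lemma good_D1 i : (0 < i)%N -> F i 0 = 0%N ->
  (forall c c', (0 < c)%R -> (0 < c')%R -> F i c = 1%N -> F i c' = 1%N -> c = c') ->
  forall p q, comp i p -> comp i q -> good p q.
Proof.
move=> i0 Fi0 one.
have nocross a b : ar (U i a) (Y i b) = false by exact: cross_D1.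
have SN := @suppN i.
have VU c := @V_up_supp i c i0; have VY c := @V_low_supp i c i0.
have out_row c z : ar (U i c) z -> z = U i z.1.
  by move=> az; case: (out_up i0 az) => // zE; move: az; rewrite zE nocross.
have nz p : comp i p -> p.1 <> 0 by move=> /comp_F + e; rewrite e Fi0.
have Ha c : (c < 0)%R -> V (U i c) -> forall p, comp i p -> good (U i c) p.
  by apply: good_up_neg => // a z _; exact: out_row.
have Hb p : V p -> comp i p -> forall c, (0 < c)%R -> V (U i c) -> good p (U i c).
  by move=> Vp pj c c0 Vc; apply: (@good_up_pos i i 1) => // a z _; exact: out_row.
have T c b : F i b = 1%N -> (0 < c < b)%R -> F i c <> 0%N -> F i c = 2%N.
  move=> Fb cb Fc; have := F_le2 i c; case e: (F i c) => [|[|[|n]]] // _.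
  by have := one c b _ _ e Fb; zlia.
(* [c] is the column of the lower row preceding the missing column [b] *)
have Hz b : (0 < b)%R -> F i b <> 0%N ->
    (forall c, (0 < c < b)%R -> F i c <> 0%N -> F i c = 2%N) ->
    forall c, V (Y i c) -> (c < b)%R -> (forall y, V (Y i y) -> ~ (c < y < b)%R) ->
    om (Y i c) (Y i (- b)) = 0.
  move: b; apply: int_ind_up => b b0 IH Fb Tb c Vc cb ncb.
  have Vb : V (Y i (- b)) by apply: VY; [zlia | exact: SN].
  case: (ltgtP c 0) => c0; last by case: (nz (Y i c)) => //; exact: comp_low.
    (* The descent ends at the pair of [Y i (- b)] with itself. *)
    have <- : c = - b; last exact: om_alt.
    apply/eqP; rewrite eq_le; apply/andP; split; rewrite leNgt; apply/negP=> h.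
      have Fc : F i (- c) = 2%N.
        by apply: Tb; [zlia | apply: SN; have := V_comp Vc; rewrite abszN absz_nat].
      have Vc' : V (Y i (- c)).
        by rewrite V_low // Fc eqxx /= if_same.
      by apply: (ncb _ Vc'); zlia.
    by apply: (ncb _ Vb); zlia.
  have Fc : F i c = 2%N by move: Vc; rewrite V_low // leNgt c0 /= => /eqP.
  have VNc : V (Y i (- c)) by apply: VY; [zlia | rewrite FN Fc].
  have ar1 : ar (Y i (- c)) (Y i (- b)).
    apply/ar_row; split=> //; first by zlia.
    move=> y Vy yc; apply: (ncb (- y)); last by zlia.
    rewrite V_low // Tb ?if_same //; first by zlia.
    by apply: SN; have := V_comp Vy; rewrite abszN absz_nat.
  apply: (ladder Vc ar1) => /=; first by zlia.
    move=> z cz; have zE := out_low i0 cz; rewrite zE in cz *.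
    have /ar_row [_ Vz zc nzc] := cz.
    apply: IH => //; first by rewrite Fc.
    by move=> y yc; apply: Tb; zlia.
  by move=> z az; have zE := out_low i0 az; rewrite zE in az *; rewrite (ar_row_uniq az ar1).
have Hy p : V p -> p.2 = - i%:Z -> forall c, V (Y i c) -> good p (Y i c).
  move: p; apply: col_ind => -[a r] Va IH /= rE c Vc; subst r.
  have Fa : F i a <> 0%N by have := V_comp Va; rewrite abszN absz_nat.
  rewrite /good /= => ac.
  (* A lower vertex with abscissa in []c, - a]] provides a rung. If there is none, the lower row
     misses the column [- a], and [Hz] applies. *)
  case: (boolP (has (fun v : vertex => (v.2 == - i%:Z) && (c < v.1 <= - a)%R) vs)) => [|/hasPn nh].
    move=> /hasP [[y r] Vy /= /andP [/eqP rE /andP [cy ya]]]; subst r.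
    have [c1 [ar1 h1 h2]] := row_pred Vc Vy cy.
    apply: (ladder Va ar1) => /=; first by zlia.
      move=> z az; have zE := out_low i0 az; have [_ Vz] := ar_V az; have /= lt := ar_lt az.
      have [V1 _] := ar_V ar1.
      by apply: goodE => /=; [zlia | apply: (IH) => //; rewrite zE].
    by move=> z az; have zE := out_low i0 az; rewrite zE in az *; rewrite (ar_row_uniq az ar1).
  have {}nh y : V (Y i y) -> ~ (c < y <= - a)%R.
    by move=> Vy h; have := nh _ Vy; rewrite /= eqxx h.
  have a0 : (a < 0)%R.
    rewrite ltNge; apply/negP=> a0; apply: (nh (- a)); last by zlia.
    by apply: VY; [zlia | exact: SN].
  have F1 : F i (- a) = 1%N.
    have : F i (- a) <> 2%N.
      move=> F2; apply: (nh (- a)); last by zlia.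
      by rewrite V_low // F2 eqxx if_same.
    by move: (SN _ Fa) (F_le2 i (- a)); case: (F i (- a)) => [|[|[|n]]].
  rewrite om_anti -[a]opprK Hz ?oppr0 //; [zlia | exact: SN | | zlia | ].
    by move=> y ya; apply: T F1 _; zlia.
  by move=> y Vy ya; apply: (nh _ Vy); zlia.
have Hu p c : comp i p -> V (U i c) -> good p (U i c).
  move=> pj Vc; have [Vp _] := pj.
  case: (ltgtP c 0) => c0; [by apply: good_sym; exact: Ha | exact: Hb | ].
  by case: (nz (U i c)) => //; exact: comp_up.
move=> [a r] [c r'] pj qj; have [Vq /= [] rE] := qj; subst r'; first exact: Hu.
have [Vp /= [] rE] := pj; subst r; last exact: Hy.
by apply: good_sym; exact: Hu.
Qed.

(** Without column 0 the square goes from [U i l'] through [U i l] and [Y i (- l)] to [Y i (- l')].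
    The pair of [Y i (- l)] with itself, which [skew_square] does not reach, vanishes by
    alternation. *)
Lemma good_D2 i : (0 < i)%N -> F i 0 = 0%N ->
  (exists c c', [/\ (0 < c)%R, (c < c')%R, F i c = 1%N & F i c' = 1%N]) ->
  forall p q, comp i p -> comp i q -> good p q.
Proof.
move=> i0 Fi0 two.
have [l lmin] : exists l, minsupp i l.
  by have [c [_ [c0 _ Fc _]]] := two; apply: (@supp_next i 0 c) => //; rewrite Fc.
have [l0 Fl lle] := lmin.
have [l' [ll' Fl' l'le]] : exists l', [/\ (l < l')%R, F i l' <> 0%N &
    forall c, (l < c)%R -> F i c <> 0%N -> (l' <= c)%R].
  have [c [c' [c0 cc' Fc Fc']]] := two; apply: (@supp_next i l c'); last by rewrite Fc'.
  by have lc : (l <= c)%R by [apply: lle; rewrite ?Fc]; zlia.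
have crossE a b := @cross_D2 i l l' a b i0 Fi0 two lmin ll' Fl' l'le.
have SN := @suppN i.
have VU c := @V_up_supp i c i0; have VY c := @V_low_supp i c i0.
have FV c r : (r = i%:Z \/ r = - i%:Z) -> V (c, r) -> F i c <> 0%N.
  by case=> -> Vc; have := V_comp Vc; rewrite ?abszN absz_nat.
have nz p : comp i p -> p.1 <> 0 by move=> /comp_F + e; rewrite e Fi0.
have Ha c : (c < 0)%R -> V (U i c) -> forall p, comp i p -> good (U i c) p.
  apply: good_up_neg => // a z a0 az.
  case: (out_up i0 az) => // zE; move: az; rewrite zE crossE.
  by rewrite !xpair_eqE => /orP [] /andP [/eqP ae _]; zlia.
have Hb p : V p -> comp i p -> forall c, (l' <= c)%R -> V (U i c) -> good p (U i c).
  move=> Vp pj c; apply: (good_up_pos i0 _ _ _ Vp pj) => // [|a z la az]; first by zlia.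
  case: (out_up i0 az) => // zE; move: az; rewrite zE crossE.
  by rewrite !xpair_eqE => /orP [] /andP [/eqP ae _]; zlia.
have nosupp c : (0 < c < l)%R -> F i c = 0%N.
  by move=> /andP [c0 cl]; case: (F i c =P 0%N) => // Fc; have := lle c c0 Fc; zlia.
have nosupp' c : (l < c < l')%R -> F i c = 0%N.
  by move=> /andP [c0 cl]; case: (F i c =P 0%N) => // Fc; have := l'le c c0 Fc; zlia.
have a1 : ar (U i l') (U i l).
  apply/ar_row; split; [apply: VU => //; zlia | apply: VU => //; zlia | by [] |].
  by move=> y Vy yl; have := FV y i%:Z (or_introl erefl) Vy; rewrite nosupp'.
have a2 : ar (U i l') (Y i (- l)) by rewrite crossE eqxx orbT.
have a3 : ar (U i l) (Y i (- l')) by rewrite crossE eqxx.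
have a5 : ar (Y i (- l)) (Y i (- l')).
  apply/ar_row; split; [apply: VY; [zlia|exact: SN] | apply: VY; [zlia|exact: SN] | zlia |].
  move=> y Vy yl; have := FV y _ (or_intror erefl) Vy.
  by rewrite -FN nosupp' //; zlia.
pose e1 := E (U i l') (U i l); pose e2 := E (U i l') (Y i (- l)).
have e3 : E (U i l) (Y i (- l')) = - e2.
  by rewrite (E_anti a3) /vneg /= !opprK.
have e5 : E (Y i (- l)) (Y i (- l')) = - e1.
  by rewrite (E_anti a5) /vneg /= !opprK.
have e1n : e1 != 0 by exact: E_neq0.
have e2n : e2 != 0 by exact: E_neq0.
have Hc p : comp i p -> (p.1 < - l)%R -> e1 * om p (U i l) + e2 * om p (Y i (- l)) = 0.
  move=> pj p0; have [Vp _] := pj; have [Vl _] := ar_V a1.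
  have pl : (p.1 + l' <= 0)%R.
    have pl : (l' <= - p.1)%R by apply: l'le; [zlia | exact/SN/comp_F].
    by zlia.
  have := om_rel Vp Vl pl; rewrite sum_out0 ?add0r => [|z pz].
    rewrite (sum_out2 a1 a2) //; first by case; zlia.
    move=> z az n1 n2; exfalso.
    case: (out_up i0 az) => zE; rewrite zE in az n1 n2.
      by case: n1; rewrite (ar_row_uniq az a1).
    move: az; rewrite crossE !xpair_eqE => /orP [] /andP [/eqP ae /eqP be].
      by zlia.
    by case: n2; rewrite be.
  have [_ Vz] := ar_V pz; have lt := ar_lt pz.
  by apply: goodE => /=; [zlia | apply: Hb => //; exact: comp_ar pz pj].
(* [U i l] may have a row arrow into the negative columns; the hypothesis on [z] disposes of its
   term. *)
have Hd p : comp i p -> (p.1 <= - l)%R ->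
    (forall z, ar (U i l) z -> (z.1 < 0)%R -> z = U i z.1 -> om p z = 0) ->
    om p (Y i (- l')) = 0.
  move=> pj p0 pup; have [Vp _] := pj.
  have [Vl _] := ar_V a3; have [VNl _] := ar_V a5.
  have pl1 : (p.1 + l <= 0)%R by zlia.
  have pl2 : (p.1 - l <= 0)%R by zlia.
  have := om_rel Vp VNl pl2; have := om_rel Vp Vl pl1.
  rewrite (sum_out1 a3) => [|z az ne]; last first.
    have /= lt := ar_lt az.
    case: (out_up i0 az) => zE; last first.
      case: ne; rewrite zE in az *.
      move: az; rewrite crossE !xpair_eqE => /orP [] /andP [/eqP ae /eqP be].
        by rewrite be.
      by zlia.
    apply: pup => //; rewrite zE in az; have [_ Vz] := ar_V az.
    case: (ltgtP z.1 0) => // z0; last by case: (nz (U i z.1)) => //; exact: comp_up.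
    have := FV _ _ (or_introl erefl) Vz; rewrite nosupp //; zlia.
  rewrite (sum_out1 a5) => [|z az ne]; last first.
    have zE := out_low i0 az; rewrite zE in az ne.
    by case: ne; rewrite (ar_row_uniq az a5).
  rewrite e3 e5 !mulNr; apply: (skew_square e1n e2n) => z pz.
  by apply: Hc; [exact: comp_ar pz pj | have := ar_lt pz; zlia].
have Hl' b : (0 < b)%R -> F i b <> 0%N -> om (Y i (- b)) (Y i (- l')) = 0.
  move=> b0 Fb; have Vb : V (Y i (- b)) by apply: VY; [zlia | exact: SN].
  apply: Hd; [exact: comp_low | by have := lle b b0 Fb; rewrite /=; zlia |].
  move=> z az z0 zE; have [_ Vz] := ar_V az; rewrite zE in Vz *.
  rewrite om_anti; apply/eqP; rewrite oppr_eq0; apply/eqP.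
  by apply: goodE; [rewrite /=; zlia | apply: Ha => //; exact: comp_low].
have He a : (0 < a)%R -> (l' <= a)%R -> F i a <> 0%N ->
    forall b, (0 < b)%R -> F i b <> 0%N -> om (Y i (- b)) (Y i (- a)) = 0.
  move: a; apply: int_ind_up => a a0 IH al Fa b b0 Fb.
  case: (eqVneq a l') => [->|al']; first exact: Hl'.
  have Va : V (Y i (- a)) by apply: VY; [zlia | exact: SN].
  have Vl : V (Y i (- l')) by apply: VY; [zlia | exact: SN].
  have Vb : V (Y i (- b)) by apply: VY; [zlia | exact: SN].
  have [|c1 [ar1 h1 h2]] := row_pred Va Vl; first by zlia.
  have [V1 _] := ar_V ar1.
  apply: (ladder Vb ar1) => /=; first by zlia.
    move=> z az; have zE := out_low i0 az; have [_ Vz] := ar_V az; have /= lt := ar_lt az.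
    rewrite zE in Vz *; rewrite -[c1]opprK -[z.1]opprK; apply: IH; try zlia.
      by apply: SN; exact: FV (or_intror erefl) V1.
    by apply: SN; exact: FV (or_intror erefl) Vz.
  by move=> z az; have zE := out_low i0 az; rewrite zE in az *; rewrite (ar_row_uniq az ar1).
have Hn a b : (a < 0)%R -> (b < 0)%R -> V (Y i a) -> V (Y i b) -> om (Y i a) (Y i b) = 0.
  move=> a0 b0 Va Vb.
  have Fa := SN _ (FV _ _ (or_intror erefl) Va); have Fb := SN _ (FV _ _ (or_intror erefl) Vb).
  have la : (l <= - a)%R by apply: lle => //; zlia.
  have lb : (l <= - b)%R by apply: lle => //; zlia.
  case: (eqVneq b (- l)) => bl; last first.
    rewrite -[a]opprK -[b]opprK; apply: He => //; [zlia | apply: l'le => //; zlia | zlia].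
  case: (eqVneq a (- l)) => al; first by rewrite al bl om_alt.
  rewrite om_anti -[a]opprK -[b]opprK He ?oppr0 //; [zlia | apply: l'le => //; zlia | zlia].
have Hy a : (0 < a)%R -> V (Y i a) -> forall b, V (Y i b) -> good (Y i a) (Y i b).
  move: a; apply: int_ind_up => a a0 IH Va b Vb.
  have Fa := FV _ _ (or_intror erefl) Va.
  apply: (ladder_row Va) => //=.
  - by apply: VY; [zlia | exact: SN].
  - move=> z az c Vc; have zE := out_low i0 az; have [_ Vz] := ar_V az; have /= lt := ar_lt az.
    rewrite zE in Vz *; rewrite /good /= => zc.
    case: (ltgtP z.1 0) => z0; last by case: (nz (Y i z.1)) => //; exact: comp_low.
      case: (ltgtP c 0) => c00; last by case: (nz (Y i c)) => //; exact: comp_low.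
        exact: Hn.
      (* Impossible: one of the columns [- a] and [c] would lie strictly between the ends of the
         arrow from [a] to [z.1]. *)
      have VNa : V (Y i (- a)) by apply: VY; [zlia | exact: SN].
      rewrite zE in az; have /ar_row [_ _ _ none] := az.
      by have := none _ Vc; have := none _ VNa; zlia.
    by apply: (IH z.1 _ _ Vz _ Vc) => //; zlia.
  - by move=> c z az; have -> := out_low i0 az.
have Hyy a b : V (Y i a) -> V (Y i b) -> good (Y i a) (Y i b).
  move=> Va Vb; case: (ltgtP a 0) => a0; last by case: (nz (Y i a)) => //; exact: comp_low.
    case: (ltgtP b 0) => b0; last by case: (nz (Y i b)) => //; exact: comp_low.
      by move=> _; exact: Hn.
    by apply: good_sym; exact: Hy.
  exact: Hy.
have Hl p : comp i p -> good p (U i l).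
  move=> pj; rewrite /good /= => pl.
  have p0 : (p.1 < - l)%R by zlia.
  have := Hc p pj p0; suff -> : om p (Y i (- l)) = 0.
    by rewrite mulr0 addr0 => /eqP; rewrite mulf_eq0 (negPf e1n) => /eqP.
  have [VNl _] := ar_V a5.
  case: p pj pl p0 => c r [Vc /= [] rE] pl p0; subst r.
    by apply: goodE; [rewrite /=; zlia | apply: Ha => //; [zlia | exact: comp_low]].
  by apply: goodE; [rewrite /=; zlia | exact: Hyy].
have Hu p c : comp i p -> V (U i c) -> good p (U i c).
  move=> pj Vc; have [Vp _] := pj; have Fc := FV _ _ (or_introl erefl) Vc.
  case: (ltgtP c 0) => c0; [by apply: good_sym; exact: Ha | |].
    case: (eqVneq c l) => [->|cl]; first exact: Hl.
    by apply: Hb => //; apply: l'le => //; have := lle c c0 Fc; zlia.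
  by case: (nz (U i c)) => //; exact: comp_up.
move=> [a r] [c r'] pj qj; have [Vq /= [] rE] := qj; subst r'; first exact: Hu.
have [Vp /= [] rE] := pj; subst r; last exact: Hyy.
by apply: good_sym; exact: Hu.
Qed.

(** The cases follow the extra arrows between the rows; a vector with all nonzero entries 2 is
    nested in itself. *)
Lemma good_self i : (0 < i)%N -> forall p q, comp i p -> comp i q -> good p q.
Proof.
move=> i0.
have Vmem c : F i c <> 0%N -> exists2 v, V v & v.1 = c.
  move=> /eqP Fc; case: (ltP c 0) => c0.
    by exists (Y i c) => //; rewrite V_low // ltW.
  by exists (U i c) => //; rewrite V_up // c0.
have := F_le2 i 0; have := F0_neq1 i0.
case F0: (F i 0) => [|[|[|n]]] // _ _.
  pose two (v v' : vertex) :=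
    [&& (0 < v.1)%R, (v.1 < v'.1)%R, F i v.1 == 1%N & F i v'.1 == 1%N].
  case: (boolP (has (fun v => has (two v) vs) vs)) => [/hasP [v _ /hasP [v' _]]|/hasPn h].
    move=> /and4P [h1 h2 /eqP h3 /eqP h4]; apply: good_D2 => //.
    by exists v.1, v'.1.
  apply: good_D1 => // c c' c0 c'0 Fc Fc'.
  have [|v Vv vc] := Vmem c; first by rewrite Fc.
  have [|v' Vv' vc'] := Vmem c'; first by rewrite Fc'.
  have := hasPn (h _ Vv) _ Vv'; have := hasPn (h _ Vv') _ Vv.
  rewrite /two vc vc' Fc Fc' eqxx c0 c'0 !andbT /= -!leNgt; zlia.
case: (boolP (has (fun v : vertex => F i v.1 == 1%N) vs)) => [/hasP [v _ /eqP Fv]|/hasPn h].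
  by apply: good_C => //; exists v.1.
apply: good_nested => // c Fc; have [v Vv vc] := Vmem c Fc.
have := h _ Vv; rewrite vc; have := F_le2 i c; move: Fc.
by case: (F i c) => [|[|[|n]]].
Qed.

Lemma good_self0 : forall p q, comp 0 p -> comp 0 q -> good p q.
Proof.
apply: good_nested0 => c; have := F_row0 c.
by case: (F 0 c) => [|[|n]].
Qed.

(** The alternatives are those of [good_nested] and [good_C]; the second one is met after a step of
    case C. *)
Definition nested i j :=
  (forall c, F j c <> 0%N -> F i c = 2%N) \/
  [/\ F i 0 = 2%N, forall c, F j c <> 0%N -> F i c <> 0%N &
      forall c, F i c = 2%N -> F j c = 2%N].

Hypothesis nest : forall i j, (0 < i)%N -> (i < j)%N -> nested i j.
Hypothesis nest0 : forall j, (0 < j)%N ->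
  (forall c, F j c <> 0%N -> F 0 c = 1%N) \/ (forall c, F 0 c <> 0%N -> F j c = 2%N).

Lemma good_lt i j : (i < j)%N -> forall p q, comp j p -> comp i q -> good p q.
Proof.
move=> ij; have j0 : (0 < j)%N by apply: leq_ltn_trans ij.
case: (posnP i) => [->|i0].
  have [h|h] := nest0 j0; first exact: good_nested0.
  by move=> p q pj q0; apply: good_sym; apply: (good_nested j0 h).
have [h|[h1 h2 h3]] := nest i0 ij; first exact: good_nested.
case: (boolP (has (fun v : vertex => F i v.1 == 1%N) vs)) => [/hasP [v _ /eqP Fv]|/hasPn h].
  by apply: good_C => //; exists v.1.
apply: good_nested => // c /h2 Fc.
have [v Vv vc] : exists2 v, V v & v.1 = c.
  move/eqP: (Fc) => Fc'; case: (ltP c 0) => c0.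
    by exists (Y i c) => //; rewrite V_low // ltW.
  by exists (U i c) => //; rewrite V_up // c0.
have := h _ Vv; rewrite vc; have := F_le2 i c; move: Fc.
by case: (F i c) => [|[|[|n]]].
Qed.

Lemma good_all p q : V p -> V q -> good p q.
Proof.
move=> Vp Vq.
have cp : comp `|p.2|%N p by split=> //; zlia.
have cq : comp `|q.2|%N q by split=> //; zlia.
case: (ltngtP `|p.2|%N `|q.2|%N) => e.
- by apply: good_sym; apply: (good_lt e).
- exact: (good_lt e).
rewrite e in cp; move: cp cq; case: (posnP `|q.2|%N) => [->|i0]; first exact: good_self0.
exact: good_self.
Qed.

End AlternatingForm.

(** * Decomposition of dimension vectors *)

Section Decomposition.
Implicit Types (c d f g : dimvec) (x i : nat).

Local Notation nt f i := (nth 0 f i).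

Lemma nth_map0 (h : nat -> nat) c i : h 0 = 0 -> nt (map h c) i = h (nt c i).
Proof.
move=> h0; case: (ltnP i (size c)) => ic; first by rewrite (nth_map 0).
by rewrite !nth_default ?size_map.
Qed.

Definition hA x := if x == 0 then 0 else 2.
Definition hB x := if x == 0 then 0 else 1.
Definition hC a x := if x == 0 then 0 else if x < a then 1 else 2.

Lemma sub_step c (h : nat -> nat) :
  sub_dimvec c (map h c) = [seq x - h x | x <- c].
Proof. by rewrite /sub_dimvec; elim: c => //= x c ->. Qed.

Lemma sumn_map_lt (h : nat -> nat) c : (forall x, 0 < x -> 0 < h x) ->
  ~~ all (pred1 0) c -> sumn [seq x - h x | x <- c] < sumn c.
Proof.
move=> hlt; have le s : sumn [seq x - h x | x <- s] <= sumn s.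
  by elim: s => //= x s IH; apply: leq_add => //; exact: leq_subr.
elim: c => //= x c IH; rewrite negb_and; case: (posnP x) => [->|x0 _].
  by rewrite /= sub0n !add0n => /IH.
have := hlt x x0; have := le c; lia.
Qed.

Lemma least_evenP c : 0 < nt c 0 -> ~~ odd (nt c 0) ->
  [/\ 0 < least_even c, ~~ odd (least_even c) &
      forall i, 0 < nt c i -> ~~ odd (nt c i) -> least_even c <= nt c i].
Proof.
move=> c0 oc0; rewrite /least_even.
set s := [seq x <- c | _]; have sc : sorted leq (sort leq s).
  exact: (sort_sorted leq_total).
have ms : sort leq s =i s by exact: mem_sort.
have c0s i : 0 < nt c i -> ~~ odd (nt c i) -> nt c i \in sort leq s.
  move=> h1 h2; rewrite ms mem_filter h1 h2 mem_nth //.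
  by rewrite ltnNge; apply: contraL h1 => /(nth_default 0) ->.
have := c0s 0 c0 oc0; case: (sort leq s) sc ms c0s => // a r /= sr ms c0s _.
have : a \in a :: r by rewrite mem_head.
rewrite ms mem_filter => /andP [/andP [a0 oa] _]; split=> // i h1 h2.
have := c0s i h1 h2; rewrite in_cons => /orP [/eqP -> //|].
by move: sr; rewrite path_sortedE; [move=> /andP [/allP h _] /h | exact: leq_trans].
Qed.

Definition nestv f g : Prop :=
  (forall i, nt g i <> 0 -> nt f i = 2) \/
  [/\ nt f 0 = 2, forall i, nt g i <> 0 -> nt f i <> 0 &
      forall i, nt f i = 2 -> nt g i = 2].

Lemma all_zero c : all (pred1 0) c -> forall i, nt c i = 0.
Proof.
move=> /allP h i; case: (ltnP i (size c)) => ic; last by rewrite nth_default.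
by have := h _ (mem_nth 0 ic) => /eqP.
Qed.

Lemma sumn_eq0 c : sumn c = 0 -> all (pred1 0) c.
Proof. by elim: c => //= x c IH /eqP; rewrite addn_eq0 => /andP [-> /eqP/IH]. Qed.

Lemma step_unfold n c d0 : let r := decompose_rec n.+1 c d0 in
  [\/ all (pred1 0) c /\ r = (d0, [::]),
      [/\ ~~ all (pred1 0) c, nt c 0 = 0 &
        let r' := decompose_rec n [seq x - minn x 2 | x <- c] d0 in
        r = (r'.1, map (minn^~ 2) c :: r'.2)],
      [/\ 0 < nt c 0, forall i, nt c i <> 1 &
        let r' := decompose_rec n [seq x - hA x | x <- c] d0 in
        r = (r'.1, map hA c :: r'.2)] |
      (exists i, nt c i = 1) /\
      ((odd (nt c 0) /\ r = decompose_rec n [seq x - hB x | x <- c] (map hB c)) \/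
      [/\ 0 < nt c 0, ~~ odd (nt c 0) &
        let a := least_even c in
        let r' := decompose_rec n [seq x - hC a x | x <- c] d0 in
        r = (r'.1, map (hC a) c :: r'.2)])].
Proof.
rewrite /=; case: ifP => [az|az]; first by constructor 1.
have e0 : entry c 0 = nt c 0 by [].
rewrite e0; case: eqP => c0; first by constructor 2; rewrite -sub_step.
case: ifP => [h|nh].
  constructor 3; split; [by case: (nt c 0) c0 | | by rewrite -sub_step].
  move=> i ci; case: (ltnP i (size c)) => ic; last by rewrite nth_default in ci.
  by move/allP: h => /(_ _ (mem_nth 0 ic)); rewrite ci.
have ex1 : exists i, nt c i = 1.
  move/negbT: nh => /allPn [x /(nthP 0) [i _ <-] xi]; exists i.
  by move: xi; case: (nt c i) => [|[|]].
case: ifP => oc; constructor 4; split=> //; first by left; rewrite -sub_step.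
by right; split; [case: (nt c 0) c0 | by [] | rewrite -sub_step].
Qed.

Lemma decompose_supp n c d0 g i :
  g \in (decompose_rec n c d0).2 -> nt g i <> 0 -> nt c i <> 0.
Proof.
elim: n c d0 => // n IH c d0; have := step_unfold n c d0.
case=> [[_ ->] //|[_ _ ->]|[_ _ ->]|[_ [[_ ->]|[_ _ ->]]]] /=; rewrite ?in_cons.
- move=> /orP [/eqP ->|/IH h /h]; rewrite nth_map0 //; lia.
- move=> /orP [/eqP ->|/IH h /h]; rewrite nth_map0 // /hA; [case: eqP; lia|lia].
- move=> /IH h /h; rewrite nth_map0 //; lia.
- move=> /orP [/eqP ->|/IH h /h]; rewrite nth_map0 // /hC; [case: eqP; lia|lia].
Qed.

(* After a step with odd entries below the least even entry, all steps add [2]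
   to the columns [i] with [f_i = 2] as long as the other columns are in play. *)
Lemma nest_stepC n f b c d0 : ~~ odd b -> nt f 0 = 2 ->
  (forall i, nt f i = 2 -> b <= nt c i) ->
  (forall i, nt f i <> 2 -> ~~ odd (nt c i) /\ nt c i <= b) ->
  (forall i, nt c i <> 0 -> nt f i <> 0) ->
  forall g, g \in (decompose_rec n c d0).2 -> nestv f g.
Proof.
move=> ob f0; elim: n b c d0 ob => // n IH b c d0 ob h2 hn hs g.
(* At [b = 0] only columns with [f_i = 2] are left. *)
case: (posnP b) => [b0|b0] gr.
  left=> i gi; have ci := decompose_supp gr gi.
  by case: (nt f i =P 2) => // /hn [_]; lia.
have c0 : 0 < nt c 0 by have := h2 0 f0; lia.
(* While [b > 0] no entry is 1, so the next step is of case A. *)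
have cn1 i : nt c i <> 1.
  by case: (nt f i =P 2) => [/h2|/hn []]; lia.
have b2 : 2 <= b by lia.
move: gr; have := step_unfold n c d0.
case=> [[az _]|[_ c00 _]|[_ _ ->]|[[i ci] _]] /=.
- by have := all_zero az 0; lia.
- lia.
- rewrite in_cons => /orP [/eqP ->|]; last first.
    apply: (IH (b - 2)); first by lia.
    + by move=> i /h2; rewrite nth_map0 // /hA; case: eqP; lia.
    + by move=> i /hn; rewrite nth_map0 // /hA; case: eqP; lia.
    + by move=> i; rewrite nth_map0 // => ci; apply: hs; lia.
  right; split=> // i; rewrite nth_map0 // /hA; last by move=> /h2; case: eqP; lia.
  by move=> ci; apply: hs; move: ci; case: eqP.
- by have := cn1 i.
Qed.

Lemma fst_decompose n c d0 : ~~ odd (nt c 0) -> (decompose_rec n c d0).1 = d0.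
Proof.
elim: n c => // n IH c oc; have := step_unfold n c d0.
case=> [[_ ->] //|[_ c0 ->]|[_ _ ->]|[_ [[h _]|[_ _ ->]]]] /=.
- by apply: IH; rewrite nth_map0 ?c0.
- by apply: IH; rewrite nth_map0 // /hA; case: eqP => [->|] //; lia.
- by rewrite h in oc.
- apply: IH; rewrite nth_map0 // /hC; case: eqP => [->|] // c0.
  have [|a0 oa le] := @least_evenP c _ oc; first by lia.
  by rewrite ltnNge le //=; lia.
Qed.

Definition two_row_shape f := [/\ nt f 0 <> 1 & forall i, nt f i <= 2].

(** Case B occurs exactly when the middle entry is odd: case A keeps its parity until some entry is
    1. Otherwise the first component is the accumulator as it came in, hence the guards on
    parity. *)
Lemma decompose_spec n c d0 : sumn c <= n ->
  let r := decompose_rec n c d0 in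
  [/\ forall i, nt c i = (if odd (nt c 0) then nt r.1 i else 0) + \sum_(f <- r.2) nt f i,
      forall f, f \in r.2 -> size f = size c /\ two_row_shape f,
      odd (nt c 0) -> [/\ size r.1 = size c, nt r.1 0 = 1 & forall i, nt r.1 i <= 1],
      forall i j, i < j < size r.2 -> nestv (nth [::] r.2 i) (nth [::] r.2 j) &
      odd (nt c 0) -> forall f, f \in r.2 ->
        (forall i, nt f i <> 0 -> nt r.1 i = 1) \/ (forall i, nt r.1 i <> 0 -> nt f i = 2)].
Proof.
elim: n c d0 => [|n IH] c d0 sc.
  have c0 : forall i, nt c i = 0 by apply/all_zero/sumn_eq0; lia.
  rewrite /= c0 /=; split=> // [i|i j]; first by rewrite big_nil c0.
  by rewrite andbC.
have cons_nest (f : dimvec) (s : seq dimvec) :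
    (forall g, g \in s -> nestv f g) ->
    (forall i j, i < j < size s -> nestv (nth [::] s i) (nth [::] s j)) ->
    forall i j, i < j < size (f :: s) -> nestv (nth [::] (f :: s) i) (nth [::] (f :: s) j).
  move=> h1 h2 [|i] [|j] //= ij; first by apply: h1; apply: mem_nth; exact: ij.
  by apply: h2; lia.
have := step_unfold n c d0.
case=> [[az ->]|[az c0 ->]|[c0 c1 ->]|[[i1 ci1] [[oc ->]|[c0 oc ->]]]] /=.
- have c0 := all_zero az; rewrite c0 /=; split=> // [i|i j]; first by rewrite big_nil c0.
  by rewrite andbC.
- have sn : sumn [seq x - minn x 2 | x <- c] <= n.
    rewrite -ltnS; apply: leq_trans sc; apply: (sumn_map_lt (h := minn^~ 2)) => // x x0.
    by rewrite /=; lia.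
  have [] := IH _ d0 sn; rewrite !nth_map0 // c0 /= => h1 h2 _ h4 _.
  split=> //; last first.
    apply: cons_nest => // g gr; left=> i /(decompose_supp gr).
    by rewrite !nth_map0 //; lia.
    move=> f; rewrite in_cons => /orP [/eqP ->|/h2]; last by rewrite size_map.
    rewrite size_map; split=> //; split=> [|i]; rewrite nth_map0 ?c0 //.
    exact: geq_minr.
  by move=> i; have := h1 i; rewrite big_cons !nth_map0 //; lia.
- have c1' i : nt c i <> 0 -> 2 <= nt c i by have := c1 i; lia.
  have az : ~~ all (pred1 0) c by apply/negP=> /all_zero /(_ 0); lia.
  have sn : sumn [seq x - hA x | x <- c] <= n.
    rewrite -ltnS; apply: leq_trans sc; apply: sumn_map_lt => // x x0.
    by rewrite /hA; case: eqP; lia.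
  have := IH _ d0 sn; rewrite /= !nth_map0 //.
  have -> : odd (nt c 0 - hA (nt c 0)) = odd (nt c 0).
    by have := c1' 0; rewrite /hA; case: eqP; lia.
  move=> [h1 h2 h3 h4 h5]; split.
  + move=> i; have := h1 i; rewrite big_cons !nth_map0 // /hA.
    have := c1' i; case: eqP; lia.
  + move=> f; rewrite in_cons => /orP [/eqP ->|/h2]; last by rewrite size_map.
    rewrite size_map; split=> //; split=> [|i]; rewrite nth_map0 // /hA; case: eqP => //.
  + by move=> /h3; rewrite size_map.
  + apply: cons_nest => // g gr; left=> i /(decompose_supp gr).
    by rewrite !nth_map0 // /hA; case: eqP; lia.
  + move=> oc f; rewrite in_cons => /orP [/eqP ->|fr]; last exact: h5.
    (* A vector taken before [d^0] is 2 on the support of [d^0]. *)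
    right=> i ri; have := h1 i; rewrite oc !nth_map0 // => hi.
    have ci : nt c i <> 0 by lia.
    by rewrite /hA; case: eqP.
- have az : ~~ all (pred1 0) c by apply/negP=> /all_zero /(_ 0); lia.
  have sn : sumn [seq x - hB x | x <- c] <= n.
    rewrite -ltnS; apply: leq_trans sc; apply: sumn_map_lt => // x x0.
    by rewrite /hB; case: eqP; lia.
  have := IH _ (map hB c) sn; rewrite /= !nth_map0 //.
  have oc' : odd (nt c 0 - hB (nt c 0)) = false.
    by rewrite /hB; case: eqP; lia.
  rewrite oc' oc fst_decompose ?nth_map0 ?oc' // => -[h1 h2 _ h4 _]; split=> //.
  + move=> i; have := h1 i; rewrite !nth_map0 // /hB; case: eqP; lia.
  + by move=> f /h2; rewrite size_map.
  + move=> _; rewrite size_map; split=> //.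
      by rewrite /hB; case: eqP; lia.
    by move=> i; rewrite nth_map0 // /hB; case: eqP.
  (* A vector taken after [d^0] is supported where the entry was at least 2, and [d^0] is 1
     there. *)
  + move=> _ f fr; left=> i /(decompose_supp fr); rewrite !nth_map0 // /hB; case: eqP; lia.
- have az : ~~ all (pred1 0) c by apply/negP=> /all_zero /(_ 0); lia.
  have [a0 oa ale] := least_evenP c0 oc; set a := least_even c in a0 oa ale *.
  have sn : sumn [seq x - hC a x | x <- c] <= n.
    rewrite -ltnS; apply: leq_trans sc; apply: sumn_map_lt => // x x0.
    by rewrite /hC; case: eqP; [lia|case: ifP; lia].
  have ac0 : a <= nt c 0 by apply: ale.
  have odd_lt i : nt c i <> 0 -> nt c i < a -> odd (nt c i).
    by move=> ci ca; apply/negPn/negP=> oi; have := ale i; lia.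
  have := IH _ d0 sn; rewrite /= !nth_map0 //.
  have oc' : odd (nt c 0 - hC a (nt c 0)) = false.
    by rewrite /hC; case: eqP; [lia|case: ifP; lia].
  rewrite oc' (negPf oc) => -[h1 h2 _ h4 _]; split=> //.
  + move=> i; have := h1 i; rewrite big_cons !nth_map0 // /hC.
    case: eqP; [lia|case: ifP; lia].
  + move=> f; rewrite in_cons => /orP [/eqP ->|/h2]; last by rewrite size_map.
    rewrite size_map; split=> //; split=> [|i]; rewrite nth_map0 // /hC; case: eqP => //; case: ifP => //; lia.
  (* After the step, [a - 2] separates the columns: odd entries below [a] have lost 1 and become
     even and at most [a - 2], entries from [a] on have lost 2. *)
  + apply: cons_nest => //; apply: (@nest_stepC _ _ (a - 2)); first by lia.
    * by rewrite nth_map0 // /hC; case: eqP; [lia|case: ifP; lia].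
    * by move=> i; rewrite !nth_map0 // /hC; case: eqP; [lia|case: ifP; lia].
    * move=> i; rewrite !nth_map0 // /hC; have := odd_lt i.
      by case: eqP; [lia|case: ifP; lia].
    * by move=> i; rewrite !nth_map0 // /hC; case: eqP; [lia|case: ifP; lia].
Qed.

End Decomposition.

(** * Line diagrams *)

Section SmallDiagrams.
Local Open Scope ring_scope.
Implicit Types (f : dimvec) (c a b r : int) (p q : vertex) (j : nat).

Lemma entryN f c : entry f (- c) = entry f c.
Proof. by rewrite /entry abszN. Qed.

Lemma mem_indices f c : (c \in indices f) = (`|c|%N <= bound f)%N.
Proof.
apply/mapP/idP=> [[i]|h].
  by rewrite mem_iota => ib ->; lia.
exists (absz (c + (bound f)%:Z)); last by lia.
by rewrite mem_iota; lia.
Qed.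

Lemma entry_indices f c : entry f c != 0%N -> c \in indices f.
Proof.
rewrite mem_indices /entry /bound => h.
have : (`|c| < size f)%N by rewrite ltnNge; apply: contra h => /(nth_default 0%N) ->.
by case: (size f) => //= n; rewrite ltnS.
Qed.

Lemma uniq_indices f : uniq (indices f).
Proof. by rewrite map_inj_uniq ?iota_uniq // => i i'; lia. Qed.

Lemma sorted_indices f : sorted <%R (indices f).
Proof.
rewrite sorted_map; apply: sub_sorted (iota_ltn_sorted 0 _) => i i' /=; lia.
Qed.

(** Presence of a vertex of the upper row in column [c]; the lower row is its image under
    [c |-> - c]. *)
Definition rowc f c := if (0 <= c)%R then entry f c != 0%N else entry f c == 2%N.

Lemma mem_two_row f c r : ((c, r) \in two_row_vertices f) =
  ((r == 1) && rowc f c) || ((r == -1) && rowc f (- c)).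
Proof.
rewrite /two_row_vertices !mem_cat /rowc entryN; apply/idP/idP.
  case/or4P=> /mapP [i]; rewrite mem_filter => /andP [/andP [i0 ei] _] [-> ->].
  - by rewrite eqxx i0 ei.
  - by rewrite eqxx orbC opprK i0 entryN ei.
  - by rewrite eqxx orbC oppr_ge0 leNgt i0 ei.
  - by rewrite eqxx oppr_ge0 leNgt i0 entryN ei.
have ne e : entry f c == e.+1 -> entry f c != 0%N by move=> /eqP ->.
case/orP=> /andP [/eqP ->]; case: ifP => c0 ec; apply/or4P.
- by constructor 1; apply/mapP; exists c => //; rewrite mem_filter c0 ec entry_indices.
- constructor 4; apply/mapP; exists (- c); rewrite ?opprK // mem_filter entryN ec entry_indices.
    by rewrite !andbT; lia.
  by rewrite entryN; exact: ne ec.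
- constructor 2; apply/mapP; exists (- c); rewrite ?opprK // mem_filter entryN ec entry_indices ?c0 //.
  by rewrite entryN.
- constructor 3; apply/mapP; exists c => //; rewrite mem_filter ec entry_indices.
    by rewrite !andbT; lia.
  exact: ne ec.
Qed.

Lemma uniq_two_row f : uniq (two_row_vertices f).
Proof.
have um (P : pred int) (h : int -> vertex) : injective h ->
    uniq [seq h i | i <- indices f & P i].
  by move=> hi; rewrite map_inj_uniq ?filter_uniq ?uniq_indices.
rewrite /two_row_vertices !cat_uniq !um; try by move=> i i' [] //; lia.
rewrite !has_cat !negb_or; repeat (apply/andP; split) => //;
  apply/hasPn => -[c r] /mapP [i]; rewrite mem_filter => /andP [/andP [i0 _] _] [-> ->];
  apply/negP => /mapP [i']; rewrite mem_filter => /andP [/andP [i0' _] _] []; lia.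
Qed.

Lemma mem_row_arrows (vs : seq vertex) p q : ((p, q) \in row_arrows vs) =
  [&& p \in vs, q \in vs, q.2 == p.2, (q.1 < p.1)%R &
    ~~ has (fun r : vertex => (r.2 == p.2) && (q.1 < r.1 < p.1)%R) vs].
Proof.
apply/allpairsPdep/idP => [[p' [q' [h1 h2 [-> ->]]]]|/and5P [h1 h2 h3 h4 h5]].
  by move: h2; rewrite mem_filter h1 => /andP [/and3P [-> -> ->] ->].
by exists p, q; rewrite mem_filter h1 h2 h3 h4 h5.
Qed.

Lemma uniq_row_arrows (vs : seq vertex) : uniq vs -> uniq (row_arrows vs).
Proof.
move=> u; apply: allpairs_uniq_dep => //; first by move=> p _; rewrite filter_uniq.
by move=> [p q] [p' q'] _ _ /= [-> ->].
Qed.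

Definition small_vertices f : seq vertex :=
  if entry f 0 == 1%N then [seq (i, 0) | i <- indices f & entry f i == 1%N]
  else two_row_vertices f.

Definition cross_arrows f : seq arrow :=
  let l := nth 0 (pos_support f) 0 in
  let l' := nth 0 (pos_support f) 1 in
  if entry f 0 == 1%N then [::]
  else if entry f 0 == 2%N then
    if has (fun i => entry f i == 1%N) (indices f) then
      [:: ((l, 1), (0, -1)); ((0, 1), (- l, -1))]
    else [::]
  else
    if (4 <= count (fun i => entry f i == 1%N) (indices f))%N then
      [:: ((l, 1), (- l', -1)); ((l', 1), (- l, -1))]
    else [::].

Lemma small_diagramE f :
  small_diagram f = (small_vertices f, row_arrows (small_vertices f) ++ cross_arrows f).
Proof.
by rewrite /small_diagram /small_vertices /cross_arrows; case: ifP => //; rewrite cats0.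
Qed.

Lemma mem_pos_support f c : (c \in pos_support f) = (0 < c)%R && (entry f c != 0%N).
Proof.
rewrite mem_filter; case: (boolP (entry f c != 0%N)) => h; last by rewrite andbF.
by rewrite entry_indices // andbT.
Qed.

Lemma sorted_pos_support f : sorted <%R (pos_support f).
Proof. exact: sorted_filter lt_trans _ _ (sorted_indices f). Qed.

Lemma pos_support_min f l : (0 < l)%R -> entry f l <> 0%N ->
  (forall c, (0 < c)%R -> entry f c <> 0%N -> (l <= c)%R) ->
  nth 0 (pos_support f) 0 = l.
Proof.
move=> l0 /eqP Fl lmin; have : l \in pos_support f by rewrite mem_pos_support l0.
have sp := sorted_pos_support f.
have mp c : c \in pos_support f -> (l <= c)%R.
  by rewrite mem_pos_support => /andP [c0 /eqP]; exact: lmin.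
case: (pos_support f) sp mp => // x s sp mp; rewrite in_cons => /orP [/eqP //|ls].
have := mp x (mem_head _ _); move: sp; rewrite /= path_sortedE; last exact: lt_trans.
by move=> /andP [/allP /(_ _ ls)]; lia.
Qed.

Lemma pos_support_next f l l' : (0 < l)%R -> entry f l <> 0%N ->
  (forall c, (0 < c)%R -> entry f c <> 0%N -> (l <= c)%R) ->
  (l < l')%R -> entry f l' <> 0%N ->
  (forall c, (l < c)%R -> entry f c <> 0%N -> (l' <= c)%R) ->
  nth 0 (pos_support f) 1 = l'.
Proof.
move=> l0 Fl lmin ll' /eqP Fl' lmin'; have h := pos_support_min l0 Fl lmin.
have : l' \in pos_support f by rewrite mem_pos_support Fl' (lt_trans l0).
have sp := sorted_pos_support f.
have mp c : c \in pos_support f -> (l < c)%R -> (l' <= c)%R.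
  by rewrite mem_pos_support => /andP [c0 /eqP Fc] lc; exact: lmin'.
case: (pos_support f) h sp mp => // x [|y s] /= xl sp mp; rewrite !in_cons.
  by rewrite orbF => /eqP; lia.
move: sp => /andP [xy]; rewrite path_sortedE; last exact: lt_trans.
move=> /andP [/allP ys _].
have {}mp : (l < y)%R -> (l' <= y)%R by apply: mp; rewrite !in_cons eqxx orbT.
case/or3P=> [/eqP|/eqP //|/ys]; lia.
Qed.

(** Entries 1 come in opposite pairs, so the positive support is long enough for [nth] never to
    return its default in the extra arrows. *)
Lemma size_pos_support f : nth 0%N f 0 <> 1%N ->
  (count (fun c => entry f c == 1%N) (indices f) <= (size (pos_support f)).*2)%N.
Proof.
move=> f0; rewrite -size_filter -addnn -[X in (_ + X)%N](size_map (@GRing.opp int)).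
rewrite -size_cat; apply: uniq_leq_size; first by rewrite filter_uniq ?uniq_indices.
move=> c; rewrite mem_filter => /andP [/eqP Fc _]; rewrite mem_cat.
case: (ltgtP c 0) => c0; last by case: f0; rewrite -Fc c0.
  apply/orP; right; apply/mapP; exists (- c); last by rewrite opprK.
  by rewrite mem_pos_support entryN Fc oppr_gt0 c0.
by rewrite mem_pos_support Fc c0.
Qed.

Lemma cross_arrows_shape f p q : two_row_shape f -> (p, q) \in cross_arrows f ->
  exists l l', [/\ p = (l, 1), q = (- l', -1), (0 <= l)%R, (0 <= l')%R &
    [/\ l <> l', entry f l != 0%N & entry f l' != 0%N]].
Proof.
move=> [f0 _]; rewrite /cross_arrows; case: ifP => // _.
have sz := size_pos_support f0; have sp := sorted_pos_support f.
have posP i : (i < size (pos_support f))%N ->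
    (0 < nth 0 (pos_support f) i)%R /\ entry f (nth 0 (pos_support f) i) != 0%N.
  by move=> /(mem_nth 0); rewrite mem_pos_support => /andP.
case: ifP => [/eqP e0|_].
  case: ifP => //; rewrite has_count => cnt.
  have sz0 : (0 < size (pos_support f))%N.
    by rewrite -double_gt0; apply: leq_trans sz.
  have [l0 el] := posP _ sz0.
  set l := nth _ _ _ in l0 el *; rewrite !inE => /orP [] /eqP [-> ->].
    by exists l, 0; rewrite oppr0 e0 (ltW l0); split=> //; split=> //; lia.
  by exists 0, l; rewrite e0 (ltW l0); split=> //; split=> //; lia.
case: ifP => // cnt.
have sz1 : (1 < size (pos_support f))%N by rewrite -ltn_double; apply: leq_trans (ltnW cnt) sz.
have [l0 el] := posP _ (ltnW sz1); have [l0' el'] := posP _ sz1.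
have ll : (nth 0 (pos_support f) 0 < nth 0 (pos_support f) 1)%R.
  by case: (pos_support f) sp sz1 => [|x [|y s]] //= /andP [].
set l := nth _ _ 0 in l0 el ll *; set l' := nth _ _ 1 in l0' el' ll *.
rewrite !inE => /orP [] /eqP [-> ->].
  by exists l, l'; rewrite (ltW l0) (ltW l0'); split=> //; split=> //; lia.
by exists l', l; rewrite (ltW l0) (ltW l0'); split=> //; split=> //; lia.
Qed.

Lemma cross_arrows_anti f l l' :
  ((l, 1), (- l', -1)) \in cross_arrows f -> ((l', 1), (- l, -1)) \in cross_arrows f.
Proof.
rewrite /cross_arrows; case: ifP => // _; case: ifP => _; case: ifP => // _;
  rewrite !inE !xpair_eqE !eqxx !andbT !eqr_opp ?oppr_eq0 => /orP [] /andP [/eqP -> /eqP ->];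
  by rewrite !eqxx ?orbT.
Qed.

End SmallDiagrams.

(** * The whole diagram: pieces, symmetry and columns *)

Section LineDiagram.
Local Open Scope ring_scope.
Implicit Types (c a b r : int) (p q : vertex) (j : nat).

Variable d : dimvec.

(** Defined for every [j]: outside the decomposition it is the empty list, whose entries are all
    0. *)
Definition pvec j : dimvec :=
  if j is i.+1 then nth [::] (decompose d).2 i
  else if odd (entry d 0) then (decompose d).1 else [::].

Definition piece j : diagram :=
  if j is i.+1 then stretch j (small_diagram (pvec j))
  else if odd (entry d 0) then small_diagram (pvec 0) else ([::], [::]).

Definition line_vertices : seq vertex := (line_diagram d).1.
Definition line_arrow : rel vertex := fun p q => (p, q) \in (line_diagram d).2.

Lemma line_diagramE : line_diagram d =
  (flatten [seq (piece j).1 | j <- iota 0 (size (decompose d).2).+1],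
   flatten [seq (piece j).2 | j <- iota 0 (size (decompose d).2).+1]).
Proof.
rewrite /= (iotaDl 1 0) -!map_comp /line_diagram /piece /pvec.
case: (decompose d) => d0 ds; case: ifP => _; rewrite /unzip1 /unzip2 /= -!map_comp;
  by do 2 congr pair.
Qed.

Lemma line_verticesE :
  line_vertices = flatten [seq (piece j).1 | j <- iota 0 (size (decompose d).2).+1].
Proof. by rewrite /line_vertices line_diagramE. Qed.

Lemma line_arrowsE :
  (line_diagram d).2 = flatten [seq (piece j).2 | j <- iota 0 (size (decompose d).2).+1].
Proof. by rewrite line_diagramE. Qed.

Lemma pvec_spec :
  [/\ forall c, entry d c = \sum_(j <- iota 0 (size (decompose d).2).+1) entry (pvec j) c,
      forall j, (0 < j)%N -> two_row_shape (pvec j),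
      odd (entry d 0) -> entry (pvec 0) 0 = 1%N,
      forall c, (entry (pvec 0) c <= 1)%N &
      (forall i j, (0 < i)%N -> (i < j)%N -> nestv (pvec i) (pvec j)) /\
      (forall j, (0 < j)%N ->
        (forall i, nth 0%N (pvec j) i <> 0%N -> nth 0%N (pvec 0) i = 1%N) \/
        (forall i, nth 0%N (pvec 0) i <> 0%N -> nth 0%N (pvec j) i = 2%N))].
Proof.
have [] := @decompose_spec (sumn d) d (nseq (size d) 0%N) (leqnn _).
rewrite -/(decompose d) /pvec => h1 h2 h3 h4 h5.
have big j : (size (decompose d).2 <= j)%N -> nth [::] (decompose d).2 j = [::].
  by exact: nth_default.
split.
- move=> c; rewrite /entry h1 /= big_cons (iotaDl 1 0) big_map.
  congr (_ + _)%N; first by case: ifP; rewrite ?nth_nil.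
  by rewrite (big_nth [::]) /index_iota subn0.
- move=> [//|j] _; case: (ltnP j (size (decompose d).2)) => jm.
    by have [] := h2 _ (mem_nth [::] jm).
  by rewrite big //; split=> [|i]; rewrite nth_nil.
- by move=> od; rewrite od; have [] := h3 od.
- by move=> c; rewrite /entry; case: ifP => [/h3 [_ _]|_]; rewrite ?nth_nil.
- split.
    move=> [//|i] [//|j] _ ij; case: (ltnP j (size (decompose d).2)) => jm.
      by apply: h4; rewrite -ltnS ij.
    by left=> x; rewrite big // nth_nil.
  move=> [//|j] _; case: ifP => od; last by right=> x; rewrite nth_nil.
  case: (ltnP j (size (decompose d).2)) => jm; last by left=> x; rewrite big // nth_nil.
  by apply: h5 => //; exact: mem_nth.
Qed.

Lemma small_vertices_two_row j : (0 < j)%N ->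
  small_vertices (pvec j) = two_row_vertices (pvec j).
Proof.
move=> j0; have [_ h _ _ _] := pvec_spec; have [f0 _] := h j j0.
by rewrite /small_vertices; case: eqP.
Qed.

Definition zero_row : seq vertex :=
  [seq (c, 0) | c <- indices (pvec 0) & entry (pvec 0) c == 1%N].

Lemma piece0 : piece 0 = (zero_row, row_arrows zero_row).
Proof.
rewrite /piece; case: (boolP (odd (entry d 0))) => od.
  have [_ _ h _ _] := pvec_spec; have e1 := h od.
  by rewrite /small_diagram e1.
by rewrite /= /zero_row /= (negPf od).
Qed.

Lemma mem_piece0 c r : ((c, r) \in (piece 0).1) = (r == 0) && (entry (pvec 0) c == 1%N).
Proof.
rewrite piece0 /=; apply/mapP/andP => [[i]|[/eqP -> e]].
  by rewrite mem_filter => /andP [ei _] [-> ->].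
by exists c => //; rewrite mem_filter e entry_indices // (eqP e).
Qed.

Lemma stretch_inj j : (0 < j)%N -> injective (stretch_vertex j).
Proof.
move=> j0 [c r] [c' r'] [-> rr]; congr (_, _).
by apply: (mulIf _ rr); lia.
Qed.

Definition stretch_arrow j (e : arrow) : arrow :=
  (stretch_vertex j e.1, stretch_vertex j e.2).

Lemma stretch_arrow_inj j : (0 < j)%N -> injective (stretch_arrow j).
Proof.
by move=> j0 [p q] [p' q'] [h1 h2 h3 h4]; congr (_, _);
   apply: (stretch_inj j0); rewrite /stretch_vertex; congr (_, _).
Qed.

Lemma pieceS j : (0 < j)%N ->
  piece j = ([seq stretch_vertex j p | p <- two_row_vertices (pvec j)],
    [seq stretch_arrow j e |
      e <- row_arrows (two_row_vertices (pvec j)) ++ cross_arrows (pvec j)]).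
Proof.
by case: j => // j _; rewrite -small_vertices_two_row // /piece small_diagramE.
Qed.

Lemma mem_pieceS j c r : (0 < j)%N -> ((c, r) \in (piece j).1) =
  ((r == j%:Z) && rowc (pvec j) c) || ((r == - j%:Z) && rowc (pvec j) (- c)).
Proof.
move=> j0; rewrite pieceS //; apply/mapP/idP => [[[c' r']]|].
  by rewrite mem_two_row => /orP [] /andP [/eqP -> h] [-> ->];
     rewrite ?mul1r ?mulN1r eqxx h ?orbT.
case/orP=> /andP [/eqP -> h]; [exists (c, 1) | exists (c, -1)];
  rewrite ?mem_two_row ?eqxx ?h ?orbT // /stretch_vertex /= ?mul1r ?mulN1r //.
Qed.

Lemma piece_row j p : p \in (piece j).1 -> `|p.2|%N = j.
Proof.
case: p j => c r [|j]; first by rewrite mem_piece0 => /andP [/eqP -> _].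
by rewrite mem_pieceS //= => /orP [] /andP [/eqP -> _]; lia.
Qed.

Lemma piece_arrow_mem j p q : (p, q) \in (piece j).2 ->
  p \in (piece j).1 /\ q \in (piece j).1.
Proof.
case: j => [|j].
  by rewrite piece0 /= mem_row_arrows => /and5P [].
rewrite pieceS // => /mapP [[p' q']] + [-> ->].
rewrite mem_cat => /orP [].
  by rewrite mem_row_arrows => /and5P [h1 h2 _ _ _]; rewrite !map_f.
set f := pvec j.+1 => h.
suff [h1 h2] : p' \in two_row_vertices f /\ q' \in two_row_vertices f by rewrite !map_f.
have [_ /(_ j.+1 isT) f02 _ _ _] := pvec_spec.
have [l [l' [-> -> l0 l0' [_ el el']]]] := cross_arrows_shape f02 h.
by rewrite !mem_two_row !eqxx /rowc opprK l0 l0' el el' orbT.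
Qed.

Lemma mem_flatten_pieces p : p \in line_vertices = (p \in (piece `|p.2|%N).1).
Proof.
rewrite line_verticesE; apply/flatten_mapP/idP => [[j _ pj]|pj].
  by rewrite (piece_row pj).
exists `|p.2|%N => //; rewrite mem_iota /= ltnS leqNgt; apply/negP=> h.
case: p pj h => c r; case: (posnP `|r|%N) => [-> //|r0].
rewrite mem_pieceS //; case: `|r|%N r0 => // j _ + h.
have -> : pvec j.+1 = [::] by rewrite /pvec nth_default.
by rewrite /rowc /entry !nth_nil /= !if_same !andbF.
Qed.

Lemma line_arrowE p q : line_arrow p q = ((p, q) \in (piece `|p.2|%N).2).
Proof.
rewrite /line_arrow line_arrowsE; apply/flatten_mapP/idP => [[j _ pj]|pj].
  by have [/piece_row -> _] := piece_arrow_mem pj.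
exists `|p.2|%N => //; have [pv _] := piece_arrow_mem pj.
have : p \in line_vertices by rewrite mem_flatten_pieces.
rewrite line_verticesE => /flatten_mapP [j jm /piece_row ->].
exact: jm.
Qed.

Lemma line_arrowV p q : line_arrow p q -> p \in line_vertices /\ q \in line_vertices.
Proof.
rewrite line_arrowE => /piece_arrow_mem [h1 h2]; rewrite !mem_flatten_pieces h1.
by rewrite (piece_row h2).
Qed.

Lemma piece_arrow_stretch j a b r r' : (0 < j)%N ->
  (((a, r * j%:Z), (b, r' * j%:Z)) \in (piece j).2) =
  (((a, r), (b, r')) \in row_arrows (two_row_vertices (pvec j)) ++ cross_arrows (pvec j)).
Proof.
move=> j0; rewrite pieceS //.
exact: (mem_map (stretch_arrow_inj j0) _ ((a, r), (b, r'))).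
Qed.

Lemma cross_arrows_rows f p q : (p, q) \in cross_arrows f -> p.2 = 1 /\ q.2 = -1.
Proof.
rewrite /cross_arrows; case: ifP => // _; case: ifP => _; case: ifP => // _;
by rewrite !inE => /orP [] /eqP [-> ->].
Qed.

Lemma line_arrow_row r a b : line_arrow (a, r) (b, r) <->
  [/\ (a, r) \in line_vertices, (b, r) \in line_vertices, (b < a)%R &
     forall y, (y, r) \in line_vertices -> ~ (b < y < a)%R].
Proof.
rewrite line_arrowE !mem_flatten_pieces /=.
have V y : ((y, r) \in line_vertices) = ((y, r) \in (piece `|r|%N).1).
  by rewrite mem_flatten_pieces.
case: (eqVneq r 0) => [r0|r0].
  rewrite r0 absz0 in V *; rewrite {1}piece0 /= mem_row_arrows.
  have -> : zero_row = (piece 0).1.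
    by rewrite piece0.
  split=> [/and5P [h1 h2 _ h4 /hasPn h5]|[h1 h2 h3 h4]].
    by split=> // y; rewrite V => /h5 /negP h yy; apply: h; rewrite /= ?eqxx.
  apply/and5P; split=> //; apply/hasPn => -[y r'] Vy /=; apply/negP=> /andP [/eqP e].
  by apply/negP/negP => h; apply: (h4 y) => //; rewrite V -e.
have j0 : (0 < `|r|)%N by lia.
pose s := sgz r; have rE : r = s * `|r|%N%:Z by rewrite /s; lia.
have s1 : s == 1 \/ s == -1 by rewrite /s; lia.
have mV y : ((y, r) \in (piece `|r|%N).1) = ((y, s) \in two_row_vertices (pvec `|r|%N)).
  rewrite mem_pieceS // mem_two_row /s.
  by congr (_ && _ || _ && _); apply/eqP/eqP; lia.
rewrite !mV {1 2}rE piece_arrow_stretch // mem_cat mem_row_arrows.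
split=> [/orP [/and5P [h1 h2 _ h4 /hasPn h5]|/cross_arrows_rows [/= e1]]|[h1 h2 h3 h4]].
- by split=> // y; rewrite V mV => /h5 /negP h yy; apply: h; rewrite /= eqxx.
- by rewrite e1.
- apply/orP; left; apply/and5P; split=> //; apply/hasPn => -[y r'] Vy /=.
  apply/negP=> /andP [/eqP e] h; apply: (h4 y) => //.
  by rewrite V mV -e.
Qed.

Lemma line_arrowP p q : line_arrow p q ->
  (p.2 = q.2) \/ exists j l l', [/\ (0 < j)%N, p = (l, j%:Z), q = (- l', - j%:Z),
     (0 <= l)%R /\ (0 <= l')%R & l <> l' /\ ((l, 1), (- l', -1)) \in cross_arrows (pvec j)].
Proof.
rewrite line_arrowE; case: (posnP `|p.2|%N) => [->|].
  by rewrite piece0 /= mem_row_arrows => /and5P [_ _ /eqP ->]; left.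
move: `|p.2|%N => j j0.
rewrite pieceS // => /mapP [[p' q']] + [-> ->].
rewrite mem_cat => /orP []; first by rewrite mem_row_arrows => /and5P [_ _ /eqP e _ _]; left; rewrite /= e.
have [_ /(_ _ j0) f02 _ _ _] := pvec_spec => h.
have [l [l' [ep eq l0 l0' [ll _ _]]]] := cross_arrows_shape f02 h.
right; exists j, l, l'; rewrite ep eq in h *.
by rewrite /stretch_vertex mul1r mulN1r; split.
Qed.

Lemma line_arrow_lt p q : line_arrow p q -> (q.1 < p.1)%R.
Proof.
move=> h; case: (line_arrowP h) => [e|[j [l [l' [_ -> -> /= [l0 l0'] [ll _]]]]]]; last by lia.
by move: p q h e => [a r] [b r'] + /= e; rewrite -e => /line_arrow_row [].
Qed.

Local Notation F := (fun j c => entry (pvec j) c).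

Lemma pvec_le2 j c : (F j c <= 2)%N.
Proof.
have [_ f2 _ f0 _] := pvec_spec.
by case: j => [|j]; [exact: leq_trans (f0 _) _ | have [_] := f2 j.+1 isT; exact].
Qed.

Lemma pvec_pos_neq1 j : (0 < j)%N -> F j 0 <> 1%N.
Proof. by have [_ f2 _ _ _] := pvec_spec => /f2 []. Qed.

Lemma line_V_up j c : (0 < j)%N ->
  ((c, j%:Z) \in line_vertices) = (if (0 <= c)%R then F j c != 0%N else F j c == 2%N).
Proof.
move=> j0; rewrite mem_flatten_pieces /= mem_pieceS // eqxx -/(rowc _ _).
by have -> : (j%:Z == - j%:Z) = false; [lia | rewrite orbF].
Qed.

Lemma line_V_low j c : (0 < j)%N ->
  ((c, - j%:Z) \in line_vertices) = (if (c <= 0)%R then F j c != 0%N else F j c == 2%N).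
Proof.
move=> j0; rewrite mem_flatten_pieces /= abszN /= mem_pieceS // eqxx /rowc entryN oppr_ge0.
by have -> : (- j%:Z == j%:Z) = false by lia.
Qed.

Lemma line_V_mid c : ((c, 0) \in line_vertices) = (F 0 c == 1%N).
Proof. by rewrite mem_flatten_pieces mem_piece0 eqxx. Qed.

Lemma line_vneg p : p \in line_vertices -> vneg p \in line_vertices.
Proof.
case: p => c r; rewrite /vneg /=; case: (ltgtP r 0) => r0.
- have [j j0 ->] : exists2 j, (0 < j)%N & r = - j%:Z by exists `|r|%N; lia.
  by rewrite opprK line_V_low // line_V_up // entryN oppr_ge0.
- have [j j0 ->] : exists2 j, (0 < j)%N & r = j%:Z by exists `|r|%N; lia.
  by rewrite line_V_low // line_V_up // entryN oppr_le0.
- by rewrite r0 oppr0 !line_V_mid entryN.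
Qed.

Lemma line_arrow_cross j a b : (0 < j)%N -> line_arrow (a, j%:Z) (b, - j%:Z) =
  (((a, 1), (b, -1)) \in cross_arrows (pvec j)).
Proof.
move=> j0; rewrite line_arrowE /=.
have -> : (((a, j%:Z), (b, - j%:Z)) \in (piece j).2) =
    (((a, 1 * j%:Z), (b, -1 * j%:Z)) \in (piece j).2) by rewrite mul1r mulN1r.
by rewrite piece_arrow_stretch // mem_cat mem_row_arrows /= !andbF.
Qed.

Lemma line_arrow_vneg p q : line_arrow p q -> line_arrow (vneg q) (vneg p).
Proof.
move=> h; case: (line_arrowP h) => [e|[j [l [l' [j0 ep eq _ [_ hc]]]]]].
  move: p q e h => [a r] [b r'] /= <- /line_arrow_row [h1 h2 h3 h4].
  apply/line_arrow_row; split; [exact: (line_vneg h2)|exact: (line_vneg h1)|by rewrite ltrN2|].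
  by move=> y /line_vneg; rewrite /vneg /= opprK => /h4; rewrite ltrNl ltrNr andbC.
by rewrite /vneg ep eq /= !opprK line_arrow_cross // cross_arrows_anti.
Qed.

(** An arrow between opposite vertices would have coefficient 0, as [e_{i,-i}] does not occur in the
    Chevalley basis. In the middle row such an arrow would jump over the vertex [(0, 0)]; between
    two rows it is excluded by [l <> l']. *)
Lemma line_arrow_neq p q : line_arrow p q -> q <> vneg p.
Proof.
move=> h; case: (line_arrowP h) => [e|[j [l [l' [j0 -> -> _ [ll _]]]]]]; last first.
  by rewrite /vneg /= => -[/oppr_inj ?]; apply: ll.
move: p q e h => [a r] [b r'] /= <- /line_arrow_row [h1 h2 h3 h4] [eb er].
have r0 : r = 0 by lia.
move: h1; rewrite r0 line_V_mid => /eqP Fa.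
have [_ _ f00 _ _] := pvec_spec.
suff F00 : F 0 0 = 1%N by apply: (h4 0); rewrite ?r0 ?line_V_mid ?F00 //; lia.
apply: f00; apply: contra_eqT Fa => od.
by rewrite /pvec (negPf od) /entry nth_nil.
Qed.

Lemma mem_ones f c : entry f c = 1%N -> has (fun c => entry f c == 1%N) (indices f).
Proof.
by move=> fc; apply/hasP; exists c; [apply: entry_indices; rewrite fc | rewrite fc].
Qed.

Lemma line_cross_C j l a b : (0 < j)%N -> F j 0 = 2%N ->
  (exists c, F j c = 1%N) -> minsupp F j l ->
  line_arrow (a, j%:Z) (b, - j%:Z) = ((a, b) == (l, 0)) || ((a, b) == (0, - l)).
Proof.
move=> j0 F2 [c /mem_ones ones] [l0 Fl lmin].
rewrite line_arrow_cross // /cross_arrows F2 (_ : (2 == 1)%N = false) // eqxx ones (pos_support_min l0 Fl lmin).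
by rewrite !inE !xpair_eqE !eqxx !andbT.
Qed.

Lemma line_cross_D1 j a b : (0 < j)%N -> F j 0 = 0%N ->
  (forall c c', (0 < c)%R -> (0 < c')%R -> F j c = 1%N -> F j c' = 1%N -> c = c') ->
  line_arrow (a, j%:Z) (b, - j%:Z) = false.
Proof.
move=> j0 F0 h; rewrite line_arrow_cross // /cross_arrows F0 (_ : (0 == 1)%N = false) // (_ : (0 == 2)%N = false) //.
have [cnt|//] := leqP 4; exfalso.
set f := pvec j in F0 h cnt.
suff [c s2] : exists c, {subset [seq c <- indices f | entry f c == 1%N] <= [:: c; - c]}.
  have := uniq_leq_size (filter_uniq _ (uniq_indices f)) s2.
  by rewrite size_filter => /(leq_trans cnt).
have [/hasP [c0 _ /eqP Fc0]|/hasPn no] := boolP (has (fun c => entry f c == 1%N) (indices f)); last first.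
  by exists 0 => c; rewrite mem_filter => /andP [Fc /no]; rewrite Fc.
have nz c : entry f c = 1%N -> c != 0 by apply: contra_eq_neq => ->; rewrite F0.
have norm c : entry f `|c| = entry f c by case: (ger0P c) => // _; rewrite entryN.
exists c0 => c; rewrite mem_filter => /andP [/eqP Fc _].
have : `|c| = `|c0| by apply: h; rewrite ?normr_gt0 ?norm ?nz.
by rewrite !inE; lia.
Qed.

Lemma line_cross_D2 j l l' a b : (0 < j)%N -> F j 0 = 0%N ->
  (exists c c', [/\ (0 < c)%R, (c < c')%R, F j c = 1%N & F j c' = 1%N]) ->
  minsupp F j l -> (l < l')%R -> F j l' <> 0%N ->
  (forall c, (l < c)%R -> F j c <> 0%N -> (l' <= c)%R) ->
  line_arrow (a, j%:Z) (b, - j%:Z) = ((a, b) == (l, - l')) || ((a, b) == (l', - l)).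
Proof.
move=> j0 F0 [c [c' [c0 cc Fc Fc']]] [l0 Fl lmin] ll Fl' lmin'.
rewrite line_arrow_cross // /cross_arrows F0 (_ : (0 == 1)%N = false) // (_ : (0 == 2)%N = false) //.
rewrite (pos_support_min l0 Fl lmin) (pos_support_next l0 Fl lmin ll Fl' lmin').
have -> : (4 <= count (fun c => entry (pvec j) c == 1%N) (indices (pvec j)))%N.
  rewrite -size_filter; apply: (@uniq_leq_size _ [:: c; c'; - c; - c']).
    by rewrite /= !inE; lia.
  have ok x : F j x = 1%N ->
      x \in [seq x <- indices (pvec j) | entry (pvec j) x == 1%N].
    by move=> Fx; rewrite mem_filter Fx entry_indices ?Fx.
  by move=> x; rewrite !inE => /or4P [] /eqP ->; apply: ok; rewrite ?entryN.
by rewrite !inE !xpair_eqE !eqxx !andbT.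
Qed.

Lemma line_cross_rows p q : line_arrow p q -> p.2 <> q.2 ->
  exists2 j, (0 < j)%N & p.2 = j%:Z /\ q.2 = - j%:Z.
Proof. by move=> /line_arrowP [//|[j [l [l' [j0 -> -> _ _]]]]] _; exists j. Qed.

Lemma uniq_flatten_map (T : eqType) (A : nat -> seq T) (g : T -> nat) (s : seq nat) :
  (forall j x, x \in A j -> g x = j) -> (forall j, uniq (A j)) -> uniq s ->
  uniq (flatten [seq A j | j <- s]).
Proof.
move=> gA uA; elim: s => //= j s IH /andP [js us]; rewrite cat_uniq uA IH // andbT.
apply/hasPn => x /flatten_mapP [i si /gA xi]; apply: contra js => /gA xj.
by rewrite -xj xi.
Qed.

Lemma uniq_piece_vertices j : uniq (piece j).1.
Proof.
case: j => [|j].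
  by rewrite piece0 map_inj_uniq ?filter_uniq ?uniq_indices // => c c' [].
by rewrite pieceS // map_inj_uniq ?uniq_two_row //; exact: stretch_inj.
Qed.

Lemma uniq_line_vertices : uniq (line_vertices).
Proof.
rewrite line_verticesE; apply: (@uniq_flatten_map _ _ (fun p => `|p.2|%N)).
- by move=> j p; exact: piece_row.
- exact: uniq_piece_vertices.
- exact: iota_uniq.
Qed.

Lemma uniq_cross_arrows f : two_row_shape f -> uniq (cross_arrows f).
Proof.
move=> f02; have := @cross_arrows_shape f _ _ f02.
have aux (x y : arrow) : x != y -> uniq [:: x; y] by rewrite /= inE => ->.
rewrite /cross_arrows; case: ifP => // _; case: ifP => _; case: ifP => // _ h; apply: aux.
all: apply/eqP=> -[e1 e2].
- have [l [l' [[<-] [e] _ _ [+ _ _]]]] := h _ _ (mem_head _ _).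
  by rewrite e1; lia.
- have [l [l' [[<-] [e] _ _ [+ _ _]]]] := h _ _ (mem_head _ _).
  by rewrite e1; lia.
Qed.

Lemma uniq_line_arrows : uniq (line_diagram d).2.
Proof.
rewrite line_arrowsE; apply: (@uniq_flatten_map _ _ (fun e : arrow => `|e.1.2|%N)).
- by move=> j [p q] /piece_arrow_mem [/piece_row].
- case=> [|j].
    by rewrite piece0; apply: uniq_row_arrows; have := uniq_piece_vertices 0; rewrite piece0.
  have [_ /(_ j.+1 isT) f02 _ _ _] := pvec_spec.
  rewrite pieceS // map_inj_uniq; last exact: stretch_arrow_inj.
  rewrite cat_uniq uniq_row_arrows ?uniq_two_row // uniq_cross_arrows // andbT /=.
  apply/hasPn => -[p q] /(cross_arrows_shape f02) [l [l' [-> -> _ _ _]]].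
  by rewrite mem_row_arrows /= !andbF.
- exact: iota_uniq.
Qed.

Lemma count_piece j c : count (fun p : vertex => p.1 == c) (piece j).1 = F j c.
Proof.
have [_ f2 _ f0 _] := pvec_spec.
case: (posnP j) => [->|j0].
  transitivity (size [seq p <- [:: (c, 0 : int)] | p \in (piece 0).1]).
    rewrite -size_filter; apply/perm_size/uniq_perm; rewrite ?filter_uniq ?uniq_piece_vertices //.
    move=> [a r]; rewrite !mem_filter !inE andbC /= mem_piece0 !xpair_eqE.
    by rewrite -andbA; case: (r == 0); rewrite ?andbF ?andbT.
  rewrite /= mem_piece0 eqxx; have := f0 c.
  by case: (entry _ _) => [|[|?]].
transitivity (size [seq p <- [:: (c, j%:Z); (c, - j%:Z)] | p \in (piece j).1]).
  rewrite -size_filter; apply/perm_size/uniq_perm; rewrite ?filter_uniq ?uniq_piece_vertices //.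
    by rewrite /= !inE !xpair_eqE; lia.
  move=> [a r]; rewrite !mem_filter !inE andbC /= mem_pieceS // !xpair_eqE.
  by case: (r == j%:Z); case: (r == - j%:Z); rewrite ?andbF ?andbT ?orbF //= ?orbT ?andbT ?orbb.
have jj : (j%:Z == - j%:Z) = false by lia.
rewrite /= !mem_pieceS // !eqxx [- j%:Z == _]eq_sym jj /= orbF /rowc entryN oppr_ge0.
have := pvec_le2 j c; have := @pvec_pos_neq1 j j0.
case: (ltgtP 0 c) => [c0 _|c0 _|<-]; case: (entry _ _) => [|[|[|?]]] //=.
Qed.

Lemma count_line_vertices c : count (fun p : vertex => p.1 == c) (line_vertices) = entry d c.
Proof.
have [dE _ _ _ _] := pvec_spec.
rewrite dE line_verticesE count_flatten sumnE !big_map.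
by apply: eq_bigr => j _; rewrite count_piece.
Qed.

Lemma line_entry p : p \in line_vertices -> (`|p.1| < size d)%N.
Proof.
move=> Vp; rewrite ltnNge; apply: contraPN Vp => h.
have := count_line_vertices p.1; rewrite /entry nth_default // => /eqP.
rewrite -leqn0 leqNgt -has_count => /hasPn no; apply/negP/negP=> /no.
by rewrite eqxx.
Qed.

Lemma perm_line_vneg : perm_eq (line_vertices) [seq vneg p | p <- line_vertices].
Proof.
have vnegK : involutive vneg by move=> [c r]; rewrite /vneg !opprK.
apply: uniq_perm; rewrite ?(map_inj_uniq (inv_inj vnegK)) ?uniq_line_vertices // => p.
apply/idP/mapP => [Vp|[q Vq ->]]; last exact: line_vneg.
by exists (vneg p); rewrite ?vnegK // line_vneg.
Qed.

Lemma count_line_le (i : nat) : count (fun p : vertex => (p.1 <= - i%:Z)%R) (line_vertices) =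
  (\sum_(i <= j < size d) entry d j)%N.
Proof.
have [m] := ubnP (size d - i)%N; elim: m i => // m IH i im.
case: (leqP (size d) i) => h.
  rewrite big_geq //; apply/eqP; rewrite -leqn0 leqNgt -has_count.
  by apply/hasPn => p /line_entry; lia.
rewrite big_ltn // -IH; last by lia.
rewrite -[entry d i]entryN -count_line_vertices -count_predUI.
rewrite [X in (_ + X)%N](_ : _ = 0%N) ?addn0.
  by apply: eq_count => p /=; lia.
apply/eqP; rewrite -leqn0 leqNgt -has_count.
by apply/hasPn => p _ /=; lia.
Qed.

Lemma size_line_vertices :
  size (line_vertices) = (entry d 0 + (\sum_(1 <= j < size d) entry d j).*2)%N.
Proof.
rewrite -count_line_le -addnn -count_line_vertices.
rewrite [X in (_ + (X + _))%N](_ : _ = count (fun p : vertex => (1 <= p.1)%R) (line_vertices)).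
  rewrite -(count_predC (fun p : vertex => p.1 == 0)); congr (_ + _)%N.
  rewrite -count_predUI [X in (_ = _ + X)%N](_ : _ = 0%N) ?addn0.
    by apply: eq_count => p /=; lia.
  apply/eqP; rewrite -leqn0 leqNgt -has_count.
  by apply/hasPn => p _ /=; lia.
rewrite (permP perm_line_vneg) count_map; apply: eq_count => p /=.
lia.
Qed.

End LineDiagram.

Section LineGood.
Local Open Scope ring_scope.

Lemma line_good (k : fieldType) (d : dimvec) (E om : vertex -> vertex -> k) :
  (2%:R : k) != 0 ->
  (forall p q, line_arrow d p q -> E p q != 0) ->
  (forall p q, line_arrow d p q -> E p q = - E (vneg q) (vneg p)) ->
  (forall p q, om q p = - om p q) ->
  (forall p q, p \in line_vertices d -> q \in line_vertices d -> (p.1 + q.1 <= 0)%R ->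
    \sum_(z <- line_vertices d | line_arrow d p z) E p z * om z q +
    \sum_(z <- line_vertices d | line_arrow d q z) E q z * om p z = 0) ->
  forall p q, p \in line_vertices d -> q \in line_vertices d ->
    (p.1 + q.1 < 0)%R -> om p q = 0.
Proof.
move=> char2 En0 EN omN rel p q; have [_ _ _ f0 [nest nest0]] := pvec_spec d.
apply: (@good_all k _ (line_arrow d) E om (fun j c => entry (pvec d j) c)) => //.
- exact: uniq_line_vertices.
- by move=> j c; exact: entryN.
- exact: pvec_le2.
- exact: pvec_pos_neq1.
- exact: line_V_up.
- exact: line_V_low.
- exact: line_V_mid.
- exact: line_arrowV.
- exact: line_arrow_lt.
- exact: line_arrow_row.
- exact: line_cross_rows.
- exact: line_cross_C.
- exact: line_cross_D1.
- exact: line_cross_D2.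
- move=> i j i0 ij; case: (nest i j i0 ij) => [h|[h1 h2 h3]]; [left|right].
    by move=> c; exact: h.
  by split=> // c; [exact: h2 | exact: h3].
- move=> j j0; case: (nest0 j j0) => h; [left|right] => c; exact: h.
Qed.

End LineGood.

(** * Signs and labels *)

Section Signs.
Local Open Scope ring_scope.
Variable N : nat.
Implicit Types i j : int.

Definition neg_pair (e : int * int) : int * int := (- e.2, - e.1).

Lemma neg_pairK : involutive neg_pair.
Proof. by move=> [i j]; rewrite /neg_pair !opprK. Qed.

Lemma Chevalley_snd e : e \in Chevalley_basis N -> e.2 = neg_pair e.1.
Proof.
rewrite /Chevalley_basis !mem_cat => /or3P [].
- by move=> /allpairsP [[i j] [_ _ ->]].
- move=> /flattenP [s /allpairsPdep [i [j [_ _ ->]]]].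
  by rewrite !inE => /orP [] /eqP ->; rewrite /neg_pair /= !opprK.
- case: (odd N) => // /flattenP [s /mapP [l _ ->]].
  by rewrite !inE => /orP [] /eqP ->; rewrite /neg_pair /= ?opprK ?oppr0.
Qed.

(** The indices of the terms with coefficient 1 in the Chevalley basis, by inequalities instead of
    lists. *)
Definition pos_pair i j : bool :=
  let n := N./2%:Z in
  [|| (0 < i <= n)%R && (0 < j <= n)%R,
      [&& 0 < i, i < - j & - j <= n]%R, [&& 0 < j, j < - i & - i <= n]%R |
      odd N && ((0 < i <= n)%R && (j == 0) || (i == 0) && (0 < j <= n)%R)].

Lemma mem_Chevalley_fst i j : ((i, j) \in unzip1 (Chevalley_basis N)) = pos_pair i j.
Proof.
rewrite /Chevalley_basis /unzip1 !map_cat !mem_cat /pos_pair /=; congr (_ || _).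
  apply/mapP/idP => [[e /allpairsP [[a b] [/= + + ->]] [-> ->]]|/andP [hi hj]].
    by rewrite !mem_iota; lia.
  exists ((i, j), (- j, - i)) => //; apply/allpairsP; exists (`|i|%N, `|j|%N).
  by rewrite /= !mem_iota !gez0_abs; [split=> //; lia|lia|lia].
rewrite orbA; congr (_ || _).
  apply/mapP/idP => [[e /flattenP [s /allpairsPdep [a [b [+ + ->]]]]]|].
    rewrite mem_filter !mem_iota !inE => ha hb /orP [] /eqP -> [-> ->] /=; apply/orP; lia.
  case/orP=> h; [exists ((i, j), (- j, - i))|exists ((i, j), (- j, - i))] => //.
    apply/flattenP; exists [:: ((i, j), (- j, - i)); ((j, i), (- i, - j))]; last exact: mem_head.
    apply/allpairsPdep; exists `|i|%N, `|j|%N; rewrite mem_filter !mem_iota.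
    have [-> ->] : `|i|%N%:Z = i /\ `|j|%N%:Z = - j by lia.
    by split; [lia|lia|rewrite opprK].
  apply/flattenP; exists [:: ((j, i), (- i, - j)); ((i, j), (- j, - i))]; last by rewrite !inE eqxx orbT.
  apply/allpairsPdep; exists `|j|%N, `|i|%N; rewrite mem_filter !mem_iota.
  have [-> ->] : `|i|%N%:Z = - i /\ `|j|%N%:Z = j by lia.
  by split; [lia|lia|rewrite opprK].
case: (odd N) => //=; apply/mapP/idP => [[e /flattenP [s /mapP [l + ->]]]|].
  rewrite mem_iota !inE => ha /orP [] /eqP -> [-> ->]; lia.
case/orP=> /andP [h1 h2].
  exists ((i, 0), (0, - i)); last by rewrite (eqP h2).
  apply/flattenP; exists [:: ((i, 0), (0, - i)); ((0, i), (- i, 0))]; last exact: mem_head.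
  by apply/mapP; exists `|i|%N; rewrite ?mem_iota ?gez0_abs //; lia.
exists ((0, j), (- j, 0)); last by rewrite (eqP h1).
apply/flattenP; exists [:: ((j, 0), (0, - j)); ((0, j), (- j, 0))]; last by rewrite !inE eqxx orbT.
by apply/mapP; exists `|j|%N; rewrite ?mem_iota ?gez0_abs //; lia.
Qed.

Lemma mem_Chevalley_snd i j : ((i, j) \in unzip2 (Chevalley_basis N)) = pos_pair (- j) (- i).
Proof.
rewrite -mem_Chevalley_fst -[in LHS](neg_pairK (i, j)).
have -> : unzip2 (Chevalley_basis N) = [seq neg_pair e | e <- unzip1 (Chevalley_basis N)].
  by rewrite /unzip1 -map_comp; apply/eq_in_map => e /Chevalley_snd.
by rewrite (mem_map (inv_inj neg_pairK)).
Qed.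

Definition is_lab i : bool := (`|i| <= N./2%:Z)%R && (odd N || (i != 0)).

Lemma pos_pair_neg i j : is_lab i -> is_lab j -> i + j != 0 ->
  pos_pair (- j) (- i) = ~~ pos_pair i j.
Proof.
rewrite /is_lab /pos_pair !opprK !oppr_gt0 !oppr_eq0; move: (N./2%:Z) => n.
case: (ltgtP i 0) => [i0|i0|->]; case: (ltgtP j 0) => [j0|j0|->];
  case: (odd N) => //=; rewrite ?andbF ?andbT ?orbF ?orbT /=; lia.
Qed.

Lemma epsE i j : is_lab i -> is_lab j -> i + j != 0 -> eps N i j = (-1) ^+ (~~ pos_pair i j).
Proof.
move=> hi hj ij; rewrite /eps mem_Chevalley_fst mem_Chevalley_snd pos_pair_neg //.
by case: (pos_pair i j).
Qed.

Lemma is_labN i : is_lab (- i) = is_lab i.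
Proof. by rewrite /is_lab normrN oppr_eq0. Qed.

(** With the symmetry of the diagram under [vneg], this makes [x] skew for the form. *)
Lemma eps_anti i j : is_lab i -> is_lab j -> i + j != 0 -> eps N (- j) (- i) = - eps N i j.
Proof.
move=> hi hj ij; rewrite !epsE ?is_labN ?pos_pair_neg //; last by lia.
by case: (pos_pair i j).
Qed.

Lemma is_lab_lab (a : nat) : (a < N)%N -> is_lab (lab N a).
Proof.
move=> aN; have := odd_double_half N; rewrite /is_lab /lab.
by case: (odd N) => /=; [lia | case: ifP; lia].
Qed.

Lemma lab_inj (a b : nat) : (a < N)%N -> (b < N)%N -> lab N a = lab N b -> a = b.
Proof.
move=> aN bN; have := odd_double_half N; rewrite /lab.
by case: (odd N) => /=; [lia | do 2 case: ifP; lia].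
Qed.

Lemma lab_le (a c : nat) : (a < N)%N -> (c <= N./2)%N ->
  (lab N a <= - c%:Z - 1)%R = (a < N./2 - c)%N.
Proof.
move=> aN cn; have := odd_double_half N; rewrite /lab.
by case: (odd N) => /=; [lia | case: ifP; lia].
Qed.

End Signs.

(** * Numbering of the vertices and isotropic flags *)

Section Labelling.
Local Open Scope ring_scope.

Lemma vertex_le_total : total vertex_le.
Proof. by move=> [a r] [b s]; rewrite /vertex_le /=; lia. Qed.

Lemma vertex_le_trans : transitive vertex_le.
Proof. by move=> [a r] [b s] [c u]; rewrite /vertex_le /=; lia. Qed.

Lemma vertex_le_anti : antisymmetric vertex_le.
Proof.
move=> [a r] [b s]; rewrite /vertex_le /= => h.
by have [-> ->] : a = b /\ r = s by lia.
Qed.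

Lemma vertex_le_vneg p q : vertex_le (vneg p) (vneg q) = vertex_le q p.
Proof. by case: p q => [a r] [b s]; rewrite /vertex_le /=; lia. Qed.

Lemma count_sorted (T : Type) (le : rel T) (P : pred T) (x0 : T) (s : seq T) (i : nat) :
  transitive le -> (forall x y, le x y -> P y -> P x) -> sorted le s -> (i < size s)%N ->
  (i < count P s)%N = P (nth x0 s i).
Proof.
move=> le_tr leP; elim: s i => // x s IH i; rewrite /= path_sortedE // => /andP [xs ss].
case: (boolP (P x)) => Px; first by case: i => [|i] //= ?; rewrite add1n ltnS IH.
have noP : all (predC P) s by apply: sub_all xs => y /= /leP h; apply: contra Px.
rewrite add0n; have -> : count P s = 0%N.
  by apply/eqP; rewrite -leqn0 leqNgt -has_count -all_predC.
by case: i => [|i] /= h; rewrite ?(negPf Px) //; move/(all_nthP x0): noP => /(_ i h) /negPf.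
Qed.

Variables (N : nat) (t : seq nat).
Hypothesis ht : (sumn t <= N./2)%N.

Local Notation d := (orth_dimvec N t).
Local Notation vs := (line_vertices d).

Definition sorted_vertices : seq vertex := sort vertex_le vs.
Local Notation sv := sorted_vertices.

Definition vtx (a : 'I_N) : vertex := nth (0, 0) sv a.
Definition vcol (a : 'I_N) : int := (vtx a).1.

Lemma sum_entry : (\sum_(1 <= j < size d) entry d j = sumn t)%N.
Proof.
by rewrite big_add1 /= sumnE [RHS](big_nth 0%N).
Qed.

Lemma size_sv : size sv = N.
Proof.
rewrite size_sort size_line_vertices sum_entry /entry /=.
by have := odd_double_half N; lia.
Qed.

Lemma uniq_sv : uniq sv.
Proof. by rewrite sort_uniq uniq_line_vertices. Qed.

Lemma sorted_sv : sorted vertex_le sv.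
Proof. exact/sort_sorted/vertex_le_total. Qed.

Lemma vtx_inj : injective vtx.
Proof.
move=> a b /eqP; rewrite /vtx nth_uniq ?size_sv ?uniq_sv //.
by move=> /eqP /val_inj.
Qed.

Lemma mem_vtx a : vtx a \in vs.
Proof. by rewrite -(mem_sort vertex_le) mem_nth // size_sv. Qed.

Lemma vtxP p : p \in vs -> exists a, p = vtx a.
Proof.
move=> Vp; have ip : (index p sv < N)%N by rewrite -size_sv index_mem mem_sort.
by exists (Ordinal ip); rewrite /vtx nth_index // mem_sort.
Qed.

Lemma label_vtx a : label N (line_diagram d) (vtx a) = lab N a.
Proof. by rewrite /label index_uniq ?size_sv ?uniq_sv. Qed.

(** [vneg] permutes the vertices and reverses their order, so the sorted list is the reverse of its
    own image. *)
Lemma vtx_rev a : vtx (rev_ord a) = vneg (vtx a).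
Proof.
have sv_rev : sv = rev [seq vneg p | p <- sv].
  apply: (sorted_eq vertex_le_trans vertex_le_anti sorted_sv).
    rewrite rev_sorted sorted_map; apply: sub_sorted sorted_sv => p q /=.
    by rewrite vertex_le_vneg.
  rewrite perm_sort perm_sym perm_rev; apply: perm_trans (perm_map _ _) _.
    by rewrite perm_sort.
  by rewrite perm_sym perm_line_vneg.
have aN := ltn_ord a.
rewrite /vtx {1}sv_rev nth_rev ?size_map ?size_sv // (nth_map (0, 0)) ?size_sv /=; last by lia.
by have -> : (N - (N - a.+1).+1 = a)%N by lia.
Qed.

Lemma vcolN a : vcol (rev_ord a) = - vcol a.
Proof. by rewrite /vcol vtx_rev. Qed.

Lemma lab_rev (a : 'I_N) : lab N (rev_ord a) = - lab N a.
Proof. by apply/eqP; rewrite -addr_eq0 addrC lab_add_eq0. Qed.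

Lemma lab_vneg p : p \in vs -> label N (line_diagram d) (vneg p) = - label N (line_diagram d) p.
Proof. by move=> /vtxP [a ->]; rewrite -vtx_rev !label_vtx lab_rev. Qed.

(** Both conditions select an initial segment of the basis; its length is
    [d_i + ... + d_s = n - c_i] in both cases. *)
Lemma vcol_le_flag (i : nat) (a : 'I_N) : (0 < i <= size d)%N ->
  (lab N a <= - (cpart d i)%:Z - 1)%R = (vcol a <= - i%:Z)%R.
Proof.
move=> /andP [i0 id]; have := sum_entry; rewrite (big_cat_nat i0 id) /= => e.
have d0 : ((entry d 0)./2 = N./2 - sumn t)%N by rewrite /entry /=; lia.
have cE : (cpart d i + \sum_(i <= j < size d) entry d j = N./2)%N.
  by rewrite /cpart d0 -addnA e; lia.
rewrite lab_le //; last by rewrite -cE leq_addr.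
rewrite -{1}cE addKn -count_line_le -(permP (permEl (perm_sort vertex_le _))).
apply: (count_sorted _ vertex_le_trans _ sorted_sv); last by rewrite size_sv.
by move=> [b r] [c s]; rewrite /vertex_le /=; lia.
Qed.

End Labelling.

(** * The diagram element and the conclusion *)

Section DiagramElement.
Local Open Scope ring_scope.
Variables (k : closedFieldType) (N : nat) (t : seq nat).
Hypothesis ht : (sumn t <= N./2)%N.

Local Notation d := (orth_dimvec N t).
Local Notation vs := (line_vertices d).
Local Notation vt := (@vtx N t).
Local Notation co := (@vcol N t).
Local Notation x := (diagram_elt k N d).

Lemma flag_upto (i : nat) : (0 < i <= size d)%N ->
  (flag k N d i :=: upto k co (- i%:Z))%MS.
Proof.
move=> hi; apply/eqmxP/andP; split.
  apply/sumsmx_subP => a; rewrite vcol_le_flag // => ha.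
  rewrite genmxE; apply: (submx_trans _ (row_sub a _)).
  rewrite (_ : row a _ = delta_mx 0 a) //; apply/rowP => b.
  by rewrite !mxE ha eqxx eq_sym; case: (_ == _); rewrite ?mulr1n ?mulr0n.
apply/row_subP => a; case: (boolP (co a <= - i%:Z)) => ha; last first.
  rewrite (_ : row a _ = 0) ?sub0mx //; apply/rowP => b.
  by rewrite !mxE (negPf ha) mul0rn.
apply: (sumsmx_sup a); first by rewrite vcol_le_flag.
rewrite genmxE (_ : row a _ = delta_mx 0 a) //; apply/rowP => b.
by rewrite !mxE ha eqxx eq_sym; case: (_ == _); rewrite ?mulr1n ?mulr0n.
Qed.

(** The flag controls only rows of negative abscissa. The other rows of [g] are reached through its
    inverse, which also preserves the flag and is the adjoint of [g]. *)
Lemma parabolicP g : parabolic k N d g <-> Pg co g.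
Proof.
have inv_flag A i : (0 < i <= size d)%N -> (flag k N d i *m A == flag k N d i)%MS ->
    (upto k co (- i%:Z) *m A <= upto k co (- i%:Z))%MS.
  move=> /flag_upto e /andP [h _]; move: h.
  by rewrite e (eqmxMr A e).
split=> [[og fg]|[og tg]]; split=> //; last first.
  move=> i hi; have {}hi : (0 < i <= size d)%N by [].
  have e := flag_upto hi; apply/andP; rewrite !(eqmxMr g e) !e tri_upto //; split=> //.
  rewrite -{1}(mulmxKV (orthogonal_unit og) (upto k co (- i%:Z))).
  by apply: submxMr; apply: sub_mul_unit (orthogonal_unit og) (tri_upto _ tg).
have neg A : (forall i : nat, (1 <= i <= (bound d).+1)%N -> (flag k N d i *m A == flag k N d i)%MS) ->
    forall a b, (co a < co b)%R -> (co a < 0)%R -> A a b = 0.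
  move=> fA a b ab a0; have hi : (0 < `|co a| <= size d)%N.
    by have := line_entry (mem_vtx ht a); rewrite -/(co a); lia.
  have /sub_upto /matrixP /(_ a b) := inv_flag A _ hi (fA _ hi).
  rewrite mul_upto upto_mul (_ : - `|co a|%N%:Z = co a); last by lia.
  by rewrite lexx leNgt ab /= mulr1n mulr0n => <-.
move=> a b ab; case: (ltP (co a) 0) => a0; first exact: neg fg a b ab a0.
have ginv i : (1 <= i <= (bound d).+1)%N -> (flag k N d i *m invmx g == flag k N d i)%MS.
  move=> /fg /eqmxP e; apply/eqmxP; apply: eqmx_trans (eqmx_sym (eqmxMr _ e)) _.
  by rewrite mulmxK // orthogonal_unit.
have := neg _ ginv (rev_ord b) (rev_ord a).
by rewrite orthogonal_inv // adjmE !rev_ordK !vcolN // ltrN2 oppr_lt0; apply; lia.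
Qed.

Definition sgn (p q : vertex) : k :=
  (eps N (label N (line_diagram d) p) (label N (line_diagram d) q))%:~R.

Lemma diagram_eltE a b :
  x a b = if line_arrow d (vt a) (vt b) then sgn (vt a) (vt b) else 0.
Proof.
rewrite /diagram_elt /labelled_arrows big_map summxE /line_arrow.
rewrite (eq_big_seq (fun e => if e == (vt a, vt b) then sgn (vt a) (vt b) else 0)); last first.
  move=> [p q] /= h; have [/vtxP [//|a' ->] /vtxP [//|b' ->]] := line_arrowV h.
  rewrite !mxE xpair_eqE !label_vtx // (inj_eq (vtx_inj ht)) (inj_eq (vtx_inj ht)).
  have labE (c c' : 'I_N) : (lab N c == lab N c') = (c' == c).
    by apply/eqP/eqP => [/(lab_inj (ltn_ord c) (ltn_ord c')) /val_inj ->|->].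
  rewrite !labE; case: eqP => [->|] /=; last by rewrite mulr0.
  by case: eqP => [->|] /=; rewrite ?mulr0 // mulr1 /sgn !label_vtx.
case: ifP => h.
  rewrite (bigD1_seq _ h) ?uniq_line_arrows //= eqxx big1 ?addr0 // => e /negPf -> //.
by rewrite big1_seq // => e /= he; case: eqP => // ee; rewrite -ee he in h.
Qed.

Lemma sgn_labels p q : line_arrow d p q ->
  let i := label N (line_diagram d) p in let j := label N (line_diagram d) q in
  [/\ is_lab N i, is_lab N j & i + j != 0].
Proof.
move=> h; have [Vp Vq] := line_arrowV h; have nq := line_arrow_neq h.
have [a ea] := vtxP ht Vp; have [b eb] := vtxP ht Vq.
rewrite ea eb !label_vtx //; split; try exact: is_lab_lab.
rewrite lab_add_eq0; apply/eqP => ba; apply: nq.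
by rewrite eb ba vtx_rev // ea.
Qed.

Lemma sgn_neq0 p q : line_arrow d p q -> sgn p q != 0.
Proof.
move=> /sgn_labels [h1 h2 h3]; rewrite /sgn epsE //.
by case: (pos_pair _ _ _) => /=; rewrite ?expr1 ?expr0 ?rmorphN1 ?rmorph1 ?oppr_eq0 oner_neq0.
Qed.

Lemma sgn_anti p q : line_arrow d p q -> sgn p q = - sgn (vneg q) (vneg p).
Proof.
move=> h; have [Vp Vq] := line_arrowV h; have [h1 h2 h3] := sgn_labels h.
by rewrite /sgn !lab_vneg // eps_anti // rmorphN opprK.
Qed.

Lemma uu_diagram_elt : uu co x.
Proof.
have arN p q : line_arrow d (vneg q) (vneg p) = line_arrow d p q.
  apply/idP/idP; last exact: line_arrow_vneg.
  by move=> /line_arrow_vneg; rewrite /vneg /= !opprK -!surjective_pairing.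
split.
  apply/matrixP=> a b; rewrite adjmE mxE !diagram_eltE !vtx_rev // arN.
  by case: ifP => [/sgn_anti ->|]; rewrite ?opprK ?oppr0.
by move=> a b; rewrite diagram_eltE; case: ifP => // /line_arrow_lt; rewrite ltNge => /negPf ->.
Qed.

Lemma sum_vertices (G : vertex -> k) : \sum_(p <- vs) G p = \sum_(a < N) G (vt a).
Proof.
rewrite -(perm_big _ (permEl (perm_sort vertex_le vs))) (big_nth (0, 0)) -/(sorted_vertices N t).
by rewrite size_sv // big_mkord.
Qed.

Lemma diagram_elt_dual (w : 'M[k]_N) :
  (2%:R : k) != 0 -> so w -> strict co (w *m x - x *m w) -> tri co w.
Proof.
move=> char2 sw cw.
(* The sums have at most one term; they define the form on arbitrary pairs, with value 0 outside the
   diagram. *)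
pose om p q : k := \sum_(a < N | vt a == p) \sum_(b < N | vt b == q) w a (rev_ord b).
have omE a b : om (vt a) (vt b) = w a (rev_ord b).
  rewrite /om (eq_bigl (pred1 a)) => [|c]; last exact: inj_eq (vtx_inj ht) _ _.
  rewrite big_pred1_eq (eq_bigl (pred1 b)) => [|c]; last exact: inj_eq (vtx_inj ht) _ _.
  by rewrite big_pred1_eq.
have wN a b : w b (rev_ord a) = - w a (rev_ord b).
  by have /matrixP /(_ a (rev_ord b)) := sw; rewrite adjmE !mxE rev_ordK.
suff good p q : p \in vs -> q \in vs -> (p.1 + q.1 < 0)%R -> om p q = 0.
  move=> a b ab; rewrite -[b]rev_ordK -omE good ?mem_vtx //.
  by rewrite -/(co a) -/(co _) vcolN //; lia.
move: p q; apply: (line_good char2 sgn_neq0 sgn_anti) => p q.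
  rewrite /om exchange_big /= -sumrN; apply: eq_bigr => a _.
  by rewrite -sumrN; apply: eq_bigr => b _; exact: wN.
move=> /(vtxP ht) [a ->] /(vtxP ht) [b ->] ab.
have /cw : (co a <= co (rev_ord b))%R by rewrite vcolN //; move: ab; rewrite -/(co a) -/(co b); lia.
rewrite !mxE => /eqP; rewrite subr_eq0 => /eqP e.
rewrite big_mkcond sum_vertices /=.
have [/matrixP sx _] := uu_diagram_elt.
have e1 : \sum_(c < N) (if line_arrow d (vt a) (vt c)
    then sgn (vt a) (vt c) * om (vt c) (vt b) else 0) = \sum_(c < N) x a c * w c (rev_ord b).
  by apply: eq_bigr => c _; rewrite diagram_eltE omE; case: ifP; rewrite ?mul0r.
(* Skewness of [x] turns right multiplication by [x] into a sum over the arrows which leave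
   [vt b]. *)
have e2 : \sum_(c < N) (if line_arrow d (vt b) (vt c)
    then sgn (vt b) (vt c) * om (vt a) (vt c) else 0) = - \sum_(c < N) w a c * x c (rev_ord b).
  rewrite [in RHS](reindex_inj rev_ord_inj) -sumrN; apply: eq_bigr => c _.
  have := sx b c; rewrite adjmE [RHS]mxE => ->.
  by rewrite diagram_eltE omE; case: ifP; rewrite mulrN opprK mulrC ?mul0r.
by rewrite e1 [X in _ + X]big_mkcond sum_vertices e2 -e subrr.
Qed.

(** Groups are predicates: [parabolic] and [Pg] agree only pointwise, so the property has to be
    transported. *)
Lemma Richardson_ext (P Q : 'M[k]_N -> Prop) (y : 'M[k]_N) :
  (forall g, P g <-> Q g) -> Richardson Q y -> Richardson P y.
Proof.
move=> PQ [U [[[cU coU [sU nU] uU] mU] [Ly [oU [Z cZ oZ]] [dU dZ]]]].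
have orb A : Ad_orbit P y A <-> Ad_orbit Q y A.
  by split=> -[g Pg ->]; exists g => //; apply/PQ.
exists U; split.
  split; first by split=> //; split=> [g /sU|g h] /PQ //; exact: nU.
  move=> K [cK coK [sK nK] uK]; apply: mU; split=> //; split=> [g /sK /PQ //|g h /PQ].
  exact: nK.
split=> //; split=> [A /orb|]; try exact: oU.
  by exists Z => // A /oZ <-.
move=> Z' cZ' h; apply: dZ => // A /orb; exact: h.
Qed.

End DiagramElement.

Theorem theorem3p3 (k : closedFieldType) (N : nat) (t : seq nat)
    (hchar : 2 \notin [pchar k]%R) (hN : 3 <= N) (ht : sumn t <= N./2)
    (hd : proper_dimvec (orth_dimvec N t)) :
  Richardson (parabolic k N (orth_dimvec N t))
             (diagram_elt k N (orth_dimvec N t)).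
Proof.
have char2 : (2%:R != 0 :> k)%R by move: hchar; rewrite inE.
apply: (Richardson_ext (fun g => parabolicP ht g)).
have hu := uu_diagram_elt k ht.
apply: (Richardson_of_surj (vcolN ht) char2 hu).
exact: (surj_of_dual (vcolN ht) char2 hu (fun w => diagram_elt_dual ht char2)).
Qed.
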